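(* Let $p_0,u_0,\rho_0>0$ be constants with $M_0>1$ and let $\theta_W\in(0,\pi/2)$ satisfy $\tan\theta_W\in(w_{sonic},w_* )$. Let $(p,u,v,\rho)$ be a transonic shock solution to Problem B (uniform supersonic flow $(p_0,u_0,0,\rho_0)$ given on $\Sigma_0$, against a ramp of angle $\theta_W$) such that the flow behind the shock-front satisfies $u>0$, the asymptotic conditions $$w\to\tan\theta_W\quad\text{as } (x,y)\to\infty\text{ (in }\mathcal D^+\cup\mathcal S),$$ $$p<p_\infty\quad\text{as }(x,y)\to\infty\text{ on }\mathcal S$$ for some constant $p_\infty<p_*$ (i.e. the downstream pressure is less than $p_\infty$ at all points of $\mathcal S$ sufficiently far from $O$), and, at the vertex $O$ of the ramp (values taken from behind the shock-front), $$w=\tan\theta_W,\qquad p=p_{weak}.$$ Then the solution is the weak transonic shock solution $U_w$.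
   Context: Fix $\gamma>1$. The steady full compressible Euler system for $(p,u,v,\rho)$ (pressure, velocity components, density; $p,\rho>0$) is $$\partial_x(\rho u)+\partial_y(\rho v)=0,\quad \partial_x(\rho u^2+p)+\partial_y(\rho uv)=0,\quad \partial_x(\rho uv)+\partial_y(\rho v^2+p)=0,\quad \tfrac12(u^2+v^2)+\tfrac{c^2}{\gamma-1}=b_0,$$ where $c=\sqrt{\gamma p/\rho}$ is the sonic speed and $b_0=\tfrac12u_0^2+\frac{\gamma p_0}{(\gamma-1)\rho_0}$ (the same on both sides of the shock-front). The Mach number is $M=\sqrt{u^2+v^2}/c$; the flow is supersonic if $M>1$, subsonic if $M<1$. Write $w=v/u$, $c_0=\sqrt{\gamma p_0/\rho_0}$, $M_0=u_0/c_0$. Problem B: $\mathcal D=\{(x,y):x>0,\ y>x\tan\theta_W\}$, $\Sigma_0=\{x=0,\ y\ge0\}$, $\Gamma=\{x>0,\ y=x\tan\theta_W\}$, $O=(0,0)$. Data: $(p,u,v,\rho)=(p_0,u_0,0,\rho_0)$ on $\Sigma_0$ and slip condition $w=\tan\theta_W$ on $\Gamma$. Transonic shock solution of Problem B: a function $f\in C^2((0,\infty))\cap C([0,\infty))$ with $f(0)=0$ and $0<f(y)<y\cot\theta_W$ for $y>0$; shock-front $\mathcal S=\{(f(y),y):y>0\}$ issuing from $O$; $\mathcal D^-=\{(x,y)\in\mathcal D:x<f(y)\}$, $\mathcal D^+=\{(x,y)\in\mathcal D:x>f(y)\}$; and functions $p,u,v,\rho\in L^\infty_{loc}$ which on each of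 $\mathcal D^-$, $\mathcal D^+$ are continuous up to the boundary (one-sided values on $\mathcal S$ and at $O$) and $C^1$ locally up to the boundary away from $O$, such that: the flow is supersonic in $\mathcal D^-$ and subsonic in $\mathcal D^+$ (including boundary values); the Euler system holds pointwise in $\mathcal D^-\cup\mathcal D^+$; the data on $\Sigma_0$ and $\Gamma$ are attained pointwise; and across $\mathcal S$ $$[\rho u]-f'(y)[\rho v]=0,\quad [\rho u^2+p]-f'(y)[\rho uv]=0,\quad [\rho uv]-f'(y)[\rho v^2+p]=0,\qquad [p]>0,$$ where $[q]$ is the value of $q$ on $\mathcal S$ from $\mathcal D^+$ minus that from $\mathcal D^-$. ''Behind the shock-front'' means in $\mathcal D^+$, including boundary values. Shock polar: for $p_0\le p\le p^+:=p_0\big(1+\frac{2\gamma}{\gamma+1}(M_0^2-1)\big)$ let $$h(p)=\frac{\frac p{p_0}-1}{\gamma M_0^2-(\frac p{p_0}-1)}\sqrt{\frac{\frac{2\gamma}{\gamma+1}(M_0^2-1)-(\frac p{p_0}-1)}{\frac p{p_0}+\frac{\gamma-1}{\gamma+1}}}.$$ The possible values of $(w,p)$ behind a shock with upstream state $(p_0,u_0,0,\rho_0)$ satisfy $w=\pm h(p)$. The function $h$ attains its maximum $w_*=h(p_* )$ at a unique $p_*\in(p_0,p^+)$, is strictly increasing on $[p_0,p_*]$ and strictly decreasing on $[p_*,p^+]$. There is a unique $p_{sonic}\in(p_0,p_* )$ for which the state behind the shock is exactly sonic ($M=1$), the state behind being subsonic exactly when $p>p_{sonic}$; $w_{sonic}=h(p_{sonic})$.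 For $\tan\theta_W\in(w_{sonic},w_* )$, $p_{weak}$ is the unique $p\in(p_{sonic},p_* )$ with $h(p)=\tan\theta_W$. Weak transonic shock solution $U_w$: the shock-front is the ray $x=y\cot\alpha$, $y>0$; the state is $(p_0,u_0,0,\rho_0)$ in $\mathcal D^-$, and in $\mathcal D^+$ it is the constant state with $p=p_{weak}$, $w=\tan\theta_W$, $v=uw$, where, with $p=p_{weak}$, $$u=u_0-\frac{p-p_0}{\rho_0u_0},\quad \rho=\rho_0\frac{(\gamma+1)p+(\gamma-1)p_0}{(\gamma-1)p+(\gamma+1)p_0},\quad \sin\alpha=\frac1{M_0}\sqrt{\frac{\gamma+1}{2\gamma}\Big(\frac p{p_0}+\frac{\gamma-1}{\gamma+1}\Big)},\ \ \alpha\in(0,\pi/2).$$ *)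

(* Defs.v *)
From HB Require Import structures.
From mathcomp Require Import all_boot all_order all_algebra.
From mathcomp Require Import all_classical all_reals all_analysis.

Set Implicit Arguments.
Unset Strict Implicit.
Unset Printing Implicit Defensive.

Import Order.TTheory GRing.Theory Num.Theory numFieldNormedType.Exports.

Local Open Scope classical_set_scope.
Local Open Scope ring_scope.

(** * Gas dynamics *)

Definition sonic_speed (R : realType) (gamma p rho : R) : R :=
  Num.sqrt (gamma * p / rho).

Definition mach (R : realType) (gamma p u v rho : R) : R :=
  Num.sqrt (u ^+ 2 + v ^+ 2) / sonic_speed gamma p rho.

Definition mach0 (R : realType) (gamma p0 u0 rho0 : R) : R :=
  u0 / sonic_speed gamma p0 rho0.

Definition bernoulli_constant (R : realType) (gamma p0 u0 rho0 : R) : R :=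
  u0 ^+ 2 / 2 + gamma * p0 / ((gamma - 1) * rho0).

Definition dx (R : realType) (F : R * R -> R) : R * R -> R :=
  'D_((1, 0) : R * R) F.

Definition dy (R : realType) (F : R * R -> R) : R * R -> R :=
  'D_((0, 1) : R * R) F.

Definition euler_at (R : realType) (gamma b0 : R) (p u v rho : R * R -> R)
    (z : R * R) : Prop :=
  [/\ dx (rho \* u) z + dy (rho \* v) z = 0,
      dx (rho \* u \* u \+ p) z + dy (rho \* u \* v) z = 0,
      dx (rho \* u \* v) z + dy (rho \* v \* v \+ p) z = 0 &
      (u z ^+ 2 + v z ^+ 2) / 2
        + sonic_speed gamma (p z) (rho z) ^+ 2 / (gamma - 1) = b0].

(** * Shock polar *)

Definition p_plus (R : realType) (gamma p0 M0 : R) : R :=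
  p0 * (1 + 2 * gamma / (gamma + 1) * (M0 ^+ 2 - 1)).

Definition polar (R : realType) (gamma p0 M0 p : R) : R :=
  (p / p0 - 1) / (gamma * M0 ^+ 2 - (p / p0 - 1))
  * Num.sqrt ((2 * gamma / (gamma + 1) * (M0 ^+ 2 - 1) - (p / p0 - 1))
              / (p / p0 + (gamma - 1) / (gamma + 1))).

Definition u_behind (R : realType) (p0 u0 rho0 p : R) : R :=
  u0 - (p - p0) / (rho0 * u0).

Definition rho_behind (R : realType) (gamma p0 rho0 p : R) : R :=
  rho0 * (((gamma + 1) * p + (gamma - 1) * p0)
          / ((gamma - 1) * p + (gamma + 1) * p0)).

Definition sin_shock_angle (R : realType) (gamma p0 M0 p : R) : R :=
  M0^-1 * Num.sqrt ((gamma + 1) / (2 * gamma)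
                    * (p / p0 + (gamma - 1) / (gamma + 1))).

(* [pstar], [psonic] and [pweak] are introduced by their defining properties,
   each of which determines a unique number when 1 < gamma, 1 < M0. *)
Definition is_pstar (R : realType) (gamma p0 M0 pstar : R) : Prop :=
  p0 < pstar < p_plus gamma p0 M0 /\
  forall p : R, p0 <= p <= p_plus gamma p0 M0 ->
    polar gamma p0 M0 p <= polar gamma p0 M0 pstar.

Definition is_psonic (R : realType) (gamma p0 u0 rho0 pstar psonic : R)
    : Prop :=
  let u := u_behind p0 u0 rho0 psonic in
  let w := polar gamma p0 (mach0 gamma p0 u0 rho0) psonic in
  p0 < psonic < pstar /\
  mach gamma psonic u (u * w) (rho_behind gamma p0 rho0 psonic) = 1.

Definition is_pweak (R : realType) (gamma p0 M0 thetaW pstar psonic pweak : R)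
    : Prop :=
  psonic < pweak < pstar /\ polar gamma p0 M0 pweak = tan thetaW.

(** * Geometry *)

Definition vertex (R : realType) : R * R := (0, 0).

Definition domain (R : realType) (thetaW : R) : set (R * R) :=
  [set z | 0 < z.1 /\ z.1 * tan thetaW < z.2].

Definition Sigma0 (R : realType) : set (R * R) :=
  [set z | z.1 = 0 /\ 0 <= z.2].

Definition ramp (R : realType) (thetaW : R) : set (R * R) :=
  [set z | 0 < z.1 /\ z.2 = z.1 * tan thetaW].

Definition front (R : realType) (f : R -> R) : set (R * R) :=
  [set z | 0 < z.2 /\ z.1 = f z.2].

Definition Dminus (R : realType) (thetaW : R) (f : R -> R) : set (R * R) :=
  domain thetaW `&` [set z | z.1 < f z.2].

Definition Dplus (R : realType) (thetaW : R) (f : R -> R) : set (R * R) :=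
  domain thetaW `&` [set z | f z.2 < z.1].

(** * Boundary values and regularity *)

(* Value at [z] of [F], seen from [A].  It is meaningful (and equal to [F z]
   when [z] belongs to [A]) under [continuous_upto A F] for [z] in the closure
   of [A]. *)
Definition trace (R : realType) (A : set (R * R)) (F : R * R -> R) (z : R * R)
    : R :=
  lim (F @ within A (nbhs z)).

Definition continuous_upto (R : realType) (A : set (R * R)) (F : R * R -> R)
    : Prop :=
  forall z : R * R, closure A z -> cvg (F @ within A (nbhs z)).

(* [F] is C^1 in the open set [A], and its first derivatives extend
   continuously to the boundary of [A] minus the vertex. *)
Definition C1_upto (R : realType) (A : set (R * R)) (F : R * R -> R) : Prop :=
  (forall z : R * R, A z -> derivable F z (1, 0) /\ derivable F z (0, 1)) /\
  forall z : R * R, closure A z -> z <> vertex R ->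
    cvg (dx F @ within A (nbhs z)) /\ cvg (dy F @ within A (nbhs z)).

Definition Linfty_loc (R : realType) (A : set (R * R)) (F : R * R -> R)
    : Prop :=
  forall K : set (R * R), compact K ->
    (F \_ (A `&` K)) \in
      Lfun (@lebesgue_measure R \x @lebesgue_measure R)%E +oo%E.

Definition C2_pos (R : realType) (f : R -> R) : Prop :=
  forall y : R, 0 < y ->
    [/\ derivable f y 1, derivable (derive1 f) y 1 &
        {for y, continuous (derive1 (derive1 f))}].

(** * Transonic shock solutions *)

Definition positive_upto (R : realType) (A : set (R * R)) (F : R * R -> R)
    : Prop :=
  forall z : R * R, closure A z -> 0 < trace A F z.

Definition mach_trace (R : realType) (gamma : R) (A : set (R * R))
    (p u v rho : R * R -> R) (z : R * R) : R :=
  mach gamma (trace A p z) (trace A u z) (trace A v z) (trace A rho z).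

Definition w_trace (R : realType) (A : set (R * R)) (u v : R * R -> R)
    (z : R * R) : R :=
  trace A v z / trace A u z.

Definition jump (R : realType) (thetaW : R) (f : R -> R) (q : R * R -> R)
    (y : R) : R :=
  trace (Dplus thetaW f) q (f y, y) - trace (Dminus thetaW f) q (f y, y).

Definition rankine_hugoniot_at (R : realType) (thetaW : R) (f : R -> R)
    (p u v rho : R * R -> R) (y : R) : Prop :=
  [/\ jump thetaW f (rho \* u) y - derive1 f y * jump thetaW f (rho \* v) y = 0,
      jump thetaW f (rho \* u \* u \+ p) y
        - derive1 f y * jump thetaW f (rho \* u \* v) y = 0 &
      jump thetaW f (rho \* u \* v) y
        - derive1 f y * jump thetaW f (rho \* v \* v \+ p) y = 0].

(* The values of p, u, v, rho on the front and outside the domain play no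
   role: on the front only the two one-sided traces matter. *)
Record transonic_shock_solution (R : realType) (gamma p0 u0 rho0 thetaW : R)
    (f : R -> R) (p u v rho : R * R -> R) : Prop := TransonicShockSolution {
  tss_front_C2 : C2_pos f ;
  tss_front_C0 : {within `[0, +oo[%classic, continuous f} ;
  tss_front_0 : f 0 = 0 ;
  tss_front_domain : forall y : R, 0 < y -> 0 < f y < y / tan thetaW ;
  tss_Linfty : forall F : R * R -> R, [\/ F = p, F = u, F = v | F = rho] ->
    Linfty_loc (Dminus thetaW f `|` Dplus thetaW f) F ;
  tss_regular : forall F : R * R -> R, [\/ F = p, F = u, F = v | F = rho] ->
    forall A : set (R * R), A = Dminus thetaW f \/ A = Dplus thetaW f ->
    continuous_upto A F /\ C1_upto A F ;
  tss_positive : forall A : set (R * R),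
    A = Dminus thetaW f \/ A = Dplus thetaW f ->
    positive_upto A p /\ positive_upto A rho ;
  tss_supersonic : forall z : R * R, closure (Dminus thetaW f) z ->
    1 < mach_trace gamma (Dminus thetaW f) p u v rho z ;
  tss_subsonic : forall z : R * R, closure (Dplus thetaW f) z ->
    mach_trace gamma (Dplus thetaW f) p u v rho z < 1 ;
  tss_euler : forall z : R * R, (Dminus thetaW f `|` Dplus thetaW f) z ->
    euler_at gamma (bernoulli_constant gamma p0 u0 rho0) p u v rho z ;
  tss_Sigma0 : forall z : R * R, Sigma0 z ->
    [/\ trace (Dminus thetaW f) p z = p0, trace (Dminus thetaW f) u z = u0,
        trace (Dminus thetaW f) v z = 0 &
        trace (Dminus thetaW f) rho z = rho0] ;
  tss_ramp : forall z : R * R, ramp thetaW z ->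
    w_trace (Dplus thetaW f) u v z = tan thetaW ;
  tss_rankine_hugoniot : forall y : R, 0 < y ->
    rankine_hugoniot_at thetaW f p u v rho y ;
  tss_entropy : forall y : R, 0 < y -> 0 < jump thetaW f p y
}.

Definition is_weak_solution (R : realType) (gamma p0 u0 rho0 thetaW pweak : R)
    (f : R -> R) (p u v rho : R * R -> R) : Prop :=
  exists alpha : R,
    [/\ 0 < alpha < pi / 2,
        sin alpha =
          sin_shock_angle gamma p0 (mach0 gamma p0 u0 rho0) pweak,
        forall y : R, 0 < y -> f y = y * (cos alpha / sin alpha),
        forall z : R * R, Dminus thetaW f z ->
          [/\ p z = p0, u z = u0, v z = 0 & rho z = rho0] &
        forall z : R * R, Dplus thetaW f z ->
          [/\ p z = pweak, u z = u_behind p0 u0 rho0 pweak,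
              v z = u z * tan thetaW & rho z = rho_behind gamma p0 rho0 pweak]].

(* Main.v *)
Require Import Defs.
From mathcomp Require Import all_boot all_order all_algebra.
From mathcomp Require Import all_classical all_reals all_analysis.
From mathcomp Require Import ring lra.
Import Order.TTheory GRing.Theory Num.Theory numFieldNormedType.Exports.
Local Open Scope classical_set_scope.
Local Open Scope ring_scope.
Set Implicit Arguments.
Unset Strict Implicit.
Unset Printing Implicit Defensive.

(** The flow ahead of the front is the uniform one. As long as its horizontal
    velocity stays above the critical speed, [x] is a time-like variable, and
    the front, behind which the flow is subsonic and moves to the right, is
    crossed outwards by every characteristic ([shock_supersonic_normal],
    [spacelike_front]). So the entropy, then the two Riemann invariants, are
    transported backward to the initial line, where they are constant
    ([transport_max], [upstream_uniform_in_cone]); as the flow that this gives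
    is faster than the critical speed by a fixed margin, it can nowhere become
    slow ([upstream_uniform]).

    The shock relations then put the state behind the front on the shock polar,
    where the pressure and [w = v / u] are explicit functions of the slope
    [f'(y)] of the front ([solution_front_state]).

    Behind the front the pressure and [w] satisfy a first-order elliptic system.
    Its Jacobian determinant [w_y p_x - w_x p_y] is non-negative, and zero only
    where both gradients vanish ([elliptic_jacobian]). Let [Psi] be a
    non-decreasing C1 function that vanishes exactly at distance at most [e]
    from [tan theta]. The integral of [Psi'(w) (w_y p_x - w_x p_y)] over the
    region behind the front, cut off near the vertex and near infinity, is the
    boundary integral of [- Psi(w) dp]. This is zero on the ramp by the slip
    condition, and on the two cuts by the conditions at the vertex and at
    infinity. On the front [Psi(w) dp] is an exact differential in the slope of
    the front, so its integral only depends on the slopes at the two ends. Both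
    belong to the weak branch of the polar, because the pressure there is below
    [pstar]. On this branch [w] is monotone and close to [tan theta] at both
    ends, hence also between them, so the integral over the front is zero too.
    Therefore [w] has zero gradient wherever it differs from [tan theta] by more
    than [e]; as every horizontal line ends on the ramp, there is no such point
    ([flux_degenerate], [deflection_constant]). The solution being only C1, the
    divergence theorem is replaced by a discrete Stokes formula
    ([stokes_degenerate]).

    With [w] constant, the gradient of the pressure is zero and the slope of the
    front stays on one point of the polar ([front_slope_constant]). Velocity and
    density are constant along the streamlines, which come from the front
    ([downstream_uniform]); the condition [p = p_weak] at the vertex identifies
    the state. *)

(** * Calculus in the plane *)

Lemma cvg_within_planeP (R : realType) (A : set (R * R)) (F : R * R -> R)
    (z : R * R) (l : R) :
  F @ within A (nbhs z) --> l <->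
  forall e, 0 < e -> exists d, 0 < d /\ forall z', A z' ->
    `|z'.1 - z.1| < d -> `|z'.2 - z.2| < d -> `|F z' - l| < e.
Proof.
split.
  move=> /cvgrPdist_lt cF e e0; have := cF e e0.
  rewrite near_withinE => /nbhs_ballP[d /= d0 dP]; exists d; split => // z' Az' h1 h2.
  rewrite distrC; apply: dP => //; split; rewrite /ball/= distrC; by [].
move=> cF; apply/cvgrPdist_lt => e e0; have [d [d0 dP]] := cF e e0.
rewrite near_withinE; apply/nbhs_ballP; exists d => //= z' [h1 h2] Az'.
by rewrite distrC; apply: dP => //; rewrite distrC.
Qed.

Lemma within_planeP (R : realType) (A : set (R * R)) (F : R * R -> R) :
  {within A, continuous F} <->
  forall z, A z -> forall e, 0 < e -> exists d, 0 < d /\ forall z', A z' ->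
    `|z'.1 - z.1| < d -> `|z'.2 - z.2| < d -> `|F z' - F z| < e.
Proof.
rewrite subspace_continuousP; split=> h z Az; first exact/cvg_within_planeP/h.
exact/cvg_within_planeP/h.
Qed.

Lemma compact_uniform_continuity (R : realType) (A : set (R * R))
    (F : R * R -> R) : compact A -> {within A, continuous F} ->
  forall e, 0 < e -> exists d, 0 < d /\ forall z z', A z -> A z' ->
    `|z'.1 - z.1| < d -> `|z'.2 - z.2| < d -> `|F z' - F z| < e.
Proof.
move=> /compact_near_coveringP cA /within_planeP cF e e0.
have := cA R (0^'+) (fun d z => forall z', A z -> A z' ->
  `|z'.1 - z.1| < d -> `|z'.2 - z.2| < d -> `|F z' - F z| < e) _.
have cov : forall z, A z -> \forall z' \near z & d \near 0^'+,
    forall y, A z' -> A y -> `|y.1 - z'.1| < d -> `|y.2 - z'.2| < d ->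
      `|F y - F z'| < e.
  move=> z Az; have e20 : 0 < e / 2 by rewrite divr_gt0.
  have [d [d0 dP]] := cF z Az _ e20.
  have d20 : 0 < d / 2 by rewrite divr_gt0.
  exists (ball z (d / 2), [set r | r < d / 2]).
    split => /=; first exact: nbhsx_ballx.
    exact: nbhs_right_lt.
  move=> [z' r] /= [[/= b1 b2] rd] y Az' Ay h1 h2.
  rewrite /ball/= in b1 b2.
  have b1' : `|z'.1 - z.1| < d / 2 by rewrite distrC.
  have b2' : `|z'.2 - z.2| < d / 2 by rewrite distrC.
  have k1 : `|F z' - F z| < e / 2 by apply: dP => //; lra.
  have k2 : `|F y - F z| < e / 2.
    apply: dP => //.
      have := ler_normD (y.1 - z'.1) (z'.1 - z.1); rewrite subrKA; lra.
    have := ler_normD (y.2 - z'.2) (z'.2 - z.2); rewrite subrKA; lra.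
  have := ler_normB (F y - F z) (F z' - F z).
  have -> : F y - F z - (F z' - F z) = F y - F z' by ring.
  lra.
move=> /(_ _ cov) /= nr.
have [d [d0 dP]] := filter_ex (filterI (nbhs_right_gt 0) nr).
exists d; split=> // z z' Az Az'; exact: (dP z Az z' Az Az').
Qed.

Lemma compact_rectangle (R : realType) (a b c d : R) :
  compact (`[a, b]%classic `*` `[c, d]%classic : set (R * R)).
Proof. by apply: compact_setX; exact: segment_compact. Qed.

(** Differentiability tested along curves: the chain rule is the definition,
    so that the rules for sums, products, quotients and compositions reduce to
    those of one variable. *)
Definition has_grad (R : realType) (F : R * R -> R) (z : R * R) (g1 g2 : R)
    : Prop :=
  forall (a b : R -> R) (t da db : R),
    is_derive t (1 : R) a da -> is_derive t (1 : R) b db -> (a t, b t) = z ->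
    is_derive t (1 : R) (fun r => F (a r, b r)) (g1 * da + g2 * db).

Lemma is_derive1_epsP (R : realType) (f : R -> R) (x l : R) :
  is_derive x (1 : R) f l <->
  forall e, 0 < e -> exists d, 0 < d /\ forall y, `|y - x| < d ->
    `|f y - f x - l * (y - x)| <= e * `|y - x|.
Proof.
split.
  move=> /is_derive1_caratheodory[g [fE cg gx]] e e0.
  move: cg => /cvgrPdist_lt/(_ e e0)/nbhs_ballP[d /= d0 dP].
  exists d; split => // y yx; rewrite fE -mulrBl normrM ler_wpM2r//.
  rewrite -gx distrC ltW//; apply: dP; by rewrite /ball/= distrC.
move=> fP; apply/is_derive1_caratheodory.
exists (fun y => if y == x then l else (f y - f x) / (y - x)); split.
- move=> y; case: eqVneq => [->|yx]; first by rewrite !subrr mulr0.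
  by rewrite divfK// subr_eq0.
- apply/cvgrPdist_le => e e0; have [d [d0 dP]] := fP e e0.
  apply/nbhs_ballP; exists d => //= y; rewrite /ball/= eqxx distrC => yx.
  case: eqVneq => [_|ne]; first by rewrite subrr normr0 ltW.
  have n0 : y - x != 0 by rewrite subr_eq0.
  rewrite distrC -(ler_pM2r (_ : 0 < `|y - x|)) ?normr_gt0// -normrM mulrBl divfK//.
  exact: dP.
- by rewrite eqxx.
Qed.

Lemma is_derive_continuous (R : realType) (f : R -> R) (y l : R) :
  is_derive y (1 : R) f l -> {for y, continuous f}.
Proof. by case=> /derivable1_diffP df _; exact: differentiable_continuous. Qed.

Lemma MVT_sym (R : realType) (f df : R -> R) (a b : R) :
  (forall c, `|c - a| <= `|b - a| -> is_derive c (1 : R) f (df c)) ->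
  exists2 c, `|c - a| <= `|b - a| & f b - f a = df c * (b - a).
Proof.
move=> fd; case: (leP a b) => h.
  have nn c : a <= c <= b -> `|c - a| <= `|b - a|.
    by move=> ?; rewrite !ger0_norm ?subr_ge0; lra.
  have d1 c : c \in `]a, b[%R -> is_derive c (1 : R) f (df c).
    by rewrite in_itv/= => /andP[c1 c2]; apply/fd/nn; rewrite !ltW.
  have [|c] := MVT_segment h d1.
    apply: derivable_within_continuous => c; rewrite in_itv/= => ch.
    by have [] := fd c (nn _ ch).
  by rewrite in_itv/= => ch ->; exists c => //; exact: nn.
have nn c : b <= c <= a -> `|c - a| <= `|b - a|.
  by move=> ?; rewrite !ler0_norm ?subr_le0; lra.
have d1 c : c \in `]b, a[%R -> is_derive c (1 : R) f (df c).
  by rewrite in_itv/= => /andP[c1 c2]; apply/fd/nn; rewrite !ltW.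
have [|c] := MVT_segment (ltW h) d1.
  apply: derivable_within_continuous => c; rewrite in_itv/= => ch.
  by have [] := fd c (nn _ ch).
rewrite in_itv/= => ch E; exists c; first exact: nn.
by rewrite -[LHS]opprB E; ring.
Qed.

(** From [z] to [(x, y)] one goes vertically, then horizontally, and the mean
    value theorem is used once on each leg. *)
Lemma C1_expansion (R : realType) (F F1 F2 : R * R -> R) (z : R * R) (r : R) :
  0 < r ->
  (forall x y, `|x - z.1| < r -> `|y - z.2| < r ->
    is_derive x (1 : R) (fun s => F (s, y)) (F1 (x, y)) /\
    is_derive y (1 : R) (fun s => F (x, s)) (F2 (x, y))) ->
  (forall e, 0 < e -> exists d, 0 < d /\ forall x y,
    `|x - z.1| < d -> `|y - z.2| < d ->
    `|F1 (x, y) - F1 z| < e /\ `|F2 (x, y) - F2 z| < e) ->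
  forall e, 0 < e -> exists d, 0 < d /\ forall x y,
    `|x - z.1| < d -> `|y - z.2| < d ->
    `|F (x, y) - F z - F1 z * (x - z.1) - F2 z * (y - z.2)|
      <= e * (`|x - z.1| + `|y - z.2|).
Proof.
move=> r0 dF cF e e0.
have [d [d0 dP]] := cF e e0.
exists (Num.min d r); split; first by rewrite lt_min d0.
move=> x y; rewrite !lt_min => /andP[xd xr] /andP[yd yr].
have [c cx Ec] := @MVT_sym R (fun s => F (s, y)) (fun s => F1 (s, y)) z.1 x
  (fun c ch => (dF c y (le_lt_trans ch xr) yr).1).
have z1r : `|z.1 - z.1| < r by rewrite subrr normr0.
have z1d : `|z.1 - z.1| < d by rewrite subrr normr0.
have [c' cy Ec'] := @MVT_sym R (fun s => F (z.1, s)) (fun s => F2 (z.1, s))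
  z.2 y (fun c ch => (dF z.1 c z1r (le_lt_trans ch yr)).2).
have [k1 _] := dP c y (le_lt_trans cx xd) yd.
have [_ k2] := dP z.1 c' z1d (le_lt_trans cy yd).
have -> : F (x, y) - F z - F1 z * (x - z.1) - F2 z * (y - z.2)
  = (F1 (c, y) - F1 z) * (x - z.1) + (F2 (z.1, c') - F2 z) * (y - z.2).
  rewrite [(F1 _ - _) * _]mulrBl [(F2 _ - _) * _]mulrBl -Ec -Ec'.
  by case: (z) => ? ?/=; ring.
rewrite (le_trans (ler_normD _ _))// [X in _ <= X]mulrDr !normrM.
by rewrite lerD// ler_wpM2r// ltW.
Qed.

Lemma has_grad_C1 (R : realType) (F F1 F2 : R * R -> R) (z : R * R) (r : R) :
  0 < r ->
  (forall x y, `|x - z.1| < r -> `|y - z.2| < r ->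
    is_derive x (1 : R) (fun s => F (s, y)) (F1 (x, y)) /\
    is_derive y (1 : R) (fun s => F (x, s)) (F2 (x, y))) ->
  (forall e, 0 < e -> exists d, 0 < d /\ forall x y,
    `|x - z.1| < d -> `|y - z.2| < d ->
    `|F1 (x, y) - F1 z| < e /\ `|F2 (x, y) - F2 z| < e) ->
  has_grad F z (F1 z) (F2 z).
Proof.
move=> r0 dF cF a b t da db /is_derive1_epsP ad /is_derive1_epsP bd abz.
apply/is_derive1_epsP => e e0.
pose M := `|F1 z| + `|F2 z| + (`|da| + `|db| + 2).
have M1 : 1 <= M by rewrite /M; have := normr_ge0 (F1 z);
  have := normr_ge0 (F2 z); have := normr_ge0 da; have := normr_ge0 db; lra.
pose e1 := e / (2 * M).
have e10 : 0 < e1 by rewrite divr_gt0// mulr_gt0//; lra.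
have [d [d0 dP]] := C1_expansion r0 dF cF e10.
pose e2 := Num.min 1 e1.
have e20 : 0 < e2 by rewrite lt_min ltr01.
have [da' [da0 daP]] := ad _ e20; have [db' [db0 dbP]] := bd _ e20.
have e21 : e2 <= 1 by rewrite ge_min lexx.
have e2e : e2 <= e1 by rewrite ge_min lexx orbT.
pose L := `|da| + `|db| + 2.
have L0 : 0 < L by rewrite /L; have := normr_ge0 da; have := normr_ge0 db; lra.
exists (Num.min (Num.min da' db') (d / L)); split.
  by rewrite !lt_min da0 db0 divr_gt0.
move=> y; rewrite !lt_min => /andP[/andP[yda ydb] ydL].
have {}daP := daP _ yda; have {}dbP := dbP _ ydb.
have z1E : z.1 = a t by rewrite -abz.
have z2E : z.2 = b t by rewrite -abz.
have bound (u u' v : R) : `|u - u' - v * (y - t)| <= e2 * `|y - t| ->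
    `|u - u'| <= (`|v| + 1) * `|y - t|.
  move=> h; have -> : u - u' = (u - u' - v * (y - t)) + v * (y - t) by ring.
  rewrite (le_trans (ler_normD _ _))// normrM addrC mulrDl lerD//.
  by rewrite (le_trans h)// ler_wpM2r.
have aB := bound _ _ _ daP; have bB := bound _ _ _ dbP.
have t0 := normr_ge0 (y - t).
have yL : `|y - t| * L < d by rewrite -ltr_pdivlMr.
have Fz : F (a t, b t) = F z by rewrite abz.
have := dP (a y) (b y); rewrite z1E z2E => hF; have [hF1 hF2] : `|a y - a t| < d /\ `|b y - b t| < d; [split|].
- rewrite (le_lt_trans aB)// (le_lt_trans _ yL)// mulrC ler_wpM2l//.
  by rewrite /L; have := normr_ge0 db; lra.
- rewrite (le_lt_trans bB)// (le_lt_trans _ yL)// mulrC ler_wpM2l//.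
  by rewrite /L; have := normr_ge0 da; lra.
have h := hF hF1 hF2; rewrite Fz.
have -> : F (a y, b y) - F z - (F1 z * da + F2 z * db) * (y - t) =
  (F (a y, b y) - F z - F1 z * (a y - a t) - F2 z * (b y - b t)) +
  (F1 z * (a y - a t - da * (y - t)) + F2 z * (b y - b t - db * (y - t))).
  by ring.
rewrite (le_trans (ler_normD _ _))//.
have h1 : e1 * (`|a y - a t| + `|b y - b t|) <= e1 * (L * `|y - t|).
  rewrite ler_wpM2l ?(ltW e10)//.
  have -> : L = (`|da| + 1) + (`|db| + 1) by rewrite /L; ring.
  by rewrite [X in _ <= X]mulrDl lerD.
have h2 : `|F1 z * (a y - a t - da * (y - t)) + F2 z * (b y - b t - db * (y - t))|
   <= (`|F1 z| + `|F2 z|) * (e1 * `|y - t|).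
  rewrite (le_trans (ler_normD _ _))// !normrM mulrDl lerD//.
    by rewrite ler_wpM2l// (le_trans daP)// ler_wpM2r.
  by rewrite ler_wpM2l// (le_trans dbP)// ler_wpM2r.
have -> : e * `|y - t| = 2 * (M * (e1 * `|y - t|)).
  by rewrite /e1; field; rewrite gt_eqF//; lra.
have ML : M = `|F1 z| + `|F2 z| + L by [].
have -> : 2 * (M * (e1 * `|y - t|)) = M * (e1 * `|y - t|) +
  (`|F1 z| + `|F2 z|) * (e1 * `|y - t|) + e1 * (L * `|y - t|).
  by rewrite ML; ring.
have : 0 <= M * (e1 * `|y - t|) by apply: mulr_ge0; [lra|rewrite mulr_ge0// ltW].
lra.
Qed.

Lemma dxE (R : realType) (F : R * R -> R) (z : R * R) :
  (dx F z = 'D_1 (fun s : R => F (s, z.2)) z.1) *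
  (derivable F z (1, 0) = derivable (fun s : R => F (s, z.2)) z.1 1).
Proof.
have E : (fun h : R => h^-1 *: ((F \o shift z) (h *: ((1 : R), (0 : R))) - F z)) =
  (fun h : R => h^-1 *: (((fun s : R => F (s, z.2)) \o shift z.1) (h *: (1 : R)) -
    F (z.1, z.2))).
  apply/funext => h /=; congr (_ *: (F _ - F _)); last by case: (z).
  by case: (z) => x y/=; congr (_, _); rewrite /= ?scaler0 ?add0r.
by rewrite /dx /derive /derivable E.
Qed.

Lemma dyE (R : realType) (F : R * R -> R) (z : R * R) :
  (dy F z = 'D_1 (fun s : R => F (z.1, s)) z.2) *
  (derivable F z (0, 1) = derivable (fun s : R => F (z.1, s)) z.2 1).
Proof.
have E : (fun h : R => h^-1 *: ((F \o shift z) (h *: ((0 : R), (1 : R))) - F z)) =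
  (fun h : R => h^-1 *: (((fun s : R => F (z.1, s)) \o shift z.2) (h *: (1 : R)) -
    F (z.1, z.2))).
  apply/funext => h /=; congr (_ *: (F _ - F _)); last by case: (z).
  by case: (z) => x y/=; congr (_, _); rewrite /= ?scaler0 ?add0r.
by rewrite /dy /derive /derivable E.
Qed.

Lemma has_grad_dx (R : realType) (F : R * R -> R) (z : R * R) (g1 g2 : R) :
  has_grad F z g1 g2 -> is_derive z.1 (1 : R) (fun s : R => F (s, z.2)) g1.
Proof.
move=> /(_ id (cst z.2) z.1 1 0 (is_derive_id _ _) (is_derive_cst _ _ _)).
by rewrite mulr1 mulr0 addr0; apply; case: (z).
Qed.

Lemma has_grad_dy (R : realType) (F : R * R -> R) (z : R * R) (g1 g2 : R) :
  has_grad F z g1 g2 -> is_derive z.2 (1 : R) (fun s : R => F (z.1, s)) g2.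
Proof.
move=> /(_ (cst z.1) id z.2 0 1 (is_derive_cst _ _ _) (is_derive_id _ _)).
by rewrite mulr1 mulr0 add0r; apply; case: (z).
Qed.

Lemma has_grad_dxE (R : realType) (F : R * R -> R) (z : R * R) (g1 g2 : R) :
  has_grad F z g1 g2 -> dx F z = g1.
Proof. by move=> /has_grad_dx h; rewrite dxE derive_val. Qed.

Lemma has_grad_dyE (R : realType) (F : R * R -> R) (z : R * R) (g1 g2 : R) :
  has_grad F z g1 g2 -> dy F z = g2.
Proof. by move=> /has_grad_dy h; rewrite dyE derive_val. Qed.

Lemma has_grad_eq (R : realType) (F : R * R -> R) (z : R * R) (g1 g2 h1 h2 : R) :
  has_grad F z g1 g2 -> g1 = h1 -> g2 = h2 -> has_grad F z h1 h2.
Proof. by move=> ? <- <-. Qed.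

Lemma has_grad_cst (R : realType) (k : R) (z : R * R) :
  has_grad (fun=> k) z 0 0.
Proof.
by move=> a b t da db _ _ _; apply: (is_derive_eq (is_derive_cst _ _ _)); ring.
Qed.

Lemma has_gradD (R : realType) (F G : R * R -> R) (z : R * R) (f1 f2 g1 g2 : R) :
  has_grad F z f1 f2 -> has_grad G z g1 g2 ->
  has_grad (fun x => F x + G x) z (f1 + g1) (f2 + g2).
Proof.
move=> hF hG a b t da db ha hb E; have := hF _ _ _ _ _ ha hb E.
have := hG _ _ _ _ _ ha hb E => kG kF.
by apply: (is_derive_eq (is_deriveD kF kG)); ring.
Qed.

Lemma has_gradM (R : realType) (F G : R * R -> R) (z : R * R) (f1 f2 g1 g2 : R) :
  has_grad F z f1 f2 -> has_grad G z g1 g2 ->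
  has_grad (fun x => F x * G x) z (F z * g1 + G z * f1) (F z * g2 + G z * f2).
Proof.
move=> hF hG a b t da db ha hb E; have := hF _ _ _ _ _ ha hb E.
have := hG _ _ _ _ _ ha hb E => kG kF.
by apply: (is_derive_eq (is_deriveM kF kG)); rewrite E /GRing.scale/=; ring.
Qed.

Lemma has_gradV (R : realType) (F : R * R -> R) (z : R * R) (f1 f2 : R) :
  F z != 0 -> has_grad F z f1 f2 ->
  has_grad (fun x => (F x)^-1) z (- f1 / F z ^+ 2) (- f2 / F z ^+ 2).
Proof.
move=> Fz hF a b t da db ha hb E; have kF := hF _ _ _ _ _ ha hb E.
have Fn : F (a t, b t) != 0 by rewrite E.
apply: (is_derive_eq (is_deriveV Fn kF)); rewrite E /GRing.scale/=.
by field.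
Qed.

Lemma has_gradN (R : realType) (F : R * R -> R) (z : R * R) (f1 f2 : R) :
  has_grad F z f1 f2 -> has_grad (fun x => - F x) z (- f1) (- f2).
Proof.
move=> hF a b t da db ha hb E; have kF := hF _ _ _ _ _ ha hb E.
by apply: (is_derive_eq (is_deriveN kF)); ring.
Qed.

Lemma has_grad_comp (R : realType) (phi : R -> R) (F : R * R -> R) (z : R * R)
    (f1 f2 k : R) :
  has_grad F z f1 f2 -> is_derive (F z) (1 : R) phi k ->
  has_grad (fun x => phi (F x)) z (k * f1) (k * f2).
Proof.
move=> hF hk a b t da db ha hb E; have kF := hF _ _ _ _ _ ha hb E.
rewrite -E in hk.
by apply: (is_derive_eq (@is_derive1_comp _ phi _ _ _ _ hk kF)); ring.
Qed.

Lemma has_grad_near (R : realType) (F G : R * R -> R) (z : R * R) (g1 g2 : R) :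
  (\forall x \near z, F x = G x) -> has_grad F z g1 g2 -> has_grad G z g1 g2.
Proof.
move=> FG hF a b t da db ha hb E.
apply: near_eq_is_derive (hF _ _ _ _ _ ha hb E).
have ca : {for t, continuous a}.
  by case: ha => /derivable1_diffP ha _; exact: differentiable_continuous.
have cb : {for t, continuous b}.
  by case: hb => /derivable1_diffP hb _; exact: differentiable_continuous.
have cab : (fun r => (a r, b r)) @ t --> (a t, b t).
  exact: (@cvg_pair R R R (nbhs t) (nbhs (a t)) (nbhs (b t)) _ _ _ a b ca cb).
by rewrite E in cab; exact: (cab _ FG).
Qed.

(** * Boundary traces *)

Lemma within_proper (R : realType) (A : set (R * R)) (z : R * R) :
  closure A z -> ProperFilter (within A (nbhs z)).
Proof. by move=> Az; apply: within_nbhs_proper. Qed.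

Lemma trace_lim (R : realType) (A : set (R * R)) (F : R * R -> R) (z : R * R)
    (l : R) : closure A z -> F @ within A (nbhs z) --> l -> trace A F z = l.
Proof.
move=> /within_proper ? Fl; rewrite /trace; apply: cvg_lim => //.
Qed.

Lemma cvg_trace (R : realType) (A : set (R * R)) (F : R * R -> R) (z : R * R) :
  cvg (F @ within A (nbhs z)) -> F @ within A (nbhs z) --> trace A F z.
Proof. by []. Qed.

Lemma trace_interior (R : realType) (A : set (R * R)) (F : R * R -> R)
    (z : R * R) : cvg (F @ within A (nbhs z)) -> A z -> trace A F z = F z.
Proof.
move=> /cvg_trace/cvg_within_planeP cF Az.
apply/eqP; rewrite -subr_eq0 -normr_eq0 eq_sym eq_le normr_ge0/= leNgt.
apply/negP => h; have [d [d0 dP]] := cF _ h.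
by have := dP z Az; rewrite !subrr normr0 => /(_ d0 d0); rewrite distrC ltxx.
Qed.

(** A value of the trace on the boundary is a limit of values inside, which are
    themselves close to the trace at every nearby point. *)
Lemma trace_continuous (R : realType) (A B : set (R * R)) (F : R * R -> R) :
  (forall z, B z -> closure A z /\ cvg (F @ within A (nbhs z))) ->
  {within B, continuous (trace A F)}.
Proof.
move=> h; apply/within_planeP => z Bz e e0.
have [_ /cvg_trace/cvg_within_planeP cF] := h z Bz.
have e20 : 0 < e / 2 by rewrite divr_gt0.
have [d [d0 dP]] := cF _ e20; exists (d / 2); split; first by rewrite divr_gt0.
move=> z' Bz' h1 h2; have [clz' /cvg_trace/cvg_within_planeP cF'] := h z' Bz'.
have [d' [d'0 d'P]] := cF' _ e20.
have m0 : 0 < Num.min d' (d / 2) by rewrite lt_min d'0 divr_gt0.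
have [y [Ay [/= y1 y2]]] := clz' _ (nbhsx_ballx z' _ m0).
move: y1 y2; rewrite /ball/= !lt_min => /andP[y1 y1'] /andP[y2 y2'].
rewrite ![in `|z'.1 - _|]distrC in y1 y1' *; rewrite ![in `|z'.2 - _|]distrC in y2 y2'.
have k1 := d'P y Ay y1 y2.
have k2 : `|F y - trace A F z| < e / 2.
  apply: dP => //.
    have := ler_normD (y.1 - z'.1) (z'.1 - z.1); rewrite subrKA; lra.
  have := ler_normD (y.2 - z'.2) (z'.2 - z.2); rewrite subrKA; lra.
have := ler_normB (F y - trace A F z) (F y - trace A F z').
have -> : F y - trace A F z - (F y - trace A F z') = trace A F z' - trace A F z.
  by ring.
move=> k; apply: (le_lt_trans k); rewrite [ltRHS]splitr; exact: (ltrD k2 k1).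
Qed.

(** The trace merges the interior values and the boundary values into one
    function, to which continuity up to the boundary and differentiability
    inside both apply. *)
Lemma trace_has_grad (R : realType) (A : set (R * R)) (F : R * R -> R)
    (z : R * R) : open A -> continuous_upto A F -> C1_upto A F -> A z ->
  z <> vertex R ->
  has_grad (trace A F) z (trace A (dx F) z) (trace A (dy F) z).
Proof.
move=> oA cF [dF cdF] Az zO.
have inA : \forall x \near z, A x by exact: open_nbhs_nbhs.
apply: (@has_grad_near _ F).
  apply: filterS inA => x Ax.
  by rewrite trace_interior//; apply/cF/subset_closure.
have [c1 c2] := cdF z (subset_closure Az) zO.
rewrite (trace_interior c1 Az) (trace_interior c2 Az).
have /cvg_within_planeP l1 := cvg_trace c1; have /cvg_within_planeP l2 := cvg_trace c2.
rewrite (trace_interior c1 Az) in l1; rewrite (trace_interior c2 Az) in l2.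
have /nbhs_ballP[r /= r0 rA] := inA.
have boxA x y : `|x - z.1| < r -> `|y - z.2| < r -> A (x, y).
  by move=> h1 h2; apply: rA; split; rewrite /ball/= distrC.
apply: (has_grad_C1 r0).
  move=> x y h1 h2; have [h3 h4] := dF _ (boxA _ _ h1 h2); split.
    by move: h3; rewrite dxE/= => h3; apply: (DeriveDef h3); rewrite dxE.
  by move: h4; rewrite dyE/= => h4; apply: (DeriveDef h4); rewrite dyE.
move=> e e0; have [d1 [d10 d1P]] := l1 e e0; have [d2 [d20 d2P]] := l2 e e0.
exists (Num.min r (Num.min d1 d2)); split; first by rewrite !lt_min r0 d10.
move=> x y; rewrite !lt_min => /and3P[? ? ?] /and3P[? ? ?].
by split; [apply: d1P|apply: d2P] => //; exact: boxA.
Qed.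

(** * The Euler system in solved form *)

(** The Euler system solved for the derivatives that the proof uses; names
    ending in 1 and 2 stand for partial derivatives. The first relation is the
    conservation of entropy along streamlines, the next two are the equations of
    momentum, and the last two the system satisfied by the pressure and the flow
    angle: its type changes with the sign of [gamma p / r - (u^2 + v^2)]. *)
Definition euler_relations (R : realType)
    (gamma p u v r p1 p2 u1 u2 v1 v2 r1 r2 : R) : Prop :=
  [/\ r * (u * p1 + v * p2) = gamma * p * (u * r1 + v * r2),
      r * (u * u1 + v * u2) = - p1, r * (u * v1 + v * v2) = - p2,
      gamma * p * (u * v1 - v * u1) = u * v * p1 - (gamma * p / r - v ^+ 2) * p2 &
      gamma * p * (u * v2 - v * u2) = (gamma * p / r - u ^+ 2) * p1 - u * v * p2].

(** The Bernoulli constant is the same everywhere, so the Bernoulli law may be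
    differentiated in both directions. Combined with the equations of momentum it
    gives the conservation of entropy, which turns the conservation of mass into
    [gamma p (u_x + v_y) = - (u p_x + v p_y)]. *)
Lemma euler_relations_algebra (R : realType)
    (gamma p u v r p1 p2 u1 u2 v1 v2 r1 r2 : R) :
  1 < gamma -> 0 < p -> 0 < r ->
  r * u1 + u * r1 + (r * v2 + v * r2) = 0 ->
  (r * u) * u1 + u * (r * u1 + u * r1) + p1
    + ((r * u) * v2 + v * (r * u2 + u * r2)) = 0 ->
  (r * u) * v1 + v * (r * u1 + u * r1)
    + ((r * v) * v2 + v * (r * v2 + v * r2) + p2) = 0 ->
  u * u1 + v * v1 + gamma / (gamma - 1) * (p1 / r - p * r1 / r ^+ 2) = 0 ->
  u * u2 + v * v2 + gamma / (gamma - 1) * (p2 / r - p * r2 / r ^+ 2) = 0 ->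
  euler_relations gamma p u v r p1 p2 u1 u2 v1 v2 r1 r2.
Proof.
move=> g1 p0 r0 M X Y B1 B2.
have X' : r * (u * u1 + v * u2) = - p1.
  have : u * (r * u1 + u * r1 + (r * v2 + v * r2)) = 0 by rewrite M mulr0.
  lra.
have Y' : r * (u * v1 + v * v2) = - p2.
  have : v * (r * u1 + u * r1 + (r * v2 + v * r2)) = 0 by rewrite M mulr0.
  lra.
have gn : gamma - 1 != 0 by rewrite gt_eqF// subr_gt0.
have rn : r != 0 by rewrite gt_eqF.
have B1' : r ^+ 2 * (gamma - 1) * (u * u1 + v * v1) + gamma * (p1 * r - p * r1) = 0.
  rewrite -[RHS](mulr0 (r ^+ 2 * (gamma - 1))) -B1; field.
  by rewrite gn rn.
have B2' : r ^+ 2 * (gamma - 1) * (u * u2 + v * v2) + gamma * (p2 * r - p * r2) = 0.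
  rewrite -[RHS](mulr0 (r ^+ 2 * (gamma - 1))) -B2; field.
  by rewrite gn rn.
have S : r * (u * p1 + v * p2) = gamma * p * (u * r1 + v * r2).
  have : u * (r ^+ 2 * (gamma - 1) * (u * u1 + v * v1) + gamma * (p1 * r - p * r1))
    + v * (r ^+ 2 * (gamma - 1) * (u * u2 + v * v2) + gamma * (p2 * r - p * r2)) = 0.
    by rewrite B1' B2' !mulr0 addr0.
  have -> : u * (r ^+ 2 * (gamma - 1) * (u * u1 + v * v1) + gamma * (p1 * r - p * r1))
    + v * (r ^+ 2 * (gamma - 1) * (u * u2 + v * v2) + gamma * (p2 * r - p * r2)) =
    r * (gamma - 1) * (u * (r * (u * u1 + v * u2)) + v * (r * (u * v1 + v * v2)))
    + gamma * (r * (u * p1 + v * p2) - p * (u * r1 + v * r2)) by ring.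
  rewrite X' Y' => ?; lra.
have D : gamma * p * (u1 + v2) = - (u * p1 + v * p2).
  apply: (mulfI rn); rewrite mulrN S.
  have -> : r * (gamma * p * (u1 + v2)) = gamma * p * (r * u1 + r * v2) by ring.
  have -> : r * u1 + r * v2 = - (u * r1 + v * r2) by lra.
  by ring.
split=> //; apply: (mulfI rn).
- have -> : r * (gamma * p * (u * v1 - v * u1)) =
    gamma * p * (r * (u * v1 + v * v2)) - r * v * (gamma * p * (u1 + v2)) by ring.
  by rewrite Y' D; field.
- have -> : r * (gamma * p * (u * v2 - v * u2)) =
    r * u * (gamma * p * (u1 + v2)) - gamma * p * (r * (u * u1 + v * u2)) by ring.
  by rewrite X' D; field.
Qed.

Lemma euler_at_relations (R : realType) (gamma b0 : R) (A : set (R * R))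
    (p u v rho : R * R -> R) (z : R * R) (p1 p2 u1 u2 v1 v2 r1 r2 : R) :
  1 < gamma -> open A -> A z ->
  (forall x, A x -> 0 < p x /\ 0 < rho x) ->
  (forall x, A x -> euler_at gamma b0 p u v rho x) ->
  has_grad p z p1 p2 -> has_grad u z u1 u2 -> has_grad v z v1 v2 ->
  has_grad rho z r1 r2 ->
  euler_relations gamma (p z) (u z) (v z) (rho z) p1 p2 u1 u2 v1 v2 r1 r2.
Proof.
move=> g1 oA Az pos eul hp hu hv hr.
have [p0 r0] := pos z Az.
have [E1 E2 E3 _] := eul z Az.
have hru := has_gradM hr hu; have hrv := has_gradM hr hv.
rewrite (has_grad_dxE hru) (has_grad_dyE hrv) in E1.
have hruu := has_gradD (has_gradM hru hu) hp.
have hruv := has_gradM hru hv; have hrvv := has_gradD (has_gradM hrv hv) hp.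
rewrite (has_grad_dxE hruu) (has_grad_dyE hruv) in E2.
rewrite (has_grad_dxE hruv) (has_grad_dyE hrvv) in E3.
have gn : gamma - 1 != 0 by rewrite gt_eqF// subr_gt0.
have rn : rho z != 0 by rewrite gt_eqF.
have rz : rho z != 0 by [].
have hB := has_gradD (has_gradM (has_gradD (has_gradM hu hu) (has_gradM hv hv))
  (@has_grad_cst R 2^-1 z)) (has_gradM (has_gradM hp (has_gradV rz hr))
  (@has_grad_cst R (gamma / (gamma - 1)) z)).
have hB0 : has_grad (fun=> b0) z 0 0 := @has_grad_cst R b0 z.
have near_b0 : \forall x \near z,
    (u x * u x + v x * v x) / 2 + p x / rho x * (gamma / (gamma - 1)) = b0.
  have : \forall x \near z, A x by exact: open_nbhs_nbhs.
  apply: filterS => x Ax; have [_ _ _ <-] := eul x Ax; have [px rx] := pos x Ax.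
  rewrite /sonic_speed sqr_sqrtr; last by rewrite divr_ge0 ?mulr_ge0//; lra.
  by rewrite -!expr2; congr (_ + _); field; rewrite gn gt_eqF.
have hBc := has_grad_near near_b0 hB.
have B1 := has_grad_dxE hBc; have B2 := has_grad_dyE hBc.
rewrite (has_grad_dxE hB0) in B1; rewrite (has_grad_dyE hB0) in B2.
apply: euler_relations_algebra => //.
  by rewrite [RHS]B1; field; rewrite gn rn.
by rewrite [RHS]B2; field; rewrite gn rn.
Qed.

(** * Transport along characteristics *)

Lemma within_continuous_along (R : realType) (N : set (R * R))
    (F : R * R -> R) (B : set R) (a b : R -> R) :
  {within N, continuous F} -> {within B, continuous a} ->
  {within B, continuous b} -> (forall s, B s -> N (a s, b s)) ->
  {within B, continuous (fun s => F (a s, b s))}.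
Proof.
move=> /within_planeP cF /subspace_continuousP ca /subspace_continuousP cb BN.
apply/subspace_continuousP => s Bs; apply/cvgrPdist_lt => e e0.
have [d [d0 dP]] := cF _ (BN s Bs) e e0.
have /cvgrPdist_lt/(_ d d0) ha := ca s Bs.
have /cvgrPdist_lt/(_ d d0) hb := cb s Bs.
rewrite !near_withinE in ha hb *; near=> r => Br.
rewrite distrC; apply: dP; first exact: BN.
  by rewrite distrC; move: Br; near: r.
by rewrite distrC; move: Br; near: r.
Unshelve. all: by end_near. Qed.

(** A maximum principle for [F_x + lam F_y = 0]. At a maximum of [F - e x] with
    [0 < x], a backward step of length [t] along the tangent of slope [lam]
    changes [F] by at most [e t / 2] and increases [- e x] by [e t]; hence the
    maximum lies on [x = 0]. Following the tangent rather than the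
    characteristic curve makes the continuity of [lam] sufficient. *)
Lemma transport_max (R : realType) (N : set (R * R))
    (F lam F1 F2 : R * R -> R) (K : R) :
  compact N -> {within N, continuous F} -> {within N, continuous lam} ->
  (forall z, N z -> 0 <= z.1) ->
  (forall z, N z -> z.1 = 0 -> F z <= K) ->
  (forall z, N z -> 0 < z.1 -> exists t0 C, 0 < t0 /\ forall t, 0 < t < t0 ->
    let y := (z.1 - t, z.2 - lam z * t) in
    [/\ N y, has_grad F y (F1 y) (F2 y), F1 y + lam y * F2 y = 0 &
        `|F2 y| <= C]) ->
  forall z, N z -> F z <= K.
Proof.
move=> cN cF clam N0 FK tr z1 Nz1; rewrite leNgt; apply/negP => Kz1.
(* So small that [F - e x] still exceeds [K] at [z1]. *)
pose e := (F z1 - K) / (2 * (z1.1 + 1)).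
have z10 := N0 _ Nz1.
have e0 : 0 < e by rewrite divr_gt0 ?subr_gt0 ?mulr_gt0//; lra.
have eK : K < F z1 - e * z1.1.
  have : e * (2 * (z1.1 + 1)) = F z1 - K by rewrite /e; field; lra.
  nra.
pose G z := F z - e * z.1.
have cG : {within N, continuous G}.
  apply/subspace_continuousP => z Nz; apply: cvgB.
    by move/subspace_continuousP : cF; exact.
  apply: cvgMl_tmp; apply: cvg_within_filter; exact: cvg_fst.
have N00 : N !=set0 by exists z1.
have [z + zmax] := compact_EVT_max N00 cN cG.
rewrite inE => Nz.
have Gz : K < F z - e * z.1.
  by apply: lt_le_trans eK _; apply: zmax; rewrite inE.
have z0 : 0 < z.1.
  rewrite lt_neqAle N0// andbT; apply/eqP => /esym z0; have := FK z Nz z0.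
  by rewrite z0 in Gz; lra.
have [t0 [C [t00 tP]]] := tr z Nz z0.
have C0 : 0 <= C.
  have /tP[_ _ _] : 0 < t0 / 2 < t0 by lra.
  exact: le_trans.
have cC : 0 < e / (2 * (C + 1)) by rewrite divr_gt0// mulr_gt0//; lra.
move/within_planeP : (clam) => /(_ z Nz _ cC)[d [d0 dP]].
pose L := `|lam z| + 1.
have L1 : 1 <= L by rewrite /L; have := normr_ge0 (lam z); lra.
have L0 : 0 < L by lra.
pose t := Num.min (t0 / 2) (d / L / 2).
have t_0 : 0 < t by rewrite lt_min !divr_gt0.
have tt0 : t < t0 by rewrite gt_min; apply/orP; left; lra.
have tL : t * L < d.
  rewrite -ltr_pdivlMr// gt_min; apply/orP; right.
  have : 0 < d / L by rewrite divr_gt0.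
  lra.
pose phi s := F (z.1 - s, z.2 - lam z * s).
have dphi s : s \in `]0, t[%R -> is_derive s (1 : R) phi
    ((lam (z.1 - s, z.2 - lam z * s) - lam z) * F2 (z.1 - s, z.2 - lam z * s)).
  rewrite in_itv/= => /andP[s0 st].
  have /tP[_ gF F12 _] : 0 < s < t0 by rewrite s0 (lt_trans st).
  have d1 : is_derive s (1 : R) (fun s => z.1 - s) (-1).
    by apply: (is_derive_eq (is_deriveB (is_derive_cst _ _ _) (is_derive_id _ _))); ring.
  have d2 : is_derive s (1 : R) (fun s => z.2 - lam z * s) (- lam z).
    apply: (is_derive_eq (is_deriveB (is_derive_cst _ _ _)
      (is_deriveM (is_derive_cst _ _ _) (is_derive_id _ _)))).
    by rewrite /GRing.scale/=; ring.
  apply: (is_derive_eq (gF _ _ _ _ _ d1 d2 erefl)).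
  by move: F12 => /=; lra.
have Nphi s : s \in `[0, t]%classic -> N (z.1 - s, z.2 - lam z * s).
  rewrite inE/= in_itv/= => /andP[]; rewrite le_eqVlt => /predU1P[<- _|s0 st].
    by rewrite mulr0 !subr0; case: (z) Nz.
  by have [] := tP s; rewrite ?s0 ?(le_lt_trans st).
have cphi : {within `[0, t], continuous phi}.
  apply: (@within_continuous_along _ N F _ (fun s => z.1 - s)
    (fun s => z.2 - lam z * s)) => //.
  - apply: continuous_subspaceT => s; apply: cvgB; [exact: cvg_cst|exact: cvg_id].
  - apply: continuous_subspaceT => s; apply: cvgB; first exact: cvg_cst.
    by apply: cvgMl_tmp; exact: cvg_id.
  - by move=> s Bs; apply: Nphi; rewrite inE.
have [s] := MVT t_0 dphi cphi.
rewrite in_itv/= subr0 => /andP[s0 st] E.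
have phi0 : phi 0 = F z by rewrite /phi mulr0 !subr0; case: (z).
have Nt : N (z.1 - t, z.2 - lam z * t).
  by apply: Nphi; rewrite inE/= in_itv/= lexx ltW.
have := zmax (z.1 - t, z.2 - lam z * t).
rewrite inE => /(_ Nt); rewrite /G/= -/(phi t).
have /tP[Ns _ _ F2C] : 0 < s < t0 by rewrite s0 (lt_trans st).
have st0 : s * L < d by apply: le_lt_trans tL; rewrite ler_wpM2r// ltW.
have /ltW h : `|lam (z.1 - s, z.2 - lam z * s) - lam z| < e / (2 * (C + 1)).
  apply: dP => //=.
    have -> : z.1 - s - z.1 = - s by ring.
    rewrite normrN gtr0_norm//; nra.
  have -> : z.2 - lam z * s - z.2 = - (lam z * s) by ring.
  rewrite normrN normrM (gtr0_norm s0) mulrC (le_lt_trans _ st0)//.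
  by rewrite ler_wpM2l ?(ltW s0)// /L lerDl.
have h2 : `|(lam (z.1 - s, z.2 - lam z * s) - lam z) *
     F2 (z.1 - s, z.2 - lam z * s)| <= e / 2.
  rewrite normrM (le_trans (ler_pM _ _ h F2C))//.
  rewrite -subr_ge0.
  have -> : e / 2 - e / (2 * (C + 1)) * C = e / (2 * (C + 1)) by field; lra.
  exact: ltW.
have := ler_norm (- ((lam (z.1 - s, z.2 - lam z * s) - lam z) *
     F2 (z.1 - s, z.2 - lam z * s))).
rewrite normrN; rewrite phi0 in E.
nra.
Qed.

(** * Stokes' formula for C1 functions *)

Lemma product_error (R : realType) (x y X Y E E' : R) :
  `|x - X| <= E -> `|y - Y| <= E' ->
  `|x * y - X * Y| <= `|X| * E' + `|Y| * E + E * E'.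
Proof.
move=> h h'.
have -> : x * y - X * Y = X * (y - Y) + Y * (x - X) + (x - X) * (y - Y) by ring.
rewrite (le_trans (ler_normD _ _))// lerD//; last by rewrite normrM ler_pM.
by rewrite (le_trans (ler_normD _ _))// lerD// normrM ler_wpM2l.
Qed.

(** The trapezoidal rule for the integral of [A dB] along an edge. *)
Definition trapezoid (R : realType) (A B : R * R -> R) (x y : R * R) : R :=
  (A x + A y) / 2 * (B y - B x).

(** Around a cell, the trapezoidal sums of [A dB] add up to an exact quadratic
    expression in the increments along the edges. As these are known from the
    gradients at one point, up to the factor [e], the circulation is the area
    times the Jacobian determinant of [(A, B)]. Green's formula would require a
    second derivative of [B] instead. *)
Lemma cell_estimate (R : realType) (A B : R * R -> R) (z00 z10 z01 z11 : R * R)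
    (h k e C a1 a2 b1 b2 : R) :
  0 < h -> 0 < k -> 0 <= e <= 1 ->
  `|a1| <= C -> `|a2| <= C -> `|b1| <= C -> `|b2| <= C ->
  `|A z10 - A z00 - h * a1| <= e * h -> `|B z10 - B z00 - h * b1| <= e * h ->
  `|A z01 - A z00 - k * a2| <= e * k -> `|B z01 - B z00 - k * b2| <= e * k ->
  `|A z11 - A z10 - k * a2| <= e * k -> `|B z11 - B z10 - k * b2| <= e * k ->
  h * k * (a1 * b2 - a2 * b1) - e * (4 * C + 2) * (h * k + k ^+ 2) <=
  trapezoid A B z00 z10 + trapezoid A B z10 z11 - trapezoid A B z01 z11
    - trapezoid A B z00 z01.
Proof.
move=> h0 k0 /andP[e0 e1] Ca1 Ca2 Cb1 Cb2 Ha Hb La Lb Ra Rb.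
have C0 : 0 <= C by exact: le_trans Ca1.
have -> : trapezoid A B z00 z10 + trapezoid A B z10 z11 - trapezoid A B z01 z11
    - trapezoid A B z00 z01 =
  ((A z10 - A z00) * ((B z01 - B z00) + (B z11 - B z10))
   - (B z10 - B z00) * ((A z01 - A z00) + (A z11 - A z10))
   + ((A z11 - A z10) * (B z01 - B z00) - (A z01 - A z00) * (B z11 - B z10))) / 2.
  by rewrite /trapezoid; field.
set a := A z10 - A z00 in Ha *; set b := B z10 - B z00 in Hb *.
set la := A z01 - A z00 in La *; set lb := B z01 - B z00 in Lb *.
set ra := A z11 - A z10 in Ra *; set rb := B z11 - B z10 in Rb *.
have sum2 (x y X : R) : `|x - k * X| <= e * k -> `|y - k * X| <= e * k ->
    `|x + y - 2 * (k * X)| <= 2 * (e * k).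
  move=> h1 h2; have -> : x + y - 2 * (k * X) = (x - k * X) + (y - k * X) by ring.
  by rewrite (le_trans (ler_normD _ _))//; lra.
have nb (t s : R) : 0 < t -> `|s| <= C -> `|t * s| <= t * C.
  by move=> t0 sC; rewrite normrM gtr0_norm// ler_wpM2l// ltW.
have nb2 (t s : R) : 0 < t -> `|s| <= C -> `|2 * (t * s)| <= 2 * (t * C).
  by move=> t0 sC; rewrite normrM ger0_norm// ler_wpM2l// nb.
have eh : 0 <= e * h by apply: mulr_ge0 => //; exact: ltW.
have ek : 0 <= e * k by apply: mulr_ge0 => //; exact: ltW.
have T (x y X Y E E' N N' : R) : `|x - X| <= E -> `|y - Y| <= E' ->
    `|X| <= N -> `|Y| <= N' -> 0 <= E -> 0 <= E' ->
    `|x * y - X * Y| <= N * E' + N' * E + E * E'.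
  move=> h1 h2 h3 h4 h5 h6; apply: le_trans (product_error h1 h2) _.
  by rewrite lerD2r lerD// ler_wpM2r.
have ek2 : 0 <= 2 * (e * k) by apply: mulr_ge0.
have T1 := T _ _ _ _ _ _ _ _ Ha (sum2 _ _ _ Lb Rb) (nb _ _ h0 Ca1) (nb2 _ _ k0 Cb2) eh ek2.
have T2 := T _ _ _ _ _ _ _ _ Hb (sum2 _ _ _ La Ra) (nb _ _ h0 Cb1) (nb2 _ _ k0 Ca2) eh ek2.
have T3 := T _ _ _ _ _ _ _ _ Ra Lb (nb _ _ k0 Ca2) (nb _ _ k0 Cb2) ek ek.
have T4 := T _ _ _ _ _ _ _ _ La Rb (nb _ _ k0 Ca2) (nb _ _ k0 Cb2) ek ek.
move: T1 T2 T3 T4; rewrite !ler_norml => /andP[T1 _] /andP[_ T2] /andP[T3 _] /andP[_ T4].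
have hk0 : 0 <= h * k by apply: mulr_ge0; exact: ltW.
have kk0 : 0 <= k ^+ 2 by apply: exprn_ge0; exact: ltW.
have m1 : 0 <= e * (1 - e) * (h * k).
  by rewrite mulr_ge0// mulr_ge0// subr_ge0.
have m2 : 0 <= e * (1 - e) * k ^+ 2.
  by rewrite mulr_ge0// mulr_ge0// subr_ge0.
have m3 : 0 <= e * C * k ^+ 2 by apply: mulr_ge0 => //; apply: mulr_ge0.
have m4 : 0 <= e * k ^+ 2 by apply: mulr_ge0.
nra.
Qed.

(** The counterclockwise sums over the cells of a grid telescope to the sum
    over its boundary, as the edge between two cells is run in both
    directions. *)
Lemma trapezoid_telescope (R : realType) (A B : R * R -> R) (x y : nat -> R)
    (n : nat) :
  \sum_(0 <= i < n) \sum_(0 <= j < n)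
    (trapezoid A B (x i, y j) (x i.+1, y j)
     + trapezoid A B (x i.+1, y j) (x i.+1, y j.+1)
     - trapezoid A B (x i, y j.+1) (x i.+1, y j.+1)
     - trapezoid A B (x i, y j) (x i, y j.+1)) =
  \sum_(0 <= i < n) (trapezoid A B (x i, y 0%N) (x i.+1, y 0%N)
    - trapezoid A B (x i, y n) (x i.+1, y n))
  + \sum_(0 <= j < n) (trapezoid A B (x n, y j) (x n, y j.+1)
    - trapezoid A B (x 0%N, y j) (x 0%N, y j.+1)).
Proof.
pose H i j := trapezoid A B (x i, y j) (x i.+1, y j).
pose V i j := trapezoid A B (x i, y j) (x i, y j.+1).
have E : forall i j, trapezoid A B (x i, y j) (x i.+1, y j)
     + trapezoid A B (x i.+1, y j) (x i.+1, y j.+1)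
     - trapezoid A B (x i, y j.+1) (x i.+1, y j.+1)
     - trapezoid A B (x i, y j) (x i, y j.+1)
   = - (H i j.+1 - H i j) + (V i.+1 j - V i j).
  by move=> i j; rewrite /H /V; ring.
under eq_bigr => i _ do (under eq_bigr => j _ do rewrite E).
under eq_bigr => i _ do rewrite big_split/=.
rewrite big_split/=; congr (_ + _).
  apply: eq_bigr => i _; rewrite sumrN telescope_sumr//.
  by rewrite /H; ring.
rewrite exchange_big/=; apply: eq_bigr => j _.
by rewrite telescope_sumr.
Qed.

(** By uniform continuity the gradient at one reference point [z] governs the
    increments along all edges of a cell around it. *)
Lemma horizontal_increment (R : realType) (F G : R * R -> R) (a b e d : R)
    (s s' y : R) (z : R * R) :
  {within `[0, 1]%classic `*` `[a, b]%classic, continuous F} ->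
  (forall x : R * R, 0 < x.1 < 1 -> a <= x.2 <= b ->
    is_derive x.1 (1 : R) (fun t => F (t, x.2)) (G x)) ->
  (forall x x' : R * R, (`[0, 1]%classic `*` `[a, b]%classic) x ->
    (`[0, 1]%classic `*` `[a, b]%classic) x' ->
    `|x'.1 - x.1| < d -> `|x'.2 - x.2| < d -> `|G x' - G x| < e) ->
  0 <= s -> s < s' -> s' <= 1 -> a <= y <= b ->
  (`[0, 1]%classic `*` `[a, b]%classic) z ->
  s' - d < z.1 < s + d -> `|y - z.2| < d ->
  `|F (s', y) - F (s, y) - (s' - s) * G z| <= e * (s' - s).
Proof.
move=> cF dF uG s0 ss' s1 yab Qz /andP[z1 z2] z3.
have cL : {within `[s, s'], continuous (fun t => F (t, y))}.
  apply: (@within_continuous_along _ _ F _ id (cst y)) => //.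
  - by apply: continuous_subspaceT => ?; exact: cvg_id.
  - by apply: continuous_subspaceT => ?; exact: cvg_cst.
  - by move=> t /=; rewrite !in_itv/= => /andP[? ?]; split; lra.
have dL t : t \in `]s, s'[%R -> is_derive t (1 : R) (fun t => F (t, y)) (G (t, y)).
  rewrite in_itv/= => /andP[? ?]; apply: (dF (t, y)) => //=.
  by apply/andP; split; lra.
have [t] := MVT ss' dL cL; rewrite in_itv/= => /andP[t1 t2] ->.
have -> : G (t, y) * (s' - s) - (s' - s) * G z = (G (t, y) - G z) * (s' - s) by ring.
rewrite normrM [X in _ * X]gtr0_norm ?subr_gt0//.
apply: ler_wpM2r; first by rewrite subr_ge0 ltW.
apply/ltW; apply: uG => //=.
  by split => /=; rewrite in_itv/=; lra.
by rewrite ltr_norml; apply/andP; split; lra.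
Qed.

(** Vertical derivatives are given for [0 < s < 1]. The bound passes to the
    sides [s = 0] and [s = 1] by continuity, because it only involves increments
    and the reference point [z]. *)
Lemma vertical_increment (R : realType) (F G : R * R -> R) (a b e d : R)
    (s y y' : R) (z : R * R) :
  {within `[0, 1]%classic `*` `[a, b]%classic, continuous F} ->
  (forall x : R * R, 0 < x.1 < 1 -> a <= x.2 <= b ->
    is_derive x.2 (1 : R) (fun t => F (x.1, t)) (G x)) ->
  (forall x x' : R * R, (`[0, 1]%classic `*` `[a, b]%classic) x ->
    (`[0, 1]%classic `*` `[a, b]%classic) x' ->
    `|x'.1 - x.1| < d -> `|x'.2 - x.2| < d -> `|G x' - G x| < e) ->
  0 <= s <= 1 -> a <= y -> y < y' -> y' <= b ->
  (`[0, 1]%classic `*` `[a, b]%classic) z ->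
  `|s - z.1| < d -> y' - d < z.2 < y + d ->
  `|F (s, y') - F (s, y) - (y' - y) * G z| <= e * (y' - y).
Proof.
move=> cF dF uG s01 ya yy' yb Qz z3 /andP[z1 z2].
have inner t : 0 < t < 1 -> `|t - z.1| < d ->
    `|F (t, y') - F (t, y) - (y' - y) * G z| <= e * (y' - y).
  move=> /andP[t0 t1] tz.
  have cL : {within `[y, y'], continuous (fun r => F (t, r))}.
    apply: (@within_continuous_along _ _ F _ (cst t) id) => //.
    - by apply: continuous_subspaceT => ?; exact: cvg_cst.
    - by apply: continuous_subspaceT => ?; exact: cvg_id.
    - by move=> r /=; rewrite !in_itv/= => /andP[? ?]; split; lra.
  have dL r : r \in `]y, y'[%R -> is_derive r (1 : R) (fun r => F (t, r)) (G (t, r)).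
    rewrite in_itv/= => /andP[? ?]; apply: (dF (t, r)) => //=; first by rewrite t0.
    by apply/andP; split; lra.
  have [r] := MVT yy' dL cL; rewrite in_itv/= => /andP[r1 r2] ->.
  have -> : G (t, r) * (y' - y) - (y' - y) * G z = (G (t, r) - G z) * (y' - y) by ring.
  rewrite normrM [X in _ * X]gtr0_norm ?subr_gt0//.
  apply: ler_wpM2r; first by rewrite subr_ge0 ltW.
  apply/ltW; apply: uG => //=.
    by split => /=; rewrite in_itv/=; lra.
  by rewrite ltr_norml; apply/andP; split; lra.
rewrite leNgt; apply/negP => h.
pose eta := (`|F (s, y') - F (s, y) - (y' - y) * G z| - e * (y' - y)) / 2.
have eta0 : 0 < eta by rewrite divr_gt0// subr_gt0.
have Q1 : (`[0, 1]%classic `*` `[a, b]%classic) (s, y).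
  by split; rewrite /= in_itv/=; lra.
have Q2 : (`[0, 1]%classic `*` `[a, b]%classic) (s, y').
  by split; rewrite /= in_itv/=; lra.
move/within_planeP : (cF) => cF'.
have [d1 [d10 d1P]] := cF' _ Q1 _ eta0; have [d2 [d20 d2P]] := cF' _ Q2 _ eta0.
pose m := Num.min (Num.min d1 d2) (d - `|s - z.1|).
have m0 : 0 < m by rewrite !lt_min d10 d20 subr_gt0.
have [t [t01 ts]] : exists t, 0 < t < 1 /\ `|t - s| < m.
  pose q := Num.min (m / 2) (1 / 4).
  have q0 : 0 < q by rewrite lt_min !divr_gt0.
  have qm : q < m by rewrite gt_min; apply/orP; left; lra.
  have q4 : q <= 1 / 4 by rewrite ge_min lexx orbT.
  case: (leP s (1 / 2)) => hs.
    exists (s + q); split; first by apply/andP; split; lra.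
    by have -> : s + q - s = q by [ring]; rewrite gtr0_norm.
  exists (s - q); split; first by apply/andP; split; lra.
  by have -> : s - q - s = - q by [ring]; rewrite normrN gtr0_norm.
move: (ts); rewrite !lt_min => /andP[/andP[ts1 ts2] ts3].
have tz : `|t - z.1| < d.
  by have := ler_normD (t - s) (s - z.1); rewrite subrKA; lra.
have k := inner t t01 tz.
have k1 : `|F (t, y) - F (s, y)| < eta.
  apply: d1P => //=; last by rewrite subrr normr0.
  by split; rewrite /= in_itv/=; lra.
have k2 : `|F (t, y') - F (s, y')| < eta.
  apply: d2P => //=; last by rewrite subrr normr0.
  by split; rewrite /= in_itv/=; lra.
have := ler_normD (F (t, y') - F (t, y) - (y' - y) * G z)
  ((F (t, y) - F (s, y)) - (F (t, y') - F (s, y'))).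
have := ler_normB (F (t, y) - F (s, y)) (F (t, y') - F (s, y')).
have -> : F (t, y') - F (t, y) - (y' - y) * G z
  + ((F (t, y) - F (s, y)) - (F (t, y') - F (s, y')))
  = F (s, y') - F (s, y) - (y' - y) * G z by ring.
move: k1 k2; rewrite /eta; lra.
Qed.

Lemma compact_bound (R : realType) (Q : set (R * R)) (F : R * R -> R) :
  compact Q -> {within Q, continuous F} ->
  exists C, 0 < C /\ forall z, Q z -> `|F z| <= C.
Proof.
move=> cQ cF.
have /ex_strict_bound_gt0[C C0 FC] : bounded_set (F @` Q).
  exact/compact_bounded/continuous_compact.
by exists C; split => // z Qz; apply/ltW/FC; exists z.
Qed.

Definition rectangle (R : realType) (a b : R) : set (R * R) :=
  `[0, 1]%classic `*` `[a, b]%classic.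

Lemma rectangleP (R : realType) (a b : R) (z : R * R) :
  rectangle a b z <-> (0 <= z.1 <= 1) /\ (a <= z.2 <= b).
Proof. by rewrite /rectangle/= !in_itv. Qed.

Definition C1_rectangle (R : realType) (a b : R) (F F1 F2 : R * R -> R) : Prop :=
  [/\ {within rectangle a b, continuous F},
      {within rectangle a b, continuous F1},
      {within rectangle a b, continuous F2},
      (forall x : R * R, 0 < x.1 < 1 -> a <= x.2 <= b ->
        is_derive x.1 (1 : R) (fun t => F (t, x.2)) (F1 x)) &
      (forall x : R * R, 0 < x.1 < 1 -> a <= x.2 <= b ->
        is_derive x.2 (1 : R) (fun t => F (x.1, t)) (F2 x))].

Definition oscillation_le (R : realType) (Q : set (R * R)) (F : R * R -> R)
    (e d : R) : Prop :=
  forall z z', Q z -> Q z' -> `|z'.1 - z.1| < d -> `|z'.2 - z.2| < d ->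
    `|F z' - F z| < e.

Lemma oscillation_weaken (R : realType) (Q : set (R * R)) (F : R * R -> R)
    (e d d' : R) : d' <= d -> oscillation_le Q F e d -> oscillation_le Q F e d'.
Proof.
move=> dd h z z' Qz Qz' h1 h2; apply: h => //; exact: lt_le_trans dd.
Qed.

Lemma clamp_increment (R : realType) (m M s s' : R) : m <= M -> s <= s' ->
  let c t := Num.max m (Num.min t M) in
  [/\ 0 <= c s' - c s, c s' - c s <= s' - s &
      c s' - c s != 0 -> m < s' /\ s < M].
Proof.
move=> mM ss /=; rewrite /Num.max /Num.min.
case: (ltP s M) => h1; case: (ltP s' M) => h2; case: ltP => h3; case: ltP => h4;
  split; rewrite ?subrr ?eqxx//; lra.
Qed.

Lemma C1_rectangle_horizontal (R : realType) (a b e d h t : R)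
    (F F1 F2 : R * R -> R) (z : R * R) :
  C1_rectangle a b F F1 F2 -> oscillation_le (rectangle a b) F1 e d ->
  0 < h < d -> 0 <= z.1 - h / 2 -> z.1 + h / 2 <= 1 -> a <= z.2 <= b ->
  a <= t <= b -> `|t - z.2| < d ->
  `|F (z.1 - h / 2 + h, t) - F (z.1 - h / 2, t) - h * F1 z| <= e * h.
Proof.
move=> [cF _ _ dF _] uF /andP[h0 hd] z0 z1 zab tab tz.
set s := z.1 - h / 2; have E : s + h - s = h by ring.
have := @horizontal_increment _ F F1 a b e d s (s + h) t z cF dF uF.
rewrite E; apply=> //; rewrite ?ltrDl//.
- by clear -z1; rewrite /s; lra.
- by apply/rectangleP; split => //; clear -z0 z1 h0; apply/andP; split; lra.
- by clear -h0 hd; rewrite /s; apply/andP; split; lra.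
Qed.

Lemma C1_rectangle_vertical (R : realType) (a b e d s k : R)
    (F F1 F2 : R * R -> R) (z : R * R) :
  C1_rectangle a b F F1 F2 -> oscillation_le (rectangle a b) F2 e d ->
  0 < k < d -> 0 <= s <= 1 -> a <= z.2 -> z.2 + k <= b -> 0 <= z.1 <= 1 ->
  `|s - z.1| < d ->
  `|F (s, z.2 + k) - F (s, z.2) - k * F2 z| <= e * k.
Proof.
move=> [cF _ _ _ dF] uF /andP[k0 kd] s01 z0 z1 z01 sz.
have E : z.2 + k - z.2 = k by ring.
have := @vertical_increment _ F F2 a b e d s z.2 (z.2 + k) z cF dF uF.
rewrite E; apply=> //; rewrite ?ltrDl//.
- by apply/rectangleP; split => //; clear -z0 z1 k0; apply/andP; split; lra.
- by clear -k0 kd; apply/andP; split; lra.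
Qed.

Lemma cell_lower_bound (R : realType) (a b C e d h k : R)
    (A A1 A2 B B1 B2 : R * R -> R) (s y : R) (z : R * R) :
  z = (s + h / 2, y) ->
  C1_rectangle a b A A1 A2 -> C1_rectangle a b B B1 B2 ->
  (forall F, [\/ F = A1, F = A2, F = B1 | F = B2] ->
     oscillation_le (rectangle a b) F e d /\
     forall z, rectangle a b z -> `|F z| <= C) ->
  0 < h < d -> 0 < k < d -> 0 <= e <= 1 ->
  0 <= s -> s + h <= 1 -> a <= y -> y + k <= b ->
  h * k * (A1 z * B2 z - A2 z * B1 z) - e * (4 * C + 2) * (h * k + k ^+ 2) <=
  trapezoid A B (s, y) (s + h, y) + trapezoid A B (s + h, y) (s + h, y + k)
    - trapezoid A B (s, y + k) (s + h, y + k) - trapezoid A B (s, y) (s, y + k).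
Proof.
move=> zE CA CB HF hd kd e01 s0 s1 y0 y1.
have /andP[h0 hd'] := hd; have /andP[k0 kd'] := kd.
have z2E : z.2 = y by rewrite zE.
have zs : s = z.1 - h / 2 by rewrite zE/=; ring.
have yab : a <= y <= b by clear -y0 y1 k0; apply/andP; split; lra.
have z10 : 0 <= z.1 - h / 2 by rewrite -zs.
have z11 : z.1 + h / 2 <= 1 by clear -s1 zs; lra.
have z01 : 0 <= z.1 <= 1 by clear -s0 s1 h0 zs; apply/andP; split; lra.
have Qz : rectangle a b z by apply/rectangleP; rewrite z2E.
have [oA1 bA1] := HF A1 (Or41 _ _ _ erefl).
have [oA2 bA2] := HF A2 (Or42 _ _ _ erefl).
have [oB1 bB1] := HF B1 (Or43 _ _ _ erefl).
have [oB2 bB2] := HF B2 (Or44 _ _ _ erefl).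
have z2 : `|y - z.2| < d by rewrite z2E subrr normr0 (lt_trans h0).
have sz : `|s - z.1| < d.
  by clear -h0 hd' zs; rewrite zs ltr_norml; apply/andP; split; lra.
have sz' : `|s + h - z.1| < d.
  by clear -h0 hd' zs; rewrite zs ltr_norml; apply/andP; split; lra.
have s01 : 0 <= s <= 1 by clear -s0 s1 h0; apply/andP; split; lra.
have s01' : 0 <= s + h <= 1 by clear -s0 s1 h0; apply/andP; split; lra.
rewrite -z2E in yab y0 y1 z2 *.
have hA := C1_rectangle_horizontal CA oA1 hd z10 z11 yab yab z2.
have hB := C1_rectangle_horizontal CB oB1 hd z10 z11 yab yab z2.
rewrite -zs in hA hB.
apply: (cell_estimate h0 k0 e01 (bA1 _ Qz) (bA2 _ Qz) (bB1 _ Qz) (bB2 _ Qz)).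
- exact: hA.
- exact: hB.
- exact: (C1_rectangle_vertical CA oA2 kd s01 y0 y1 z01 sz).
- exact: (C1_rectangle_vertical CB oB2 kd s01 y0 y1 z01 sz).
- exact: (C1_rectangle_vertical CA oA2 kd s01' y0 y1 z01 sz').
- exact: (C1_rectangle_vertical CB oB2 kd s01' y0 y1 z01 sz').
Qed.

(** Where [g' = A B_y], the trapezoidal rule approximates the increment of [g]:
    both are [k A B_y] at one point, up to the oscillation of [A] and [B_y]. *)
Lemma boundary_edge (R : realType) (a b C e d k : R)
    (A A1 A2 B B1 B2 : R * R -> R) (g : R -> R) (y : R) :
  C1_rectangle a b A A1 A2 -> C1_rectangle a b B B1 B2 ->
  oscillation_le (rectangle a b) A e d ->
  oscillation_le (rectangle a b) B2 e d ->
  (forall z, rectangle a b z -> `|A z| <= C) ->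
  (forall z, rectangle a b z -> `|B2 z| <= C) ->
  (forall y, a <= y <= b -> is_derive y (1 : R) g (A (0, y) * B2 (0, y))) ->
  0 < k < d -> 0 < e <= 1 -> a <= y -> y + k <= b ->
  `|trapezoid A B (0, y) (0, y + k) - (g (y + k) - g y)|
    <= e * k * (2 * C + 1).
Proof.
move=> CA CB oA oB bA bB dg /andP[k0 kd] /andP[e0 e1] y0 y1.
have yy : y < y + k by rewrite ltrDl.
have dgj t : t \in `]y, y + k[%R -> is_derive t (1 : R) g (A (0, t) * B2 (0, t)).
  rewrite in_itv/= => /andP[? ?]; apply: dg.
  by clear CA CB; apply/andP; split; lra.
have cgj : {within `[y, y + k], continuous g}.
  apply: derivable_within_continuous => t; rewrite in_itv/= => /andP[? ?].
  have [] : is_derive t (1 : R) g (A (0, t) * B2 (0, t)) => //.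
  by apply: dg; clear CA CB; apply/andP; split; lra.
have [t] := MVT yy dgj cgj; rewrite in_itv/= => /andP[t1 t2] ->.
have -> : y + k - y = k by ring.
have in01 : (0 : R) <= (0 : R) <= 1 by apply/andP; split => //; exact: ler01.
have Q r : a <= r <= b -> rectangle a b (0, r) by move=> ?; apply/rectangleP.
have tab : a <= t <= b by clear -t1 t2 y0 y1; apply/andP; split; lra.
have yab : a <= y <= b by clear -y0 y1 k0; apply/andP; split; lra.
have ykab : a <= y + k <= b by clear -y0 y1 k0; apply/andP; split; lra.
have oscA r : a <= r <= b -> `|r - t| < d -> `|A (0, r) - A (0, t)| < e.
  move=> rab rt; apply: (oA _ _ (Q _ tab) (Q _ rab)) => //.
  by rewrite subrr normr0 (lt_trans k0).
have H1 : `|A (0, y) - A (0, t)| < e.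
  by apply: oscA => //; clear -t1 t2 kd k0; rewrite ltr_norml; apply/andP; split; lra.
have H2 : `|A (0, y + k) - A (0, t)| < e.
  by apply: oscA => //; clear -t1 t2 kd k0; rewrite ltr_norml; apply/andP; split; lra.
have H3 : `|(A (0, y) + A (0, y + k)) / 2 - A (0, t)| <= e.
  have -> : (A (0, y) + A (0, y + k)) / 2 - A (0, t) =
    ((A (0, y) - A (0, t)) + (A (0, y + k) - A (0, t))) / 2 by field.
  rewrite normrM [`|2^-1|]gtr0_norm ?invr_gt0//.
  have := ler_normD (A (0, y) - A (0, t)) (A (0, y + k) - A (0, t)).
  by clear -H1 H2; lra.
have H4 : `|B (0, y + k) - B (0, y) - k * B2 (0, t)| <= e * k.
  have [cB _ _ _ dB2] := CB.
  have -> : B (0, y + k) - B (0, y) - k * B2 (0, t) =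
    B (0, y + k) - B (0, y) - (y + k - y) * B2 (0, t) by ring.
  have -> : e * k = e * (y + k - y) by ring.
  apply: (vertical_increment cB dB2 oB _ _ _ _ (Q _ tab)) => //.
    by rewrite subrr normr0 (lt_trans k0).
  by clear -t1 t2 kd; apply/andP; split => /=; lra.
have := product_error H3 H4; rewrite /trapezoid => H.
have -> : A (0, t) * B2 (0, t) * k = A (0, t) * (k * B2 (0, t)) by ring.
apply: le_trans H _.
have K1 := bA _ (Q _ tab); have K2 := bB _ (Q _ tab).
rewrite normrM (gtr0_norm k0).
have ek0 : 0 <= e * k by apply: mulr_ge0; exact: ltW.
have : `|A (0, t)| * (e * k) <= C * (e * k) by rewrite ler_wpM2r.
have : `|B2 (0, t)| * (e * k) <= C * (e * k) by rewrite ler_wpM2r.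
have : e * (e * k) <= 1 * (e * k) by rewrite ler_wpM2r.
by clear; lra.
Qed.

Definition clamp (R : realType) (c r t : R) : R :=
  Num.max (c - r) (Num.min t (c + r)).

Lemma clamp_full (R : realType) (c r a b : R) :
  0 <= r -> a <= c - r -> c + r <= b -> clamp c r b - clamp c r a = 2 * r.
Proof.
move=> r0 h1 h2; have e1 : a <= c + r by lra.
have e2 : c - r <= c + r by lra.
by rewrite /clamp (min_r h2) (max_r e2) (min_l e1) (max_l h1); ring.
Qed.

(** The increments of the clamping function to an interval bound the length of
    the cells that meet this interval and vanish on the other ones: their sums
    give lower bounds for sums of areas of cells. *)
Lemma clamp_cell_bound (R : realType) (c1 c2 r h k s y w kap : R) :
  0 < r -> 0 < h -> 0 < k -> 0 <= w -> 0 <= kap ->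
  (c1 - r < s + h -> s < c1 + r -> c2 - r < y + k -> y < c2 + r -> kap <= w) ->
  kap * ((clamp c1 r (s + h) - clamp c1 r s)
         * (clamp c2 r (y + k) - clamp c2 r y)) <= h * k * w.
Proof.
move=> r0 h0 k0 w0 kap0 H.
have hk0 : 0 <= h * k by apply: mulr_ge0; exact: ltW.
have zr1 : c1 - r <= c1 + r by clear -r0; lra.
have zr2 : c2 - r <= c2 + r by clear -r0; lra.
have xx : s <= s + h by rewrite lerDl ltW.
have yy : y <= y + k by rewrite lerDl ltW.
have [p1 p2 p3] := clamp_increment zr1 xx.
have [q1 q2 q3] := clamp_increment zr2 yy.
rewrite -/(clamp c1 r _) -/(clamp c1 r _) in p1 p2 p3.
rewrite -/(clamp c2 r _) -/(clamp c2 r _) in q1 q2 q3.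
case: (eqVneq (clamp c1 r (s + h) - clamp c1 r s) 0) => [->|/p3[p4 p5]].
  by rewrite mul0r mulr0 mulr_ge0.
case: (eqVneq (clamp c2 r (y + k) - clamp c2 r y) 0) => [->|/q3[q4 q5]].
  by rewrite !mulr0 mulr_ge0.
rewrite [leLHS]mulrC; apply: ler_pM => //; [exact: mulr_ge0| |exact: H].
by apply: ler_pM => //; [move: p2|move: q2]; rewrite addrAC subrr add0r.
Qed.

(** The circulation around the grid is computed in two ways. As a sum over the
    cells it is at least [kap] times the area of the square of centre [z0] and
    side [2 r], up to a multiple of [e]; on the boundary it reduces to the side
    [s = 0], where it is the increment of [g], up to a multiple of [e]. *)
Lemma grid_area_bound (R : realType) (a b C e d r kap : R)
    (A A1 A2 B B1 B2 : R * R -> R) (g : R -> R) (z0 : R * R) (n : nat) :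
  C1_rectangle a b A A1 A2 -> C1_rectangle a b B B1 B2 ->
  (forall F, [\/ F = A1, F = A2, F = B1 | F = B2] \/ F = A ->
     oscillation_le (rectangle a b) F e d /\
     forall z, rectangle a b z -> `|F z| <= C) ->
  (forall y : R, a <= y <= b -> A (1, y) = 0) ->
  (forall s : R, 0 <= s <= 1 -> A (s, a) = 0) ->
  (forall s : R, 0 <= s <= 1 -> A (s, b) = 0) ->
  (forall z : R * R, 0 < z.1 < 1 -> a <= z.2 <= b ->
     0 <= A1 z * B2 z - A2 z * B1 z) ->
  (forall y, a <= y <= b -> is_derive y (1 : R) g (A (0, y) * B2 (0, y))) ->
  g a = g b -> 0 < e <= 1 -> 0 < r -> 0 <= kap ->
  0 <= z0.1 - r -> z0.1 + r <= 1 -> a <= z0.2 - r -> z0.2 + r <= b ->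
  (forall z, rectangle a b z -> `|z.1 - z0.1| < 2 * r ->
     `|z.2 - z0.2| < 2 * r -> kap <= A1 z * B2 z - A2 z * B1 z) ->
  (0 < n)%N -> n%:R^-1 < d -> n%:R^-1 < r ->
  0 < (b - a) / n%:R < d -> (b - a) / n%:R < r ->
  kap * (2 * r * (2 * r)) <=
    e * ((4 * C + 2) * ((b - a) + (b - a) ^+ 2) + (2 * C + 1) * (b - a)).
Proof.
move=> CA CB HF AT Aa Ab Dge dg gab e01 r0 kap0 zl zr zd zu kapD n0 hd hr.
set L := b - a => /andP[k0 kd] kr.
have nR0 : (0 : R) < n%:R by rewrite ltr0n.
have nRn : n%:R != 0 :> R by rewrite gt_eqF.
set h := n%:R^-1 : R in hd hr; set k := L / n%:R in k0 kd kr.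
have h0 : 0 < h by rewrite invr_gt0.
have hd' : 0 < h < d by rewrite h0.
have kd' : 0 < k < d by rewrite k0.
pose x i : R := i%:R * h; pose y j : R := a + j%:R * k.
have xS i : x i.+1 = x i + h by rewrite /x -natr1; ring.
have yS j : y j.+1 = y j + k by rewrite /y -natr1; ring.
have x0 : x 0%N = 0 by rewrite /x mul0r.
have y0 : y 0%N = a by rewrite /y mul0r addr0.
have xn : x n = 1 by rewrite /x /h divff.
have yn : y n = b by rewrite /y /k /L; field.
have xin i : (i < n)%N -> 0 <= x i /\ x i + h <= 1.
  move=> ilt; split; first by rewrite /x mulr_ge0// ltW.
  by rewrite -xS -xn /x ler_wpM2r ?(ltW h0)// ler_nat.
have yin j : (j < n)%N -> a <= y j /\ y j + k <= b.
  move=> jlt; split; first by rewrite /y lerDl mulr_ge0// ltW.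
  by rewrite -yS -yn /y lerD2l ler_wpM2r ?(ltW k0)// ler_nat.
have nhL : n%:R * h = 1 by rewrite /h divff.
have nkL : n%:R * k = L by rewrite /k; field.
clearbody x y h k.
pose D z := A1 z * B2 z - A2 z * B1 z.
pose cell i j := trapezoid A B (x i, y j) (x i.+1, y j)
     + trapezoid A B (x i.+1, y j) (x i.+1, y j.+1)
     - trapezoid A B (x i, y j.+1) (x i.+1, y j.+1)
     - trapezoid A B (x i, y j) (x i, y j.+1).
pose err := e * (4 * C + 2) * (h * k + k ^+ 2).
have cellP i j : (i < n)%N -> (j < n)%N ->
    kap * ((clamp z0.1 r (x i.+1) - clamp z0.1 r (x i))
      * (clamp z0.2 r (y j.+1) - clamp z0.2 r (y j))) - err <= cell i j.
  move=> ilt jlt; have [xi xi1] := xin i ilt; have [yj yj1] := yin j jlt.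
  have HF' F : [\/ F = A1, F = A2, F = B1 | F = B2] ->
     oscillation_le (rectangle a b) F e d /\
     forall z, rectangle a b z -> `|F z| <= C by move=> ?; apply: HF; left.
  have e01' : 0 <= e <= 1 by case/andP: e01 => /ltW-> ->.
  rewrite /cell xS yS.
  have := cell_lower_bound erefl CA CB HF' hd' kd' e01' xi xi1 yj yj1.
  apply: le_trans; rewrite lerD2r; apply: clamp_cell_bound => //.
    apply: Dge => /=; first by clear -xi xi1 h0; apply/andP; split; lra.
    by clear -yj yj1 k0; apply/andP; split; lra.
  move=> p1 p2 p3 p4; apply: kapD.
  - by apply/rectangleP; clear -xi xi1 yj yj1 h0 k0; split; apply/andP => /=; split; lra.
  - by clear -p1 p2 hr h0; rewrite /= ltr_norml; apply/andP; split; lra.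
  - by clear -p3 p4 kr k0; rewrite /= ltr_norml; apply/andP; split; lra.
have total : \sum_(0 <= i < n) \sum_(0 <= j < n) cell i j =
    - \sum_(0 <= j < n) trapezoid A B (x 0%N, y j) (x 0%N, y j.+1).
  rewrite trapezoid_telescope big_nat big1 ?add0r; last first.
    move=> i /andP[_ ilt]; have [xi xi1] := xin i ilt.
    have h1 : 0 <= x i <= 1 by clear -xi xi1 h0; apply/andP; split; lra.
    have h2 : 0 <= x i + h <= 1 by clear -xi xi1 h0; apply/andP; split; lra.
    by rewrite y0 yn /trapezoid xS !Aa// !Ab//; ring.
  rewrite -sumrN big_nat [RHS]big_nat; apply: eq_bigr => j /andP[_ jlt].
  have [yj yj1] := yin j jlt.
  have h1 : a <= y j <= b by clear -yj yj1 k0; apply/andP; split; lra.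
  have h2 : a <= y j + k <= b by clear -yj yj1 k0; apply/andP; split; lra.
  by rewrite xn yS /trapezoid !AT//; ring.
have bdry : `|\sum_(0 <= j < n) trapezoid A B (x 0%N, y j) (x 0%N, y j.+1)|
    <= e * ((2 * C + 1) * L).
  have -> : \sum_(0 <= j < n) trapezoid A B (x 0%N, y j) (x 0%N, y j.+1) =
      \sum_(0 <= j < n) (trapezoid A B (x 0%N, y j) (x 0%N, y j.+1)
        - (g (y j.+1) - g (y j))).
    by rewrite sumrB telescope_sumr// yn y0 gab subrr subr0.
  rewrite (le_trans (ler_norm_sum _ _ _))//.
  have -> : e * ((2 * C + 1) * L) = \sum_(0 <= j < n) e * k * (2 * C + 1).
    by rewrite sumr_const_nat subn0 -[RHS]mulr_natl -nkL; ring.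
  rewrite big_nat [leRHS]big_nat; apply: ler_sum => j /andP[_ jlt].
  have [yj yj1] := yin j jlt.
  rewrite x0 yS.
  have [oA bA] := HF A (or_intror erefl).
  have [oB bB] := HF B2 (or_introl (Or44 _ _ _ erefl)).
  exact: (boundary_edge CA CB oA oB bA bB dg kd' e01 yj yj1).
have lower : kap * (2 * r * (2 * r)) - e * ((4 * C + 2) * (L + L ^+ 2)) <=
    \sum_(0 <= i < n) \sum_(0 <= j < n) cell i j.
  have -> : kap * (2 * r * (2 * r)) - e * ((4 * C + 2) * (L + L ^+ 2)) =
    \sum_(0 <= i < n) \sum_(0 <= j < n)
     (kap * ((clamp z0.1 r (x i.+1) - clamp z0.1 r (x i))
      * (clamp z0.2 r (y j.+1) - clamp z0.2 r (y j))) - err).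
    have inner i : \sum_(0 <= j < n)
       (kap * ((clamp z0.1 r (x i.+1) - clamp z0.1 r (x i))
        * (clamp z0.2 r (y j.+1) - clamp z0.2 r (y j))) - err) =
        (clamp z0.1 r (x i.+1) - clamp z0.1 r (x i)) * (kap * (2 * r)) - err *+ n.
      rewrite sumrB sumr_const_nat subn0 -mulr_sumr -mulr_sumr.
      by rewrite telescope_sumr// yn y0 (@clamp_full _ z0.2 r a b) ?(ltW r0)//; congr (_ - _); ring.
    rewrite (eq_bigr _ (fun i _ => inner i)) sumrB sumr_const_nat subn0.
    rewrite -mulr_suml telescope_sumr// xn x0 (@clamp_full _ z0.1 r 0 1) ?(ltW r0)//.
    rewrite [2 * r * (kap * (2 * r))]mulrCA.
    congr (_ - _).
    rewrite -[RHS]mulr_natr -[(err *+ n)]mulr_natr /err -nkL.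
    have -> : e * (4 * C + 2) * (h * k + k ^+ 2) * n%:R * n%:R =
      e * ((4 * C + 2) * ((n%:R * h) * (n%:R * k) + (n%:R * k) ^+ 2)) by ring.
    by rewrite nhL mul1r.
  rewrite big_nat [leRHS]big_nat; apply: ler_sum => i /andP[_ ilt].
  rewrite big_nat [leRHS]big_nat; apply: ler_sum => j /andP[_ jlt].
  exact: cellP.
move: bdry; rewrite ler_norml => /andP[bd _].
rewrite total in lower.
rewrite mulrDr -lerBlDl; apply: le_trans lower _.
by rewrite lerNl.
Qed.

(** Stokes' formula for functions that are only C1. The integral of [dA /\ dB]
    over the rectangle equals the boundary integral of [A dB], which is zero:
    [A] vanishes on three sides, and on the fourth [A dB = dg] with [g] taking
    equal values at the ends. A continuous non-negative integrand with zero
    integral vanishes. *)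
Lemma stokes_degenerate (R : realType) (a b : R) (A A1 A2 B B1 B2 : R * R -> R)
    (g : R -> R) :
  a < b -> C1_rectangle a b A A1 A2 -> C1_rectangle a b B B1 B2 ->
  (forall y : R, a <= y <= b -> A (1, y) = 0) ->
  (forall s : R, 0 <= s <= 1 -> A (s, a) = 0) ->
  (forall s : R, 0 <= s <= 1 -> A (s, b) = 0) ->
  (forall z : R * R, 0 < z.1 < 1 -> a <= z.2 <= b ->
     0 <= A1 z * B2 z - A2 z * B1 z) ->
  (forall y, a <= y <= b -> is_derive y (1 : R) g (A (0, y) * B2 (0, y))) ->
  g a = g b ->
  forall z : R * R, 0 < z.1 < 1 -> a < z.2 < b -> A1 z * B2 z - A2 z * B1 z = 0.
Proof.
move=> ab CA CB AT Aa Ab Dge dg gab z0 z01 zab.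
have [cA cA1 cA2 _ _] := CA; have [_ cB1 cB2 _ _] := CB.
pose Q := rectangle a b.
have cQ : compact Q by exact: compact_rectangle.
pose D z := A1 z * B2 z - A2 z * B1 z.
have cD : {within Q, continuous D}.
  move: cA1 cA2 cB1 cB2; rewrite !subspace_continuousP => cA1 cA2 cB1 cB2 z Qz.
  by apply: cvgB; apply: cvgM; [exact: cA1|exact: cB2|exact: cA2|exact: cB1].
have [/andP[s00 s01] /andP[y0a y0b]] := conj z01 zab.
have Qz0 : Q z0 by apply/rectangleP; rewrite !ltW.
have Dz0' : 0 <= D z0 by apply: Dge => //; rewrite !ltW.
apply/eqP; rewrite -/(D z0) eq_le Dz0' andbT.
rewrite leNgt; apply/negP => Dz0.
have Dz02 : 0 < D z0 / 2 by rewrite divr_gt0.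
move/within_planeP : cD => /(_ _ Qz0 _ Dz02)[r0 [r00 r0P]].
have [r [r_0 rr0 [rs rs'] [ry ry']]] : exists r, [/\ 0 < r, 2 * r <= r0,
    r <= z0.1 /\ r <= 1 - z0.1 & r <= z0.2 - a /\ r <= b - z0.2].
  exists (Num.min (r0 / 2) (Num.min (Num.min z0.1 (1 - z0.1))
    (Num.min (z0.2 - a) (b - z0.2)))).
  rewrite !lt_min divr_gt0// s00 !subr_gt0 s01 y0a y0b.
  split=> //; first by rewrite mulrC -ler_pdivlMr// ge_min lexx.
    by rewrite !ge_min !lexx !orbT.
  by rewrite !ge_min !lexx !orbT.
have kapD z : Q z -> `|z.1 - z0.1| < 2 * r -> `|z.2 - z0.2| < 2 * r ->
    D z0 / 2 <= D z.
  move=> Qz h1 h2.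
  have := r0P z Qz (lt_le_trans h1 rr0) (lt_le_trans h2 rr0).
  by clear; rewrite ltr_norml => /andP[? ?]; lra.
have [C [C0 CP]] : exists C, 0 < C /\ forall F z,
    [\/ F = A1, F = A2, F = B1 | F = B2] \/ F = A -> Q z -> `|F z| <= C.
  have [CA' [CA0 CAP]] := compact_bound cQ cA.
  have [CA1 [CA10 CA1P]] := compact_bound cQ cA1.
  have [CA2 [CA20 CA2P]] := compact_bound cQ cA2.
  have [CB1 [CB10 CB1P]] := compact_bound cQ cB1.
  have [CB2 [CB20 CB2P]] := compact_bound cQ cB2.
  exists (CA' + CA1 + CA2 + CB1 + CB2); split; first by rewrite !addr_gt0.
  have le5 (x : R) : x \in [:: CA'; CA1; CA2; CB1; CB2] -> x <= CA' + CA1 + CA2 + CB1 + CB2.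
    clear -CA0 CA10 CA20 CB10 CB20; rewrite !inE => /or4P[/eqP->|/eqP->|/eqP->|/orP[/eqP->|/eqP->]]; lra.
  by move=> F z [[|||]|] -> Qz; [apply: le_trans (CA1P _ Qz) _|
    apply: le_trans (CA2P _ Qz) _|apply: le_trans (CB1P _ Qz) _|
    apply: le_trans (CB2P _ Qz) _|apply: le_trans (CAP _ Qz) _];
    apply: le5; rewrite !inE eqxx ?orbT.
pose L := b - a.
have L0 : 0 < L by rewrite subr_gt0.
pose M := (4 * C + 2) * (L + L ^+ 2) + (2 * C + 1) * L.
have M0 : 0 < M.
  by apply: addr_gt0; apply: mulr_gt0 => //; rewrite addr_gt0// ?mulr_gt0// exprn_gt0.
pose low := D z0 / 2 * (2 * r * (2 * r)).
have low0 : 0 < low by rewrite mulr_gt0// mulr_gt0// mulr_gt0.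
have [e [e0 e1 eM]] : exists e, [/\ 0 < e, e <= 1 & e * M < low].
  exists (Num.min 1 (low / (2 * M))); rewrite lt_min ltr01 divr_gt0 ?mulr_gt0//.
  split => //; first by rewrite ge_min lexx.
  apply: (@le_lt_trans _ _ (low / (2 * M) * M)).
    by rewrite ler_pM2r// ge_min lexx orbT.
  have -> : low / (2 * M) * M = low / 2 by field; rewrite gt_eqF.
  by clear -low0; lra.
have [d [d_0 uP]] : exists d, 0 < d /\ forall F,
    [\/ F = A1, F = A2, F = B1 | F = B2] \/ F = A -> oscillation_le Q F e d.
  have [d0 [d00 uA]] := compact_uniform_continuity cQ cA e0.
  have [d1 [d10 uA1]] := compact_uniform_continuity cQ cA1 e0.
  have [d2 [d20 uA2]] := compact_uniform_continuity cQ cA2 e0.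
  have [d3 [d30 uB1]] := compact_uniform_continuity cQ cB1 e0.
  have [d4 [d40 uB2]] := compact_uniform_continuity cQ cB2 e0.
  exists (Num.min (Num.min d0 (Num.min d1 d2)) (Num.min d3 d4)).
  rewrite !lt_min d00 d10 d20 d30 d40; split => // F [[|||]|] ->;
    [apply: oscillation_weaken uA1|apply: oscillation_weaken uA2|
     apply: oscillation_weaken uB1|apply: oscillation_weaken uB2|
     apply: oscillation_weaken uA]; by rewrite !ge_min lexx ?orbT.
have [n [n0 [hd hr] [kd kr]]] : exists n : nat, [/\ (0 < n)%N,
    n%:R^-1 < d /\ n%:R^-1 < r & L / n%:R < d /\ L / n%:R < r].
  pose mesh := Num.min d r.
  have mesh0 : 0 < mesh by rewrite lt_min d_0.
  have L10 : 0 < 1 + L by rewrite addr_gt0.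
  pose n := (Num.bound ((1 + L) / mesh)).+1.
  have n0 : (0 : R) < n%:R by rewrite ltr0n.
  have nmesh : (1 + L) / mesh < n%:R.
    apply: lt_trans (archi_boundP _) _; last by rewrite ltr_nat.
    by rewrite divr_ge0 ?(ltW mesh0)// ltW.
  have key x : x <= 1 + L -> x / n%:R < mesh.
    move=> xL; rewrite ltr_pdivrMr// mulrC -ltr_pdivrMr//.
    by apply: le_lt_trans nmesh; rewrite ler_pM2r ?invr_gt0.
  have := key 1; rewrite lerDl (ltW L0) div1r lt_min => /(_ isT)/andP[? ?].
  by have := key L; rewrite lerDr ler01 lt_min => /(_ isT)/andP[? ?]; exists n.
have HF F : [\/ F = A1, F = A2, F = B1 | F = B2] \/ F = A ->
     oscillation_le Q F e d /\ forall z, Q z -> `|F z| <= C.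
  by move=> HF; split; [exact: uP|move=> z; exact: CP].
have kd' : 0 < L / n%:R < d by rewrite divr_gt0// ltr0n.
have e01 : 0 < e <= 1 by rewrite e0.
have b1 : 0 <= z0.1 - r by rewrite subr_ge0.
have b2 : z0.1 + r <= 1 by rewrite -lerBrDl.
have b3 : a <= z0.2 - r by rewrite lerBrDl -lerBrDr.
have b4 : z0.2 + r <= b by rewrite -lerBrDl.
have := grid_area_bound CA CB HF AT Aa Ab Dge dg gab e01 r_0 (ltW Dz02)
  b1 b2 b3 b4 kapD n0 hd hr kd' kr.
by rewrite -/L -/M -/low leNgt eM.
Qed.

(** * Shock relations and the shock polar *)

Lemma mach_sonic_cmp (R : realType) (gamma p u v r : R) : 0 < gamma * p / r ->
  (mach gamma p u v r < 1 -> u ^+ 2 + v ^+ 2 < gamma * p / r) /\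
  (1 < mach gamma p u v r -> gamma * p / r < u ^+ 2 + v ^+ 2).
Proof.
move=> e0; have c0 : 0 < Num.sqrt (gamma * p / r) by rewrite sqrtr_gt0.
rewrite /mach /sonic_speed; split.
  by rewrite ltr_pdivrMr// mul1r ltr_sqrt.
rewrite ltr_pdivlMr// mul1r => h; rewrite -ltr_sqrt//.
by rewrite -sqrtr_gt0; apply: lt_trans h.
Qed.

(** The square of the speed at which a flow with Bernoulli constant [b0] is
    sonic. *)
Definition critical_speed2 (R : realType) (gamma b0 : R) : R :=
  2 * (gamma - 1) / (gamma + 1) * b0.

(** The critical value is a convex combination of [q2] and [e]. *)
Lemma critical_speed2P (R : realType) (gamma b0 q2 e : R) : 1 < gamma ->
  q2 / 2 + e / (gamma - 1) = b0 ->
  (q2 < e -> q2 < critical_speed2 gamma b0) /\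
  (e < q2 -> critical_speed2 gamma b0 < q2) /\
  (critical_speed2 gamma b0 < q2 -> e < critical_speed2 gamma b0).
Proof.
move=> g1 <-; rewrite /critical_speed2.
have -> : 2 * (gamma - 1) / (gamma + 1) * (q2 / 2 + e / (gamma - 1)) =
  ((gamma - 1) * q2 + 2 * e) / (gamma + 1).
  by field; rewrite !gt_eqF//; lra.
have g10 : 0 < gamma + 1 by lra.
rewrite ltr_pdivlMr// ltr_pdivrMr// ltr_pdivlMr//.
split; [|split]; nra.
Qed.

(** The tangential velocity is continuous across the front, so that the normal
    components obey the one-dimensional shock relations. Dividing them by
    [P - p] leaves the normal Mach number as a function of the pressure
    ratio. *)
Lemma shock_strength (R : realType) (gamma s p u v r P U V Q : R) :
  1 < gamma -> 0 < p -> 0 < r -> 0 < Q -> p != P ->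
  Q * U - r * u - s * (Q * V - r * v) = 0 ->
  (Q * U * U + P) - (r * u * u + p) - s * (Q * U * V - r * u * v) = 0 ->
  (Q * U * V - r * u * v) - s * ((Q * V * V + P) - (r * v * v + p)) = 0 ->
  (u ^+ 2 + v ^+ 2) / 2 + gamma * p / r / (gamma - 1) =
  (U ^+ 2 + V ^+ 2) / 2 + gamma * P / Q / (gamma - 1) ->
  [/\ r * (u - s * v) * (u - U) = P - p,
      r * (u - s * v) * (V - v) = s * (P - p),
      Q * (U - s * V) = r * (u - s * v) &
      2 * r * (u - s * v) ^+ 2
        = (1 + s ^+ 2) * ((gamma + 1) * P + (gamma - 1) * p)].
Proof.
move=> g1 p0 r0 Q0 pP E1 E2 E3 B.
pose m := r * (u - s * v).
have Qm : Q * (U - s * V) = m by rewrite /m; lra.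
have mU : m * (u - U) = P - p.
  have : Q * (U - s * V) * U = m * U by rewrite Qm.
  by rewrite /m; lra.
have mV : m * (V - v) = s * (P - p).
  have : Q * (U - s * V) * V = m * V by rewrite Qm.
  by rewrite /m; lra.
have m0 : m != 0.
  by apply: contra_eq_neq mU => ->; rewrite mul0r eq_sym subr_eq0 eq_sym.
split=> //.
pose un := u - s * v; pose Un := U - s * V.
have run : r * un = m by [].
have QUn : Q * Un = m by [].
have un0 : un != 0 by apply: contra_neq m0 => h; rewrite -run h mulr0.
have Un0 : Un != 0 by apply: contra_neq m0 => h; rewrite -QUn h mulr0.
have rE : r = m / un by rewrite -run mulfK.
have QE : Q = m / Un by rewrite -QUn mulfK.
have tang : s * U + V = s * u + v.
  apply: (mulfI m0); have : m * (s * U + V) = - s * (m * (u - U)) + m * (V - v)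
    + m * (s * u + v) by ring.
  by rewrite mU mV => ->; ring.
have jump : m * (un - Un) = (1 + s ^+ 2) * (P - p).
  have -> : m * (un - Un) = m * (u - U) + s * (m * (V - v)) by rewrite /un /Un; ring.
  by rewrite mU mV; ring.
have N0 : 1 + s ^+ 2 != 0 by rewrite gt_eqF// ltr_wpDr// sqr_ge0.
have g0 : gamma - 1 != 0 by rewrite gt_eqF// subr_gt0.
have K1 : (1 + s ^+ 2) * (u ^+ 2 + v ^+ 2) = un ^+ 2 + (s * u + v) ^+ 2.
  by rewrite /un; ring.
have K2 : (1 + s ^+ 2) * (U ^+ 2 + V ^+ 2) = Un ^+ 2 + (s * U + V) ^+ 2.
  by rewrite /Un; ring.
have B2 : (gamma - 1) * m * (un ^+ 2 - Un ^+ 2)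
    = 2 * gamma * (1 + s ^+ 2) * (P * Un - p * un).
  have -> : un ^+ 2 - Un ^+ 2 = (1 + s ^+ 2) * ((u ^+ 2 + v ^+ 2) - (U ^+ 2 + V ^+ 2)).
    by rewrite mulrBr K1 K2 tang; ring.
  have -> : (u ^+ 2 + v ^+ 2) - (U ^+ 2 + V ^+ 2) =
    2 * (gamma * P / Q / (gamma - 1) - gamma * p / r / (gamma - 1)) by lra.
  rewrite rE QE; field; by rewrite Un0 m0 un0 g0.
have B3 : (gamma - 1) * (P - p) * (un + Un) = 2 * gamma * (P * Un - p * un).
  apply: (mulfI N0).
  have -> : (1 + s ^+ 2) * ((gamma - 1) * (P - p) * (un + Un)) =
    (gamma - 1) * (un + Un) * ((1 + s ^+ 2) * (P - p)) by ring.
  rewrite -jump.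
  have -> : (gamma - 1) * (un + Un) * (m * (un - Un)) =
    (gamma - 1) * m * (un ^+ 2 - Un ^+ 2) by ring.
  by rewrite B2; ring.
have PP : P - p != 0 by rewrite subr_eq0 eq_sym.
apply: (mulfI PP); apply/eqP; rewrite -/un.
have -> : 2 * r * un ^+ 2 = 2 * m * un by rewrite -run; ring.
have B4 : m * ((gamma - 1) * (P - p) * (un + Un)) =
   m * (2 * gamma * (P * Un - p * un)) by rewrite B3.
have mUn : m * Un = m * un - (1 + s ^+ 2) * (P - p) by lra.
apply/eqP.
have : (gamma - 1) * (P - p) * (m * un + m * Un) =
  2 * gamma * (P * (m * Un) - p * (m * un)).
  have -> : (gamma - 1) * (P - p) * (m * un + m * Un) =
    m * ((gamma - 1) * (P - p) * (un + Un)) by ring.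
  by rewrite B4; ring.
by rewrite mUn; clear; lra.
Qed.

(** The horizontal velocity falls from above to below the critical speed, so the
    mass flux [r (u - s v)] through the front has the sign of the pressure jump;
    then the strength relation, with [p < P], makes the normal component
    supersonic. *)
Lemma shock_supersonic_normal (R : realType) (gamma b0 s p u v r P U V Q : R) :
  1 < gamma -> 0 < p -> 0 < r -> 0 < Q -> p < P ->
  Q * U - r * u - s * (Q * V - r * v) = 0 ->
  (Q * U * U + P) - (r * u * u + p) - s * (Q * U * V - r * u * v) = 0 ->
  (Q * U * V - r * u * v) - s * ((Q * V * V + P) - (r * v * v + p)) = 0 ->
  (u ^+ 2 + v ^+ 2) / 2 + gamma * p / r / (gamma - 1) = b0 ->
  (U ^+ 2 + V ^+ 2) / 2 + gamma * P / Q / (gamma - 1) = b0 ->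
  0 < u -> critical_speed2 gamma b0 < u ^+ 2 ->
  0 < U -> U ^+ 2 + V ^+ 2 < gamma * P / Q ->
  0 < u - s * v /\ (1 + s ^+ 2) * (gamma * p / r) < (u - s * v) ^+ 2.
Proof.
move=> g1 p0 r0 Q0 pP E1 E2 E3 B B' u0 uc U0 Usub.
have pP' : p != P by rewrite lt_eqF.
have [mU mV _ K] := shock_strength g1 p0 r0 Q0 pP' E1 E2 E3 (etrans B (esym B')).
have [+ _] := critical_speed2P g1 B' => /(_ Usub) Uc.
have Uu : U < u.
  rewrite -(ltr_pXn2r (_ : (0 < 2)%N)) ?nnegrE ?ltW//.
  by apply: le_lt_trans uc; apply: le_trans (ltW Uc); rewrite lerDl sqr_ge0.
have m0 : 0 < r * (u - s * v).
  by rewrite -(pmulr_lgt0 _ (_ : 0 < u - U)) ?subr_gt0// mU subr_gt0.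
split; first by rewrite -(pmulr_rgt0 _ r0).
rewrite mulrA ltr_pdivrMr//.
have N0 : 0 < 1 + s ^+ 2 by rewrite ltr_pwDl// sqr_ge0.
have : 0 < (1 + s ^+ 2) * ((gamma + 1) * (P - p)).
  by rewrite mulr_gt0// mulr_gt0 ?subr_gt0//; lra.
lra.
Qed.

(** The shock polar, parametrized by the slope [s = f'(y)] of the front, with
    [a = rho0 u0^2]. The pressure and the slope of the velocity behind the front
    become rational functions of [s], smooth up to the normal shock [s = 0],
    where the formula for the polar in terms of the pressure has a square
    root. *)
Definition front_pressure (R : realType) (gamma p0 a s : R) : R :=
  (2 * a / (1 + s ^+ 2) - (gamma - 1) * p0) / (gamma + 1).

Definition front_w (R : realType) (gamma p0 a s : R) : R :=
  2 * s * (a - gamma * p0 - gamma * p0 * s ^+ 2)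
  / ((gamma - 1) * a + 2 * gamma * p0 + ((gamma + 1) * a + 2 * gamma * p0) * s ^+ 2).

Lemma slope_gt0 (R : realType) (s : R) : 0 < 1 + s ^+ 2.
Proof. by rewrite ltr_pwDl// sqr_ge0. Qed.

Lemma front_w_den_gt0 (R : realType) (gamma p0 a s : R) :
  1 < gamma -> 0 < p0 -> 0 < a ->
  0 < (gamma - 1) * a + 2 * gamma * p0 + ((gamma + 1) * a + 2 * gamma * p0) * s ^+ 2.
Proof.
move=> g1 p00 a0.
have ga : 0 < (gamma - 1) * a by rewrite mulr_gt0// subr_gt0.
have gp : 0 < gamma * p0 by rewrite mulr_gt0//; lra.
have ga' : 0 < (gamma + 1) * a by rewrite mulr_gt0//; lra.
apply: ltr_pwDl; first by lra.
by apply: mulr_ge0; [lra|exact: sqr_ge0].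
Qed.

Lemma front_pressureP (R : realType) (gamma p0 a s p : R) : 1 < gamma ->
  2 * a = (1 + s ^+ 2) * ((gamma + 1) * p + (gamma - 1) * p0) ->
  p = front_pressure gamma p0 a s.
Proof.
move=> g1 E; rewrite /front_pressure E; field.
by rewrite !gt_eqF ?slope_gt0//; lra.
Qed.

Lemma front_pressureE (R : realType) (gamma p0 a s : R) : 1 < gamma ->
  2 * a = (1 + s ^+ 2) *
    ((gamma + 1) * front_pressure gamma p0 a s + (gamma - 1) * p0).
Proof.
move=> g1; rewrite /front_pressure; field.
by rewrite !gt_eqF ?slope_gt0//; lra.
Qed.

Lemma front_pressure_gt (R : realType) (gamma p0 a s : R) : 1 < gamma ->
  (p0 < front_pressure gamma p0 a s) = (gamma * p0 * s ^+ 2 < a - gamma * p0).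
Proof.
move=> g1; have g0 : 0 < gamma + 1 by lra.
rewrite /front_pressure ltr_pdivlMr// ltrBrDr ltr_pdivlMr ?slope_gt0//.
by apply/idP/idP => h; lra.
Qed.

Lemma front_pressure_lt (R : realType) (gamma p0 a s t : R) : 1 < gamma ->
  0 < a -> 0 <= s -> 0 <= t ->
  (front_pressure gamma p0 a s < front_pressure gamma p0 a t) = (t < s).
Proof.
move=> g1 a0 s0 t0; have g0 : 0 < gamma + 1 by lra.
rewrite /front_pressure ltr_pM2r ?invr_gt0// ltrD2r.
have a2 : 0 < 2 * a by rewrite mulr_gt0.
rewrite ltr_pM2l// ltf_pV2 ?posrE ?slope_gt0// ltrD2l.
by rewrite ltr_pXn2r ?nnegrE.
Qed.

(** The sign of the difference of two values of [front_w] is that of an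
    expression decreasing in both slopes: past a maximum [front_w] decreases. *)
Lemma front_w_diff (R : realType) (gamma p0 a s t : R) :
  1 < gamma -> 0 < p0 -> 0 < a -> 0 < s -> 0 < t ->
  let al := a - gamma * p0 in let ka := gamma * p0 in
  let A := (gamma - 1) * a + 2 * gamma * p0 in
  let B := (gamma + 1) * a + 2 * gamma * p0 in
  exists k : R, 0 < k /\
  front_w gamma p0 a s - front_w gamma p0 a t =
  k * ((s - t) * (al * A - al * B * (s * t) - ka * A * (s ^+ 2 + s * t + t ^+ 2)
    - ka * B * (s * t) ^+ 2)).
Proof.
move=> g1 p00 a0 s0 t0 al ka A B.
have Ds := front_w_den_gt0 s g1 p00 a0; have Dt := front_w_den_gt0 t g1 p00 a0.
exists (2 / ((A + B * s ^+ 2) * (A + B * t ^+ 2))).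
split; first by rewrite divr_gt0// mulr_gt0.
rewrite /front_w -/al -/ka -/A -/B; field.
by rewrite !gt_eqF.
Qed.

Lemma front_w_decreasing (R : realType) (gamma p0 a ss s t : R) :
  1 < gamma -> 0 < p0 -> gamma * p0 < a -> 0 < ss ->
  (forall r, ss < r -> gamma * p0 * r ^+ 2 <= a - gamma * p0 ->
    front_w gamma p0 a r <= front_w gamma p0 a ss) ->
  ss <= s -> s < t -> gamma * p0 * t ^+ 2 <= a - gamma * p0 ->
  front_w gamma p0 a t < front_w gamma p0 a s.
Proof.
move=> g1 p00 ag ss0 ssmax sss st tmax.
have gp0 : 0 < gamma * p0 by rewrite mulr_gt0//; lra.
have a0 : 0 < a by exact: lt_trans ag.
(* The comparison with an intermediate slope is strict also when [s = ss]. *)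
pose r := (s + t) / 2.
have [rs rt] : s < r /\ r < t by clear -st; rewrite /r; split; lra.
clearbody r.
have s0 : 0 < s by exact: lt_le_trans sss.
have t0 : 0 < t by exact: lt_trans st.
have r0 : 0 < r by exact: lt_trans rs.
have rmax : gamma * p0 * r ^+ 2 <= a - gamma * p0.
  by apply: le_trans tmax; rewrite ler_pM2l// ler_pXn2r// ?nnegrE ltW.
have ssr : ss < r by exact: le_lt_trans rs.
have h := ssmax r ssr rmax.
have [k [k0 kE]] := front_w_diff g1 p00 a0 r0 ss0.
have [k' [k'0 k'E]] := front_w_diff g1 p00 a0 t0 s0.
rewrite -subr_lt0 k'E pmulr_rlt0// pmulr_rlt0 ?subr_gt0//.
move: h; rewrite -subr_le0 kE pmulr_rle0// pmulr_rle0 ?subr_gt0//.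
apply: lt_le_trans.
set A := (gamma - 1) * a + _; set B := (gamma + 1) * a + _.
have gm0 : 0 < gamma - 1 by rewrite subr_gt0.
have gP0 : 0 < gamma + 1 by clear -g1; lra.
have gp2 : 0 < 2 * gamma * p0 by rewrite -mulrA mulr_gt0.
have A0 : 0 < A by apply: addr_gt0 => //; exact: mulr_gt0.
have B0 : 0 < B by apply: addr_gt0 => //; exact: mulr_gt0.
have al0 : 0 < a - gamma * p0 by rewrite subr_gt0.
have rss0 : 0 < r * ss by exact: mulr_gt0.
have ts0 : 0 < t * s by exact: mulr_gt0.
have m1 : r * ss < t * s.
  by apply: (@lt_le_trans _ _ (t * ss)); [rewrite ltr_pM2r|rewrite ler_pM2l].
have m2 : (r * ss) ^+ 2 < (t * s) ^+ 2 by rewrite ltr_pXn2r// nnegrE ltW.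
have m3 : r ^+ 2 + r * ss + ss ^+ 2 < t ^+ 2 + t * s + s ^+ 2.
  apply: ltr_leD; last by rewrite ler_pXn2r// nnegrE ltW.
  by apply: ltrD => //; rewrite ltr_pXn2r// nnegrE ltW.
have k1 : (a - gamma * p0) * B * (r * ss) < (a - gamma * p0) * B * (t * s).
  by rewrite ltr_pM2l// mulr_gt0.
have k2 : gamma * p0 * A * (r ^+ 2 + r * ss + ss ^+ 2)
   < gamma * p0 * A * (t ^+ 2 + t * s + s ^+ 2) by rewrite ltr_pM2l// mulr_gt0.
have k3 : gamma * p0 * B * (r * ss) ^+ 2 < gamma * p0 * B * (t * s) ^+ 2.
  by rewrite ltr_pM2l// mulr_gt0.
by clear -k1 k2 k3; lra.
Qed.

Lemma front_w_gt0 (R : realType) (gamma p0 a s : R) :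
  1 < gamma -> 0 < p0 -> 0 < a -> gamma * p0 * s ^+ 2 < a - gamma * p0 ->
  0 < front_w gamma p0 a s -> 0 < s.
Proof.
move=> g1 p00 a0 h; rewrite /front_w pmulr_lgt0 ?invr_gt0 ?front_w_den_gt0//.
by rewrite pmulr_lgt0 ?subr_gt0// pmulr_rgt0.
Qed.

Lemma sqr_mach0 (R : realType) (gamma p0 u0 rho0 : R) :
  1 < gamma -> 0 < p0 -> 0 < rho0 -> 0 < u0 ->
  mach0 gamma p0 u0 rho0 ^+ 2 = rho0 * u0 ^+ 2 / (gamma * p0) /\
  (1 < mach0 gamma p0 u0 rho0 -> gamma * p0 < rho0 * u0 ^+ 2).
Proof.
move=> g1 p00 r0 u00.
have gp0 : 0 < gamma * p0 by rewrite mulr_gt0//; lra.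
have E : mach0 gamma p0 u0 rho0 ^+ 2 = rho0 * u0 ^+ 2 / (gamma * p0).
  rewrite /mach0 /sonic_speed expr_div_n sqr_sqrtr ?divr_ge0 ?ltW//.
  by field; rewrite !gt_eqF//; lra.
split=> // M1; have : 1 < mach0 gamma p0 u0 rho0 ^+ 2.
  by rewrite exprn_egt1.
by rewrite E ltr_pdivlMr// mul1r.
Qed.

(** The radicand in the formula for the shock polar is the square of the slope of
    the front. *)
Lemma polar_front (R : realType) (gamma p0 u0 rho0 s : R) :
  1 < gamma -> 0 < p0 -> 0 < rho0 -> 0 < u0 -> 0 <= s ->
  let a := rho0 * u0 ^+ 2 in gamma * p0 < a ->
  gamma * p0 * s ^+ 2 <= a - gamma * p0 ->
  polar gamma p0 (mach0 gamma p0 u0 rho0) (front_pressure gamma p0 a s)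
  = front_w gamma p0 a s.
Proof.
move=> g1 p00 r0 u00 s0 a ag sm.
have gp0 : 0 < gamma * p0 by rewrite mulr_gt0//; lra.
have a0 : 0 < a by exact: lt_trans ag.
have [M0 _] := sqr_mach0 g1 p00 r0 u00.
rewrite /polar M0 -/a.
have s1 := slope_gt0 s.
have D := front_w_den_gt0 s g1 p00 a0.
have n1 : gamma + 1 != 0 by rewrite gt_eqF//; lra.
have n2 : 1 + s ^+ 2 != 0 by rewrite gt_eqF.
have n3 : p0 != 0 by rewrite gt_eqF.
have n4 : gamma != 0 by rewrite gt_eqF//; lra.
have n5 : a != 0 by rewrite gt_eqF.
have -> : (2 * gamma / (gamma + 1) * (a / (gamma * p0) - 1) -
    (front_pressure gamma p0 a s / p0 - 1)) /
   (front_pressure gamma p0 a s / p0 + (gamma - 1) / (gamma + 1)) = s ^+ 2.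
  rewrite /front_pressure; field; rewrite n1 n2 n3 n4 ?andbT/=.
  have -> : 2 * a + - ((gamma - 1) * p0) * (1 + s ^+ 2) +
    (gamma - 1) * ((1 + s ^+ 2) * p0) = 2 * a by ring.
  by rewrite mulf_neq0.
rewrite sqrtr_sqr ger0_norm// /front_w /front_pressure.
have DE : (gamma - 1) * a + 2 * gamma * p0 + ((gamma + 1) * a + 2 * gamma * p0) * s ^+ 2
  != 0 by rewrite gt_eqF.
by field; rewrite DE n1 n2 n3 n4.
Qed.

Lemma slope_of_pressure (R : realType) (gamma p0 u0 rho0 p : R) :
  1 < gamma -> 0 < p0 -> 0 < rho0 -> 0 < u0 ->
  let a := rho0 * u0 ^+ 2 in gamma * p0 < a ->
  p0 < p < p_plus gamma p0 (mach0 gamma p0 u0 rho0) ->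
  exists s, [/\ 0 < s, gamma * p0 * s ^+ 2 < a - gamma * p0 &
    front_pressure gamma p0 a s = p].
Proof.
move=> g1 p00 r0 u00 a ag /andP[pp0]; rewrite /p_plus.
have gp0 : 0 < gamma * p0 by rewrite mulr_gt0//; lra.
have gP0 : 0 < gamma + 1 by clear -g1; lra.
have [-> _] := sqr_mach0 g1 p00 r0 u00; rewrite -/a.
have -> : p0 * (1 + 2 * gamma / (gamma + 1) * (a / (gamma * p0) - 1)) =
  (2 * a - (gamma - 1) * p0) / (gamma + 1).
  by field; rewrite !gt_eqF//; lra.
rewrite ltr_pdivlMr// => pm.
pose X := (gamma + 1) * p + (gamma - 1) * p0.
have X0 : 0 < X.
  have k1 : 0 < (gamma - 1) * p0 by rewrite mulr_gt0// subr_gt0.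
  have k2 : 0 < (gamma + 1) * p by rewrite mulr_gt0// (lt_trans p00).
  by rewrite /X addr_gt0.
have Xa : X < 2 * a by rewrite /X; clear -pm; lra.
have q0 : 0 < 2 * a / X - 1 by rewrite subr_gt0 ltr_pdivlMr// mul1r.
exists (Num.sqrt (2 * a / X - 1)).
have E : front_pressure gamma p0 a (Num.sqrt (2 * a / X - 1)) = p.
  apply/esym/front_pressureP => //; rewrite sqr_sqrtr ?ltW// -/X.
  by field; rewrite gt_eqF.
split=> //; first by rewrite sqrtr_gt0.
by rewrite -front_pressure_gt// E.
Qed.

(** The pressure decreases with the slope. Hence the slopes beyond that of [pstar]
    form the weak branch of the polar, which starts at its maximum. *)
Lemma pstar_slope (R : realType) (gamma p0 u0 rho0 pstar : R) :
  1 < gamma -> 0 < p0 -> 0 < rho0 -> 0 < u0 ->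
  let a := rho0 * u0 ^+ 2 in gamma * p0 < a ->
  is_pstar gamma p0 (mach0 gamma p0 u0 rho0) pstar ->
  exists ss, [/\ 0 < ss, front_pressure gamma p0 a ss = pstar &
    forall s t, ss <= s -> s < t -> gamma * p0 * t ^+ 2 <= a - gamma * p0 ->
      front_w gamma p0 a t < front_w gamma p0 a s].
Proof.
move=> g1 p00 r0 u00 a ag [pin pmax].
have a0 : 0 < a by rewrite mulr_gt0// exprn_gt0.
have [ss [ss0 ssm ssP]] := slope_of_pressure g1 p00 r0 u00 ag pin.
exists ss; split=> //; move=> s t; apply: front_w_decreasing => //.
move=> r ssr rm; have rr0 := lt_trans ss0 ssr.
rewrite -!(polar_front g1 p00 r0 u00) ?(ltW ss0) ?(ltW rr0) ?(ltW ssm)//.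
rewrite -/a ssP; apply: pmax.
have h : front_pressure gamma p0 a r < front_pressure gamma p0 a ss.
  by rewrite front_pressure_lt// ltW.
apply/andP; split; last first.
  by rewrite -ssP in pin; case/andP: pin => _ k; rewrite (le_trans (ltW h)) ?ltW.
rewrite leNgt; apply/negP => hlt.
suff : 2 * a < 2 * a by rewrite ltxx.
rewrite {1}(front_pressureE p0 a r g1).
apply: (@lt_le_trans _ _ ((1 + r ^+ 2) * (2 * gamma * p0))).
  by rewrite ltr_pM2l ?slope_gt0//; nra.
by clear -rm; lra.
Qed.

(** The strength relation gives the pressure, the jumps of momentum the velocity,
    and the mass flux the density. *)
Lemma shock_state (R : realType) (gamma s p0 u0 rho0 P U V Q : R) :
  1 < gamma -> 0 < p0 -> 0 < rho0 -> 0 < u0 -> 0 < Q -> p0 < P -> 0 < U ->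
  Q * U - rho0 * u0 - s * (Q * V - rho0 * 0) = 0 ->
  (Q * U * U + P) - (rho0 * u0 * u0 + p0) - s * (Q * U * V - rho0 * u0 * 0) = 0 ->
  (Q * U * V - rho0 * u0 * 0) - s * ((Q * V * V + P) - (rho0 * 0 * 0 + p0)) = 0 ->
  u0 ^+ 2 / 2 + gamma * p0 / rho0 / (gamma - 1) =
  (U ^+ 2 + V ^+ 2) / 2 + gamma * P / Q / (gamma - 1) ->
  let a := rho0 * u0 ^+ 2 in
  [/\ P = front_pressure gamma p0 a s, U = u_behind p0 u0 rho0 P,
      V / U = front_w gamma p0 a s & Q = rho_behind gamma p0 rho0 P].
Proof.
move=> g1 p00 r0 u00 Q0 pP U0 E1 E2 E3 B a.
have B' : (u0 ^+ 2 + 0 ^+ 2) / 2 + gamma * p0 / rho0 / (gamma - 1) =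
  (U ^+ 2 + V ^+ 2) / 2 + gamma * P / Q / (gamma - 1) by rewrite -B; ring.
have pP' : p0 != P by rewrite lt_eqF.
have [mU mV mQ K] := shock_strength g1 p00 r0 Q0 pP' E1 E2 E3 B'.
rewrite mulr0 subr0 in mU mV mQ K.
have a0 : 0 < a by rewrite mulr_gt0// exprn_gt0.
have PE : P = front_pressure gamma p0 a s by apply: front_pressureP => //; rewrite /a mulrA.
have m0 : rho0 * u0 != 0 by rewrite mulf_neq0// gt_eqF.
have rn : rho0 != 0 by rewrite gt_eqF.
have un : u0 != 0 by rewrite gt_eqF.
have UE : U = u0 - (P - p0) / (rho0 * u0).
  by rewrite -mU; field; rewrite rn un.
have VE : V = s * (P - p0) / (rho0 * u0).
  by rewrite -mV; field; rewrite rn un.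
have gP0 : gamma + 1 != 0 by rewrite gt_eqF//; lra.
have sn : 1 + s ^+ 2 != 0 by rewrite gt_eqF// slope_gt0.
have D := front_w_den_gt0 s g1 p00 a0.
have Dn : (gamma - 1) * (rho0 * u0 ^+ 2) + 2 * gamma * p0 +
  ((gamma + 1) * (rho0 * u0 ^+ 2) + 2 * gamma * p0) * s ^+ 2 != 0 by rewrite gt_eqF.
have U0' : u0 - (P - p0) / (rho0 * u0) != 0 by rewrite -UE gt_eqF.
split => //.
- rewrite VE UE {1 2}PE /front_w /front_pressure /a.
  by field; rewrite Dn un rn gP0 sn.
- have Y0 : 0 < (gamma - 1) * P + (gamma + 1) * p0.
    have k1 : 0 < (gamma - 1) * P by rewrite mulr_gt0 ?subr_gt0// (lt_trans p00).
    have k2 : 0 < (gamma + 1) * p0 by rewrite mulr_gt0//; lra.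
    exact: addr_gt0.
  rewrite /rho_behind mulrA; apply: (mulIf (lt0r_neq0 Y0)).
  rewrite divfK ?lt0r_neq0//; apply: (mulfI sn).
  have -> : (1 + s ^+ 2) * (rho0 * ((gamma + 1) * P + (gamma - 1) * p0)) =
    rho0 * ((1 + s ^+ 2) * ((gamma + 1) * P + (gamma - 1) * p0)) by ring.
  rewrite -K.
  have E : rho0 * u0 * (U - s * V) = rho0 * u0 ^+ 2 - (1 + s ^+ 2) * (P - p0).
    have -> : rho0 * u0 * (U - s * V) = rho0 * u0 ^+ 2 - rho0 * u0 * (u0 - U)
      - s * (rho0 * u0 * (V - 0)) by ring.
    by rewrite mU mV; ring.
  have -> : (1 + s ^+ 2) * (Q * ((gamma - 1) * P + (gamma + 1) * p0)) =
    Q * ((1 + s ^+ 2) * ((gamma + 1) * P + (gamma - 1) * p0)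
      - 2 * ((1 + s ^+ 2) * (P - p0))) by ring.
  rewrite -K.
  have -> : Q * (2 * rho0 * u0 ^+ 2 - 2 * ((1 + s ^+ 2) * (P - p0))) =
    2 * Q * (rho0 * u0 ^+ 2 - (1 + s ^+ 2) * (P - p0)) by ring.
  rewrite -E.
  have -> : 2 * Q * (rho0 * u0 * (U - s * V)) = 2 * (rho0 * u0) * (Q * (U - s * V)) by ring.
  by rewrite mQ; ring.
Qed.

(** * Geometry of the flow regions *)

Lemma tan_gt0 (R : realType) (t : R) : 0 < t < pi / 2 -> 0 < tan t.
Proof.
move=> /andP[t0 t2]; rewrite /tan divr_gt0//.
  by apply: sin_gt0_pihalf; rewrite t0.
apply: cos_gt0_pihalf; rewrite t2 andbT; apply: lt_trans t0.
by rewrite oppr_lt0 divr_gt0// pi_gt0.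
Qed.

Record front_curve (R : realType) (T : R) (f : R -> R) : Prop := FrontCurve {
  fc_tan : 0 < T ;
  fc_C2 : C2_pos f ;
  fc_C0 : {within `[0, +oo[%classic, continuous f} ;
  fc_0 : f 0 = 0 ;
  fc_domain : forall y, 0 < y -> 0 < f y < y / T }.

Lemma front_curve_derive (R : realType) (T : R) (f : R -> R) (y : R) :
  front_curve T f -> 0 < y -> is_derive y (1 : R) f (derive1 f y).
Proof.
move=> Hf y0; have [df _ _] := fc_C2 Hf y0.
by apply: (DeriveDef df); rewrite derive1E.
Qed.

Lemma front_curve_derive2 (R : realType) (T : R) (f : R -> R) (y : R) :
  front_curve T f -> 0 < y ->
  is_derive y (1 : R) (derive1 f) (derive1 (derive1 f) y).
Proof.
move=> Hf y0; have [_ df _] := fc_C2 Hf y0.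
by apply: (DeriveDef df); rewrite derive1E.
Qed.

Lemma front_curve_continuous (R : realType) (T : R) (f : R -> R) (y e : R) :
  front_curve T f -> 0 <= y -> 0 < e -> exists d, 0 < d /\ forall y', 0 <= y' ->
    `|y' - y| < d -> `|f y' - f y| < e.
Proof.
move=> Hf y0 e0; have /subspace_continuousP cf := fc_C0 Hf.
have yi : `[0, +oo[%classic y by rewrite /= in_itv/= y0.
have /cvgrPdist_lt/(_ e e0) := cf y yi.
rewrite near_withinE => /nbhs_ballP[d /= d0 dP]; exists d; split=> // y' y'0 yy.
rewrite distrC; apply: dP; first by rewrite /ball/= distrC.
by rewrite /= in_itv/= y'0.
Qed.

Lemma DminusP (R : realType) (theta : R) (f : R -> R) (z : R * R) :
  front_curve (tan theta) f ->
  Dminus theta f z <-> [/\ 0 < z.2, 0 < z.1 & z.1 < f z.2].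
Proof.
move=> Hf; have T0 := fc_tan Hf; rewrite /Dminus /domain/=; split.
  move=> [[z1 z2] zf]; split=> //.
  by apply: le_lt_trans z2; rewrite mulr_ge0// ltW.
move=> [z2 z1 zf]; split=> //; split=> //.
have /andP[_ h] := fc_domain Hf z2.
by rewrite -ltr_pdivlMr//; exact: lt_trans h.
Qed.

Lemma DplusP (R : realType) (theta : R) (f : R -> R) (z : R * R) :
  front_curve (tan theta) f ->
  Dplus theta f z <-> [/\ 0 < z.2, f z.2 < z.1 & z.1 < z.2 / tan theta].
Proof.
move=> Hf; have T0 := fc_tan Hf; rewrite /Dplus /domain/=; split.
  move=> [[z1 z2] zf]; split=> //; last by rewrite ltr_pdivlMr.
  by apply: le_lt_trans z2; rewrite mulr_ge0// ltW.
move=> [z2 zf zT]; split=> //; split; last by rewrite -ltr_pdivlMr.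
have /andP[h _] := fc_domain Hf z2.
exact: lt_trans zf.
Qed.

Lemma open_planeP (R : realType) (A : set (R * R)) :
  (forall z, A z -> exists d, 0 < d /\ forall z', `|z'.1 - z.1| < d ->
    `|z'.2 - z.2| < d -> A z') -> open A.
Proof.
move=> h; rewrite openE => z /h[d [d0 dP]]; apply/nbhs_ballP; exists d => //= z'.
by move=> [h1 h2]; apply: dP; rewrite distrC.
Qed.

Lemma closure_planeP (R : realType) (A : set (R * R)) (z : R * R) :
  (forall d, 0 < d -> exists z', [/\ A z', `|z'.1 - z.1| < d & `|z'.2 - z.2| < d]) ->
  closure A z.
Proof.
move=> h B /nbhs_ballP[d /= d0 dB]; have [z' [Az' h1 h2]] := h d d0.
by exists z'; split=> //; apply: dB; split; rewrite /ball/= distrC.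
Qed.

Lemma Dminus_open (R : realType) (theta : R) (f : R -> R) :
  front_curve (tan theta) f -> open (Dminus theta f).
Proof.
move=> Hf; apply: open_planeP => z /(DminusP _ Hf)[z2 z1 zf].
have e0 : 0 < (f z.2 - z.1) / 2 by rewrite divr_gt0// subr_gt0.
have [d [d0 dP]] := front_curve_continuous Hf (ltW z2) e0.
exists (Num.min (Num.min d z.2) (Num.min z.1 ((f z.2 - z.1) / 2))).
split; first by rewrite !lt_min d0 z2 z1.
move=> z'; rewrite !lt_min => /andP[/andP[a1 a2] /andP[a3 a4]].
move=> /andP[/andP[b1 b2] /andP[b3 b4]]; apply/DminusP => //.
move: b2 a3 a4; rewrite !ltr_norml => /andP[b2 _] /andP[a3 _] /andP[_ a4].
have z'2 : 0 < z'.2 by clear -b2; lra.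
split=> //; first by clear -a3; lra.
have := dP _ (ltW z'2) b1; rewrite ltr_norml => /andP[c1 _].
by clear -a4 c1; lra.
Qed.

Lemma Dplus_open (R : realType) (theta : R) (f : R -> R) :
  front_curve (tan theta) f -> open (Dplus theta f).
Proof.
move=> Hf; have T0 := fc_tan Hf; apply: open_planeP => z /(DplusP _ Hf)[z2 zf zT].
have e0 : 0 < (z.1 - f z.2) / 2 by rewrite divr_gt0// subr_gt0.
have [d [d0 dP]] := front_curve_continuous Hf (ltW z2) e0.
pose m := (z.2 - z.1 * tan theta) / (1 + tan theta) / 2.
have w0 : 0 < z.2 - z.1 * tan theta by rewrite subr_gt0 -ltr_pdivlMr.
have t1 : 0 < 1 + tan theta by rewrite addr_gt0.
have m0 : 0 < m by rewrite !divr_gt0.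
exists (Num.min (Num.min d z.2) (Num.min m ((z.1 - f z.2) / 2))).
split; first by rewrite !lt_min d0 z2 m0.
move=> z'; rewrite !lt_min => /andP[/andP[a1 a2] /andP[a3 a4]].
move=> /andP[/andP[b1 b2] /andP[b3 b4]]; apply/DplusP => //.
move: b2 b3 a3 a4; rewrite !ltr_norml.
move=> /andP[b2 _] /andP[b3 _] /andP[_ a3] /andP[a4 _].
have z'2 : 0 < z'.2 by clear -b2; lra.
split=> //.
  have := dP _ (ltW z'2) b1; rewrite ltr_norml => /andP[_ c1].
  by clear -a4 c1; lra.
rewrite ltr_pdivlMr//.
have : z'.1 * tan theta < (z.1 + m) * tan theta.
  by rewrite ltr_pM2r//; clear -a3; lra.
have : m * (1 + tan theta) = (z.2 - z.1 * tan theta) / 2.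
  by rewrite /m; field; rewrite gt_eqF.
have : z.2 - m < z'.2 by clear -b3; lra.
by clear -w0; lra.
Qed.

Lemma interval_approx (R : realType) (a b x d : R) : a < b -> a <= x <= b -> 0 < d ->
  exists x', a < x' < b /\ `|x' - x| < d.
Proof.
move=> ab /andP[ax xb] d0.
pose q := Num.min (d / 2) ((b - a) / 4).
have q0 : 0 < q by rewrite lt_min !divr_gt0// subr_gt0.
have qd : q < d by rewrite gt_min; apply/orP; left; clear -d0; lra.
have qb : q <= (b - a) / 4 by rewrite ge_min lexx orbT.
case: (leP x ((a + b) / 2)) => h.
  exists (x + q); split; first by clear -ax h q0 qb ab; apply/andP; split; lra.
  by have -> : x + q - x = q by [ring]; rewrite gtr0_norm.
exists (x - q); split; first by clear -xb h q0 qb ab; apply/andP; split; lra.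
by have -> : x - q - x = - q by [ring]; rewrite normrN gtr0_norm.
Qed.

Lemma Dminus_closure (R : realType) (theta : R) (f : R -> R) (z : R * R) :
  front_curve (tan theta) f -> 0 <= z.2 -> 0 <= z.1 <= f z.2 ->
  closure (Dminus theta f) z.
Proof.
move=> Hf; rewrite le_eqVlt => /predU1P[z2|z2] z1; apply: closure_planeP => d d0.
  have [d' [d'0 d'P]] := front_curve_continuous Hf (lexx 0) d0.
  pose y := Num.min (d / 2) (d' / 2).
  have y0 : 0 < y by rewrite lt_min !divr_gt0.
  have yd : y < d by rewrite gt_min; apply/orP; left; clear -d0; lra.
  have yd' : y < d' by rewrite gt_min; apply/orP; right; clear -d'0; lra.
  have /andP[fy0 _] := fc_domain Hf y0.
  have fyd : f y < d.
    have := d'P y (ltW y0); rewrite subr0 (fc_0 Hf) subr0 (gtr0_norm y0) (gtr0_norm fy0).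
    exact.
  have z10 : z.1 = 0.
    by move: z1; rewrite -z2 (fc_0 Hf) => ?; apply/eqP; rewrite eq_le andbC.
  exists (f y / 2, y); rewrite /= z10 -z2 !subr0; split.
  - by apply/DminusP => //=; split=> //; clear -fy0; lra.
  - by rewrite gtr0_norm ?divr_gt0//; clear -fy0 fyd; lra.
  - by rewrite gtr0_norm.
have /andP[fy0 _] := fc_domain Hf z2.
have [x [/andP[x0 x1] xd]] := interval_approx fy0 z1 d0.
by exists (x, z.2); rewrite /= subrr normr0; split=> //; apply/DminusP.
Qed.

Lemma Dplus_closure (R : realType) (theta : R) (f : R -> R) (z : R * R) :
  front_curve (tan theta) f -> 0 <= z.2 -> f z.2 <= z.1 <= z.2 / tan theta ->
  closure (Dplus theta f) z.
Proof.
move=> Hf; have T0 := fc_tan Hf.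
rewrite le_eqVlt => /predU1P[z2|z2] z1; apply: closure_planeP => d d0.
  have z10 : z.1 = 0.
    move: z1; rewrite -z2 (fc_0 Hf) mul0r => ?.
    by apply/eqP; rewrite eq_le andbC.
  pose y := Num.min (d / 2) (d * tan theta / 2).
  have y0 : 0 < y by rewrite lt_min !divr_gt0// mulr_gt0.
  have yd : y < d by rewrite gt_min; apply/orP; left; clear -d0; lra.
  have yd' : y / tan theta < d.
    rewrite ltr_pdivrMr// gt_min; apply/orP; right.
    have : 0 < d * tan theta by rewrite mulr_gt0.
    by clear; lra.
  have /andP[fy0 fyT] := fc_domain Hf y0.
  exists ((f y + y / tan theta) / 2, y); rewrite /= z10 -z2 !subr0; split.
  - by apply/DplusP => //=; split=> //; clear -fyT; lra.
  - by rewrite gtr0_norm ?divr_gt0//; clear -fy0 fyT yd'; lra.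
  - by rewrite gtr0_norm.
have /andP[fy0 fyT] := fc_domain Hf z2.
have [x [/andP[x0 x1] xd]] := interval_approx fyT z1 d0.
by exists (x, z.2); rewrite /= subrr normr0; split=> //; apply/DplusP.
Qed.

(** * Flows regular up to the boundary *)

Lemma closure_constant (R : realType) (A : set (R * R)) (G : R * R -> R) (k : R) :
  {within closure A, continuous G} -> (forall z, A z -> G z = k) ->
  forall z, closure A z -> G z = k.
Proof.
move=> /within_planeP cG Gk z Az; apply/eqP; rewrite -subr_eq0 -normr_eq0.
rewrite eq_le normr_ge0 andbT leNgt; apply/negP => h.
have [d [d0 dP]] := cG z Az _ h.
have [y [Ay [y1 y2]]] := Az _ (nbhsx_ballx z _ d0).
have := dP y (subset_closure Ay); rewrite ![`|_ - z.1|]distrC ![`|_ - z.2|]distrC.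
by move=> /(_ y1 y2); rewrite Gk// distrC ltxx.
Qed.

(** A flow given by its traces: interior points and boundary points of the region
    are treated alike, and the Euler system appears in solved form. *)
Record flow_up_to (R : realType) (gamma b0 : R) (A : set (R * R))
    (p u v rho : R * R -> R) : Prop := FlowUpTo {
  fu_open : open A ;
  fu_vertex : ~ A (vertex R) ;
  fu_cont : forall F, [\/ F = p, F = u, F = v | F = rho] ->
    {within closure A, continuous (trace A F)} ;
  fu_grad : forall F, [\/ F = p, F = u, F = v | F = rho] -> forall z, A z ->
    has_grad (trace A F) z (trace A (dx F) z) (trace A (dy F) z) ;
  fu_grad_cont : forall F, [\/ F = p, F = u, F = v | F = rho] ->
    {within closure A `\` [set vertex R], continuous (trace A (dx F))} /\
    {within closure A `\` [set vertex R], continuous (trace A (dy F))} ;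
  fu_pos : forall z, closure A z -> 0 < trace A p z /\ 0 < trace A rho z ;
  fu_bernoulli : forall z, closure A z ->
    (trace A u z ^+ 2 + trace A v z ^+ 2) / 2
      + gamma * trace A p z / trace A rho z / (gamma - 1) = b0 ;
  fu_relations : forall z, A z ->
    euler_relations gamma (trace A p z) (trace A u z) (trace A v z)
      (trace A rho z) (trace A (dx p) z) (trace A (dy p) z)
      (trace A (dx u) z) (trace A (dy u) z) (trace A (dx v) z)
      (trace A (dy v) z) (trace A (dx rho) z) (trace A (dy rho) z) ;
  fu_inside : forall F, [\/ F = p, F = u, F = v | F = rho] -> forall z, A z ->
    trace A F z = F z }.

Lemma flow_up_to_intro (R : realType) (gamma b0 : R) (A : set (R * R))
    (p u v rho : R * R -> R) :
  1 < gamma -> open A -> ~ A (vertex R) ->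
  (forall F : R * R -> R, [\/ F = p, F = u, F = v | F = rho] ->
     continuous_upto A F /\ C1_upto A F) ->
  positive_upto A p -> positive_upto A rho ->
  (forall z, A z -> euler_at gamma b0 p u v rho z) ->
  flow_up_to gamma b0 A p u v rho.
Proof.
move=> g1 oA AO reg pp rp eul.
have inside F : [\/ F = p, F = u, F = v | F = rho] -> forall z, A z ->
    trace A F z = F z.
  by move=> /reg[cF _] z Az; apply: trace_interior => //; apply/cF/subset_closure.
have cont F : [\/ F = p, F = u, F = v | F = rho] ->
    {within closure A, continuous (trace A F)}.
  by move=> /reg[cF _]; apply: trace_continuous => z Az; split=> //; exact: cF.
have zO z : A z -> z <> vertex R by move=> Az zO; apply: AO; rewrite -zO.
have grad F : [\/ F = p, F = u, F = v | F = rho] -> forall z, A z ->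
    has_grad (trace A F) z (trace A (dx F) z) (trace A (dy F) z).
  by move=> /reg[cF c1F] z Az; apply: trace_has_grad => //; exact: zO.
have is_p : [\/ p = p, p = u, p = v | p = rho] by exact: Or41.
have is_u : [\/ u = p, u = u, u = v | u = rho] by exact: Or42.
have is_v : [\/ v = p, v = u, v = v | v = rho] by exact: Or43.
have is_r : [\/ rho = p, rho = u, rho = v | rho = rho] by exact: Or44.
have bern z : A z -> (trace A u z ^+ 2 + trace A v z ^+ 2) / 2
      + gamma * trace A p z / trace A rho z / (gamma - 1) = b0.
  move=> Az; have [_ _ _ <-] := eul z Az; have cAz := subset_closure Az.
  have := pp z cAz; have := rp z cAz; rewrite !inside// => r0 p0.
  by rewrite /sonic_speed sqr_sqrtr// divr_ge0 ?mulr_ge0 ?ltW//; lra.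
split; [exact: oA|exact: AO|exact: cont|exact: grad| | | | |exact: inside].
- move=> F /reg[_ [_ c1F]].
  by split; apply: trace_continuous => z [Az /c1F]; case/(_ Az).
- by move=> z Az; split; [exact: pp|exact: rp].
- apply: (@closure_constant _ A
    (fun z => (trace A u z ^+ 2 + trace A v z ^+ 2) / 2
      + gamma * trace A p z / trace A rho z / (gamma - 1))) => //.
  have /subspace_continuousP cp := cont p is_p.
  have /subspace_continuousP cu := cont u is_u.
  have /subspace_continuousP cv := cont v is_v.
  have /subspace_continuousP cr := cont rho is_r.
  apply/subspace_continuousP => z Az.
  have hp := cp z Az; have hu := cu z Az; have hv := cv z Az; have hr := cr z Az.
  apply: cvgD.
    by apply: cvgMr_tmp; apply: cvgD; rewrite !expr2; apply: cvgM.
  apply: cvgMr_tmp; apply: cvgM; first by apply: cvgMl_tmp.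
  by apply: cvgV => //; rewrite gt_eqF// rp.
- move=> z Az; apply: (@euler_at_relations _ gamma b0 A (trace A p) (trace A u)
    (trace A v) (trace A rho)) => //; try exact: grad.
    by move=> x /subset_closure Ax; split; [exact: pp|exact: rp].
  move=> x Ax; have inA : \forall y \near x, A y by exact: open_nbhs_nbhs.
  have E F : [\/ F = p, F = u, F = v | F = rho] -> \forall y \near x, F y = trace A F y.
    by move=> HF; apply: filterS inA => y Ay; rewrite inside.
  have Ep := E p is_p; have Eu := E u is_u; have Ev := E v is_v; have Er := E rho is_r.
  have near_d F G w : (\forall y \near x, F y = G y) -> 'D_w F x = 'D_w G x :> R.
    exact: near_eq_derive.
  have [e1 e2 e3 e4] := eul x Ax; split.
  + rewrite -e1 /dx /dy; congr (_ + _); apply: near_d; near=> y => /=;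
    by rewrite (near Er y)// ?(near Eu y)// ?(near Ev y).
  + rewrite -e2 /dx /dy; congr (_ + _); apply: near_d; near=> y => /=;
    by rewrite (near Er y)// ?(near Eu y)// ?(near Ev y)// ?(near Ep y).
  + rewrite -e3 /dx /dy; congr (_ + _); apply: near_d; near=> y => /=;
    by rewrite (near Er y)// ?(near Eu y)// ?(near Ev y)// ?(near Ep y).
  + by rewrite !inside.
Unshelve. all: by end_near. Qed.

Lemma trace_cvg (R : realType) (A : set (R * R)) (F : R * R -> R) (z : R * R) :
  continuous_upto A F -> closure A z -> F @ within A (nbhs z) --> trace A F z.
Proof. by move=> cF Az; exact/cvg_trace/cF. Qed.

Lemma trace_flux (R : realType) (A : set (R * R)) (F G : R * R -> R) (z : R * R) :
  continuous_upto A F -> continuous_upto A G -> closure A z ->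
  trace A (F \* G) z = trace A F z * trace A G z.
Proof. by move=> cF cG Az; apply: trace_lim => //; apply: cvgM; exact: trace_cvg. Qed.

Lemma trace_momentum_flux (R : realType) (A : set (R * R))
    (F G H : R * R -> R) (z : R * R) :
  continuous_upto A F -> continuous_upto A G -> continuous_upto A H -> closure A z ->
  trace A (F \* G \* H) z = trace A F z * trace A G z * trace A H z.
Proof.
by move=> cF cG cH Az; apply: trace_lim => //; do 2?[apply: cvgM]; exact: trace_cvg.
Qed.

Lemma trace_momentum_flux_pressure (R : realType) (A : set (R * R))
    (F G H p : R * R -> R) (z : R * R) :
  continuous_upto A F -> continuous_upto A G -> continuous_upto A H ->
  continuous_upto A p -> closure A z ->
  trace A (F \* G \* H \+ p) z
    = trace A F z * trace A G z * trace A H z + trace A p z.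
Proof.
move=> cF cG cH cp Az; apply: trace_lim => //; apply: cvgD; last exact: trace_cvg.
by do 2?[apply: cvgM]; exact: trace_cvg.
Qed.

Lemma solution_front_curve (R : realType) (gamma p0 u0 rho0 thetaW : R)
    (f : R -> R) (p u v rho : R * R -> R) :
  0 < thetaW < pi / 2 ->
  transonic_shock_solution gamma p0 u0 rho0 thetaW f p u v rho ->
  front_curve (tan thetaW) f.
Proof. by move=> /tan_gt0 T0 []. Qed.

Lemma solution_flow (R : realType) (gamma p0 u0 rho0 thetaW : R)
    (f : R -> R) (p u v rho : R * R -> R) (A : set (R * R)) :
  1 < gamma -> 0 < thetaW < pi / 2 ->
  transonic_shock_solution gamma p0 u0 rho0 thetaW f p u v rho ->
  A = Dminus thetaW f \/ A = Dplus thetaW f ->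
  flow_up_to gamma (bernoulli_constant gamma p0 u0 rho0) A p u v rho.
Proof.
move=> g1 th sol HA; have Hf := solution_front_curve th sol.
have [pp rp] := tss_positive sol HA.
apply: flow_up_to_intro => //.
- by case: HA => ->; [exact: Dminus_open|exact: Dplus_open].
- by case: HA => -> [[/= ]]; rewrite ltxx.
- by move=> F HF; exact: (tss_regular sol HF HA).
- by move=> z Az; apply: (tss_euler sol); case: HA => <-; [left|right].
Qed.

Lemma solution_jumps (R : realType) (gamma p0 u0 rho0 thetaW : R)
    (f : R -> R) (p u v rho : R * R -> R) (y : R) :
  0 < thetaW < pi / 2 ->
  transonic_shock_solution gamma p0 u0 rho0 thetaW f p u v rho -> 0 < y ->
  let Dm := Dminus thetaW f in let Dp := Dplus thetaW f in
  let z := (f y, y) in let s := derive1 f y in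
  let P := trace Dp p z in let U := trace Dp u z in
  let V := trace Dp v z in let Q := trace Dp rho z in
  let P' := trace Dm p z in let U' := trace Dm u z in
  let V' := trace Dm v z in let Q' := trace Dm rho z in
  [/\ closure Dm z, closure Dp z & [/\
    Q * U - Q' * U' - s * (Q * V - Q' * V') = 0,
    (Q * U * U + P) - (Q' * U' * U' + P') - s * (Q * U * V - Q' * U' * V') = 0,
    (Q * U * V - Q' * U' * V') - s * ((Q * V * V + P) - (Q' * V' * V' + P')) = 0 &
    P' < P]].
Proof.
move=> th sol y0 Dm Dp z s P U V Q P' U' V' Q'.
have Hf := solution_front_curve th sol.
have /andP[fy0 fyT] := fc_domain Hf y0.
have cm : closure Dm z.
  by apply: Dminus_closure => //=; [exact: ltW|rewrite lexx ltW].
have cp : closure Dp z.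
  by apply: Dplus_closure => //=; [exact: ltW|rewrite lexx ltW].
have reg A F : A = Dm \/ A = Dp -> [\/ F = p, F = u, F = v | F = rho] ->
   continuous_upto A F by move=> HA HF; have [] := tss_regular sol HF HA.
have [e1 e2 e3] := tss_rankine_hugoniot sol y0.
have e4 := tss_entropy sol y0.
have is_m : Dm = Dm \/ Dm = Dp by left.
have is_p : Dp = Dm \/ Dp = Dp by right.
have pm := reg Dm p is_m (Or41 _ _ _ erefl); have pp := reg Dp p is_p (Or41 _ _ _ erefl).
have um := reg Dm u is_m (Or42 _ _ _ erefl); have up := reg Dp u is_p (Or42 _ _ _ erefl).
have vm := reg Dm v is_m (Or43 _ _ _ erefl); have vp := reg Dp v is_p (Or43 _ _ _ erefl).
have rm := reg Dm rho is_m (Or44 _ _ _ erefl); have rp := reg Dp rho is_p (Or44 _ _ _ erefl).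
move: e1 e2 e3 e4; rewrite /jump -/Dm -/Dp -/z -/s.
rewrite !trace_momentum_flux_pressure// !trace_momentum_flux// !trace_flux//.
by rewrite subr_gt0 => e1 e2 e3 e4; split.
Qed.

(** * The upstream flow is uniform *)

Lemma primitive_exists (R : realType) (g : R -> R) (a b : R) :
  a < b -> {within `[a, b], continuous g} ->
  exists G : R -> R, forall x, a < x < b -> is_derive x (1 : R) G (g x).
Proof.
move=> ab cg.
have ig : (@lebesgue_measure R).-integrable `[a, b] (EFin \o g).
  by apply: continuous_compact_integrable => //; exact: segment_compact.
exists (fun x => (\int[@lebesgue_measure R]_(t in `[a, x]) g t)%R) => x /andP[ax xb].
have cx : {for x, continuous g}.
  have xi : x \in `]a, b[%R by rewrite in_itv/= ax.
  exact: (within_continuous_continuous ab cg xi).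
have [dG gE] := continuous_FTC1_closed xb ig ax cx.
by apply: (DeriveDef dG); rewrite -gE derive1E.
Qed.

(** The part to the left of [x = t] of a backward cone, with apex abscissa [c],
    over the ordinate [y1]. When the aperture [K] exceeds the slopes of all
    characteristics, these can leave the set backward only through the initial
    line [x = 0]. *)
Definition upstream_cone (R : realType) (f : R -> R) (K c y1 t : R) : set (R * R) :=
  [set z | [/\ 0 <= z.2, 0 <= z.1 <= f z.2, `|z.2 - y1| <= K * (c - z.1)
    & z.1 <= t]].

Definition upstream_cone_interior (R : realType) (f : R -> R) (K c y1 t : R)
    : set (R * R) :=
  [set z | [/\ 0 < z.2, 0 < z.1 < f z.2, `|z.2 - y1| < K * (c - z.1)
    & z.1 < t]].

Lemma upstream_cone_compact (R : realType) (T : R) (f : R -> R) (K c y1 t : R) :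
  front_curve T f -> 0 < K -> compact (upstream_cone f K c y1 t).
Proof.
move=> Hf K0.
apply: (@subclosed_compact _ _ (`[0, t]%classic `*` `[0, y1 + K * c]%classic)).
- move=> z clz.
  have near d : 0 < d -> exists z', [/\ upstream_cone f K c y1 t z',
      `|z'.1 - z.1| < d & `|z'.2 - z.2| < d].
    move=> d0; have [y [Ny [h1 h2]]] := clz _ (nbhsx_ballx z _ d0).
    by exists y; split=> //; rewrite distrC.
  have z2 : 0 <= z.2.
    rewrite leNgt; apply/negP => h; have h' : 0 < - z.2 by rewrite oppr_gt0.
    have [z' [[a1 _ _ _] _]] := near _ h'.
    by rewrite ltr_norml => /andP[_]; clear -a1; lra.
  have z1 : 0 <= z.1.
    rewrite leNgt; apply/negP => h; have h' : 0 < - z.1 by rewrite oppr_gt0.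
    have [z' [[_ /andP[a1 _] _ _] + _]] := near _ h'.
    by rewrite ltr_norml => /andP[_]; clear -a1; lra.
  split=> //.
  + rewrite z1 leNgt; apply/negP => h.
    have e0 : 0 < (z.1 - f z.2) / 2 by rewrite divr_gt0// subr_gt0.
    have [d [d0 dP]] := front_curve_continuous Hf z2 e0.
    have m0 : 0 < Num.min d ((z.1 - f z.2) / 2) by rewrite lt_min d0.
    have [z' [[a1 /andP[_ a2] _ _] + +]] := near _ m0.
    rewrite !lt_min => /andP[_ b1] /andP[b2 _].
    have := dP _ a1 b2; move: b1; rewrite !ltr_norml => /andP[b1 _] /andP[_ b3].
    by clear -a2 b1 b3; lra.
  + rewrite leNgt; apply/negP => h.
    pose m := (`|z.2 - y1| - K * (c - z.1)) / (1 + K).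
    have K1 : 0 < 1 + K by rewrite addr_gt0.
    have m0 : 0 < m by rewrite divr_gt0// subr_gt0.
    have [z' [[_ _ a1 _] b1 b2]] := near _ m0.
    have := ler_normB (z'.2 - y1) (z'.2 - z.2).
    have -> : z'.2 - y1 - (z'.2 - z.2) = z.2 - y1 by ring.
    have : m * (1 + K) = `|z.2 - y1| - K * (c - z.1).
      by rewrite /m; field; rewrite gt_eqF.
    move: b1; rewrite ltr_norml => /andP[b1 _].
    have : K * (z.1 - z'.1) < K * m by rewrite ltr_pM2l//; clear -b1; lra.
    by clear -a1 b2; lra.
  + rewrite leNgt; apply/negP => h; have h' : 0 < z.1 - t by rewrite subr_gt0.
    have [z' [[_ _ _ a1] + _]] := near _ h'.
    by rewrite ltr_norml => /andP[]; clear -a1; lra.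
- exact: compact_rectangle.
- move=> z [z2 /andP[z1 _] h zt]; split; rewrite /= in_itv/=.
    by rewrite z1.
  rewrite z2/=; move: h; rewrite ler_norml => /andP[_].
  have : 0 <= K * z.1 by rewrite mulr_ge0// ltW.
  by clear; lra.
Qed.

(** A backward line of slope [l] stays in the cone as [|l| < K], and leaves the
    front towards the upstream side as [l f' < 1]. *)
Lemma upstream_cone_inward (R : realType) (T : R) (f : R -> R) (K c y1 t l : R)
    (z : R * R) :
  front_curve T f -> upstream_cone f K c y1 t z -> 0 < z.1 -> `|l| < K ->
  (z.1 = f z.2 -> l * derive1 f z.2 < 1) ->
  exists r0, 0 < r0 /\ forall r, 0 < r < r0 ->
    upstream_cone_interior f K c y1 t (z.1 - r, z.2 - l * r).
Proof.
move=> Hf [z2 /andP[_ zf] zK zt] z1 lK lf.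
have z2' : 0 < z.2.
  rewrite lt_neqAle z2 andbT; apply/eqP => h.
  by move: zf; rewrite -h (fc_0 Hf) leNgt z1.
have L1 : 0 < `|l| + 1 by rewrite ltr_wpDl.
have main : exists r1, 0 < r1 /\ forall r, 0 < r < r1 -> z.1 - r < f (z.2 - l * r).
  move: zf; rewrite le_eqVlt => /predU1P[zf|zf].
    have {}lf := lf zf.
    have /is_derive1_epsP df := front_curve_derive Hf z2'.
    have e0 : 0 < (1 - l * derive1 f z.2) / (2 * (`|l| + 1)).
      by rewrite divr_gt0 ?mulr_gt0// subr_gt0.
    have [d [d0 dP]] := df _ e0.
    exists (d / (`|l| + 1)); split; first by rewrite divr_gt0.
    move=> r /andP[r0 rd].
    have rl : r * (`|l| + 1) < d by rewrite -ltr_pdivlMr.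
    have E : z.2 - l * r - z.2 = - (l * r) by ring.
    have nE : `|z.2 - l * r - z.2| = `|l| * r by rewrite E normrN normrM (gtr0_norm r0).
    have lr0 : 0 <= `|l| * r by rewrite mulr_ge0// ltW.
    have hd : `|l| * r < d by clear -rl r0; lra.
    have := dP (z.2 - l * r); rewrite nE => /(_ hd).
    rewrite E ler_norml => /andP[h _].
    have : (1 - l * derive1 f z.2) / (2 * (`|l| + 1)) * (`|l| * r) <=
      (1 - l * derive1 f z.2) / (2 * (`|l| + 1)) * ((`|l| + 1) * r).
      by rewrite ler_wpM2l ?(ltW e0)//; clear -r0; lra.
    have -> : (1 - l * derive1 f z.2) / (2 * (`|l| + 1)) * ((`|l| + 1) * r) =
      (1 - l * derive1 f z.2) * r / 2 by field; rewrite gt_eqF.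
    have : 0 < (1 - l * derive1 f z.2) * r by rewrite mulr_gt0// subr_gt0.
    by rewrite zf; clear -h; lra.
  have e0 : 0 < f z.2 - z.1 by rewrite subr_gt0.
  have [d [d0 dP]] := front_curve_continuous Hf z2 e0.
  exists (Num.min (d / (`|l| + 1)) (z.2 / (`|l| + 1))).
  split; first by rewrite lt_min !divr_gt0.
  move=> r /andP[r0]; rewrite lt_min !ltr_pdivlMr// => /andP[rd rz].
  have lr : `|l * r| = `|l| * r by rewrite normrM (gtr0_norm r0).
  have h1 : 0 <= z.2 - l * r.
    by have := ler_norm (l * r); rewrite lr; clear -rz r0; lra.
  have h2 : `|z.2 - l * r - z.2| < d.
    have -> : z.2 - l * r - z.2 = - (l * r) by ring.
    by rewrite normrN lr; clear -rd r0; lra.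
  have := dP _ h1 h2; rewrite ltr_norml => /andP[].
  by clear -r0; lra.
have [r1 [r10 r1P]] := main.
exists (Num.min (Num.min r1 z.1) (z.2 / (`|l| + 1))).
split; first by rewrite !lt_min r10 z1 divr_gt0.
move=> r /andP[r0]; rewrite !lt_min => /andP[/andP[rr1 rz1]].
rewrite ltr_pdivlMr// => rz2.
have lr : `|l * r| = `|l| * r by rewrite normrM (gtr0_norm r0).
split => /=.
- by have := ler_norm (l * r); rewrite lr; clear -rz2 r0; lra.
- by rewrite subr_gt0 rz1/= r1P// r0.
- have := ler_normB (z.2 - y1) (l * r); rewrite lr.
  have -> : z.2 - y1 - l * r = z.2 - l * r - y1 by ring.
  have : `|l| * r < K * r by rewrite ltr_pM2r.
  by clear -zK; lra.
- by clear -zt r0; lra.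
Qed.

Lemma upstream_cone_transport (R : realType) (T : R) (f : R -> R) (K c y1 t k : R)
    (F F1 F2 lam : R * R -> R) :
  front_curve T f -> 0 < K ->
  {within upstream_cone f K c y1 t, continuous F} ->
  {within upstream_cone f K c y1 t, continuous lam} ->
  {within upstream_cone f K c y1 t `\` [set vertex R], continuous F2} ->
  (forall z, upstream_cone_interior f K c y1 t z ->
     has_grad F z (F1 z) (F2 z) /\ F1 z + lam z * F2 z = 0) ->
  (forall z, upstream_cone f K c y1 t z -> `|lam z| < K) ->
  (forall z, upstream_cone f K c y1 t z -> 0 < z.1 -> z.1 = f z.2 ->
     lam z * derive1 f z.2 < 1) ->
  (forall z, upstream_cone f K c y1 t z -> z.1 = 0 -> F z <= k) ->
  forall z, upstream_cone f K c y1 t z -> F z <= k.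
Proof.
move=> Hf K0 cF clam cF2 grad lamK lamf Fk.
have cN := @upstream_cone_compact _ _ _ _ c y1 t Hf K0.
apply: (@transport_max _ _ F lam F1 F2 k cN cF clam _ Fk).
  by move=> z [_ /andP[]].
move=> z Nz z1.
have [r0 [r00 r0P]] := upstream_cone_inward Hf Nz z1 (lamK z Nz) (lamf z Nz z1).
have zO : (upstream_cone f K c y1 t `\` [set vertex R]) z.
  by split=> // zO; rewrite zO ltxx in z1.
move/within_planeP : cF2 => /(_ z zO 1 ltr01)[d [d0 dP]].
have L1 : 0 < `|lam z| + 1 by rewrite ltr_wpDl.
exists (Num.min r0 (d / (`|lam z| + 1))), (`|F2 z| + 1).
split; first by rewrite lt_min r00 divr_gt0.
move=> r /andP[r_0]; rewrite lt_min ltr_pdivlMr// => /andP[rr0 rd].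
set y := (_, _).
have Iy : upstream_cone_interior f K c y1 t y by apply: r0P; rewrite r_0.
have Ny : upstream_cone f K c y1 t y.
  case: Iy => i1 /andP[i2 i3] i4 i5.
  by split; [exact: ltW|apply/andP; split; exact: ltW|exact: ltW|exact: ltW].
have [gF F12] := grad y Iy; split=> //.
have yO : (upstream_cone f K c y1 t `\` [set vertex R]) y.
  by split=> // yO; case: Iy => + _ _ _; rewrite yO ltxx.
have lr : `|lam z * r| = `|lam z| * r by rewrite normrM (gtr0_norm r_0).
have lr0 : 0 <= `|lam z| * r by rewrite mulr_ge0// ltW.
have k' := dP y yO; have := ler_normD (F2 y - F2 z) (F2 z); rewrite subrK => h.
have : `|F2 y - F2 z| <= 1.
  apply/ltW/k'.
    have -> : y.1 - z.1 = - r by rewrite /=; ring.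
    by rewrite normrN gtr0_norm//; clear -rd lr0; lra.
  have -> : y.2 - z.2 = - (lam z * r) by rewrite /=; ring.
  by rewrite normrN lr; clear -rd r_0; lra.
by clear -h; lra.
Qed.

(** A combination of the last two Euler relations, with the slope [l] of a Mach
    line as coefficient, differentiates both the flow angle and the pressure in
    the direction [(1, l)] only. *)
Lemma characteristic_relation (R : realType) (gamma p u v r p1 p2 u1 u2 v1 v2 r1 r2
    e S eps l : R) :
  euler_relations gamma p u v r p1 p2 u1 u2 v1 v2 r1 r2 ->
  e = gamma * p / r -> e < u ^+ 2 -> S ^+ 2 = e * (u ^+ 2 + v ^+ 2 - e) ->
  eps ^+ 2 = 1 -> l = (u * v + eps * S) / (u ^+ 2 - e) ->
  gamma * p * ((u * v1 - v * u1) + l * (u * v2 - v * u2))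
    = - eps * S * (p1 + l * p2).
Proof.
move=> [_ _ _ K1 K2] eE ue SE epsE lE.
have d0 : u ^+ 2 - e != 0 by rewrite gt_eqF// subr_gt0.
rewrite mulrDr [gamma * p * (l * _)]mulrCA K1 K2 -eE.
have A1 : u * v + l * (e - u ^+ 2) = - eps * S.
  by rewrite lE; field.
have A2 : e - v ^+ 2 + l * (u * v) = eps * S * l.
  apply: (mulIf d0); rewrite lE.
  have -> : (e - v ^+ 2 + (u * v + eps * S) / (u ^+ 2 - e) * (u * v)) * (u ^+ 2 - e)
    = (e - v ^+ 2) * (u ^+ 2 - e) + (u * v + eps * S) * (u * v) by field.
  have -> : eps * S * ((u * v + eps * S) / (u ^+ 2 - e)) * (u ^+ 2 - e) =
    eps * S * (u * v) + eps ^+ 2 * S ^+ 2 by field.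
  by rewrite epsE SE; ring.
have -> : u * v * p1 - (e - v ^+ 2) * p2 + l * ((e - u ^+ 2) * p1 - u * v * p2) =
  (u * v + l * (e - u ^+ 2)) * p1 - (e - v ^+ 2 + l * (u * v)) * p2 by ring.
by rewrite A1 A2; ring.
Qed.

(** A front crossed with supersonic normal velocity is steeper than both Mach
    lines: followed backward, these enter the upstream side. With
    [un = u - s v] this comes down to the identity
    [(u un - e)^2 - s^2 S^2 = (u^2 - e) (un^2 - (1 + s^2) e)]. *)
Lemma spacelike_front (R : realType) (u v s e S eps : R) :
  0 < u -> 0 < e -> e < u ^+ 2 -> S ^+ 2 = e * (u ^+ 2 + v ^+ 2 - e) ->
  eps ^+ 2 = 1 -> 0 < u - s * v -> (1 + s ^+ 2) * e < (u - s * v) ^+ 2 ->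
  (u * v + eps * S) / (u ^+ 2 - e) * s < 1.
Proof.
move=> u0 e0 ue SE epsE un0 une.
have d0 : 0 < u ^+ 2 - e by rewrite subr_gt0.
rewrite mulrAC ltr_pdivrMr// mul1r.
have c0 : 0 < Num.sqrt e by rewrite sqrtr_gt0.
have eE : e = Num.sqrt e ^+ 2 by rewrite sqr_sqrtr// ltW.
have un1 : Num.sqrt e < u - s * v.
  rewrite -(ltr_pXn2r (_ : (0 < 2)%N)) ?nnegrE ?ltW// -eE.
  apply: le_lt_trans une; rewrite mulrDl mul1r lerDl.
  by rewrite mulr_ge0 ?sqr_ge0// ltW.
have u1 : Num.sqrt e < u.
  by rewrite -(ltr_pXn2r (_ : (0 < 2)%N)) ?nnegrE ?ltW// -eE.
have e1 : e < u * (u - s * v).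
  rewrite {1}eE expr2; apply: (@lt_le_trans _ _ (u * Num.sqrt e)).
    by rewrite ltr_pM2r.
  by rewrite ler_pM2l// ltW.
have key : (eps * S * s) ^+ 2 < (u * (u - s * v) - e) ^+ 2.
  rewrite -subr_gt0.
  have -> : (u * (u - s * v) - e) ^+ 2 - (eps * S * s) ^+ 2 =
    (u ^+ 2 - e) * ((u - s * v) ^+ 2 - (1 + s ^+ 2) * e).
    rewrite !exprMn epsE SE; ring.
  by rewrite mulr_gt0// subr_gt0.
have : `|eps * S * s| < u * (u - s * v) - e.
  rewrite -(ltr_pXn2r (_ : (0 < 2)%N)) ?nnegrE//; last by rewrite subr_ge0 ltW.
  by rewrite real_normK// num_real.
have := ler_norm (eps * S * s).
by clear; lra.
Qed.

Lemma within_cvg (R : realType) (N : set (R * R)) (z : R * R)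
    (F : R * R -> R) : {within N, continuous F} -> N z ->
  F @ within N (nbhs z) --> F z.
Proof. by move=> /subspace_continuousP; apply. Qed.

Lemma cvg_real_comp (R : realType) (N : set (R * R)) (z : R * R) (phi : R -> R)
    (F : R * R -> R) (l : R) : {for l, continuous phi} ->
  F @ within N (nbhs z) --> l ->
  (fun x => phi (F x)) @ within N (nbhs z) --> phi l.
Proof. by move=> cphi cF; apply: (continuous_cvg _ cphi cF). Qed.

Lemma cvg_quotient (R : realType) (N : set (R * R)) (z : R * R)
    (F G : R * R -> R) (l m : R) : 0 < m ->
  F @ within N (nbhs z) --> l -> G @ within N (nbhs z) --> m ->
  (fun x => F x / G x) @ within N (nbhs z) --> l / m.
Proof.
move=> m0 cF cG; apply: cvgM; first exact: cF.
by apply: cvgV; [rewrite gt_eqF|exact: cG].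
Qed.

Definition entropy (R : realType) (gamma p r : R) : R := ln p - gamma * ln r.

Lemma entropy_injective (R : realType) (gamma p r p0 r0 : R) :
  1 < gamma -> 0 < p -> 0 < r -> 0 < p0 -> 0 < r0 ->
  entropy gamma p r = entropy gamma p0 r0 -> gamma * p / r = gamma * p0 / r0 ->
  p = p0 /\ r = r0.
Proof.
move=> g1 pp rp p0p r0p E1 E2.
have gn : gamma != 0 by rewrite gt_eqF//; lra.
have E2' : p / r = p0 / r0 by apply: (mulfI gn); rewrite !mulrA.
have E3 : ln p - ln r = ln p0 - ln r0.
  by rewrite -!ln_div ?posrE// E2'.
have Er : ln r = ln r0.
  have : (gamma - 1) * (ln r - ln r0) = 0 by move: E1 E3; rewrite /entropy; lra.
  move=> /eqP; rewrite mulf_eq0 subr_eq0 => /orP[/eqP h|]; first by lra.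
  by rewrite subr_eq0 => /eqP.
have rr : r = r0 by apply: (ln_inj rp r0p); exact: Er.
split=> //; apply: (mulIf (_ : r^-1 != 0)); first by rewrite invr_neq0// gt_eqF.
by rewrite E2' rr.
Qed.

(** The margin of [u1^2] over the critical value is passed on to [u^2 - e], the
    denominator of the slopes of the Mach lines. *)
Lemma fast_state (R : realType) (gamma b0 p u v r u1 : R) :
  1 < gamma -> 0 < p -> 0 < r -> 0 < u1 -> u1 <= u ->
  critical_speed2 gamma b0 < u1 ^+ 2 ->
  (u ^+ 2 + v ^+ 2) / 2 + gamma * p / r / (gamma - 1) = b0 ->
  let e := gamma * p / r in
  [/\ 0 < e, e < u ^+ 2, u ^+ 2 + v ^+ 2 < 2 * b0,
      u1 ^+ 2 - critical_speed2 gamma b0 <= u ^+ 2 - e &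
      e < critical_speed2 gamma b0].
Proof.
move=> g1 p0 r0 u10 u1u cu B e.
have e0 : 0 < e by rewrite /e divr_gt0// mulr_gt0//; lra.
have uu : u1 ^+ 2 <= u ^+ 2 by rewrite ler_pXn2r ?nnegrE ?(ltW u10)// (le_trans (ltW u10)).
have [_ [_]] := critical_speed2P g1 B.
have v0 : 0 <= v ^+ 2 by rewrite sqr_ge0.
have cq : critical_speed2 gamma b0 < u ^+ 2 + v ^+ 2 by clear -cu uu v0; lra.
move=> /(_ cq) ec; rewrite -/e in ec B; split=> //.
- by clear -ec cu uu; lra.
- have : 0 < e / (gamma - 1) by rewrite divr_gt0// subr_gt0.
  by rewrite -B; clear; lra.
- by clear -ec uu; lra.
Qed.

Lemma characteristic_slope_bound (R : realType) (u v e S eps q kap : R) :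
  0 < kap -> 0 < u -> 0 < e -> kap <= u ^+ 2 - e -> u ^+ 2 + v ^+ 2 < 2 * q ->
  0 <= S -> S ^+ 2 = e * (u ^+ 2 + v ^+ 2 - e) -> eps ^+ 2 = 1 ->
  `|v / u| < 2 * q / kap /\ `|(u * v + eps * S) / (u ^+ 2 - e)| < 2 * q / kap.
Proof.
move=> k0 u0 e0 ku qb S0 SE epsE.
have uv : `|u * v| <= (u ^+ 2 + v ^+ 2) / 2.
  have := sqr_ge0 (u - v); have := sqr_ge0 (u + v).
  by rewrite ler_norml; clear => *; apply/andP; split; lra.
have Sb : S <= (u ^+ 2 + v ^+ 2) / 2.
  rewrite -(ler_pXn2r (_ : (0 < 2)%N)) ?nnegrE//; last first.
    by apply: le_trans uv; exact: normr_ge0.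
  rewrite SE -subr_ge0.
  have -> : ((u ^+ 2 + v ^+ 2) / 2) ^+ 2 - e * (u ^+ 2 + v ^+ 2 - e) =
    ((u ^+ 2 + v ^+ 2) / 2 - e) ^+ 2 by field.
  exact: sqr_ge0.
have eps1 : `|eps| = 1.
  have : `|eps| ^+ 2 = 1 by rewrite real_normK// num_real.
  by move/eqP; rewrite sqrp_eq1 ?normr_ge0// => /eqP.
have d0 : 0 < u ^+ 2 - e by exact: lt_le_trans ku.
have q0 : 0 <= (u ^+ 2 + v ^+ 2) / 2 by apply: le_trans uv; exact: normr_ge0.
split.
  have -> : v / u = (u * v) / u ^+ 2 by field; rewrite gt_eqF.
  have uk : kap <= u ^+ 2 by clear -ku e0; lra.
  have u20 : 0 < u ^+ 2 by exact: lt_le_trans uk.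
  rewrite normrM normfV (gtr0_norm u20) ltr_pdivrMr// mulrAC ltr_pdivlMr//.
  apply: (@le_lt_trans _ _ ((u ^+ 2 + v ^+ 2) / 2 * u ^+ 2)).
    by apply: ler_pM => //; exact: ltW.
  by rewrite ltr_pM2r//; clear -qb q0; lra.
rewrite normrM normfV (gtr0_norm d0) ltr_pdivrMr// mulrAC ltr_pdivlMr//.
apply: (@le_lt_trans _ _ ((u ^+ 2 + v ^+ 2) * (u ^+ 2 - e))).
  apply: ler_pM => //; first exact: ltW.
  apply: le_trans (ler_normD _ _) _.
  have -> : `|eps * S| = S by rewrite normrM eps1 mul1r ger0_norm.
  by rewrite [leRHS]splitr lerD.
by rewrite ltr_pM2r.
Qed.

Lemma entropy_grad (R : realType) (gamma : R) (p r : R * R -> R) (z : R * R)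
    (p1 p2 r1 r2 : R) : 0 < p z -> 0 < r z ->
  has_grad p z p1 p2 -> has_grad r z r1 r2 ->
  has_grad (fun x => entropy gamma (p x) (r x)) z
    (p1 / p z - gamma * (r1 / r z)) (p2 / p z - gamma * (r2 / r z)).
Proof.
move=> p0 r0 hp hr.
have -> : (fun x => entropy gamma (p x) (r x)) =
    (fun x => ln (p x) + (- gamma) * ln (r x)).
  by apply/funext => x; rewrite mulNr.
have h1 := has_grad_comp hp (is_derive1_ln p0).
have h2 := has_grad_comp hr (is_derive1_ln r0).
apply: (has_grad_eq (has_gradD h1 (has_gradM (@has_grad_cst R (- gamma) z) h2))).
  by rewrite (mulrC _^-1) [in LHS](mulrC _^-1); ring.
by rewrite (mulrC _^-1) [in LHS](mulrC _^-1); ring.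
Qed.

Lemma flow_angle_grad (R : realType) (u v : R * R -> R) (z : R * R)
    (u1 u2 v1 v2 : R) : u z != 0 -> has_grad u z u1 u2 -> has_grad v z v1 v2 ->
  has_grad (fun x => atan (v x / u x)) z
    ((u z * v1 - v z * u1) / (u z ^+ 2 + v z ^+ 2))
    ((u z * v2 - v z * u2) / (u z ^+ 2 + v z ^+ 2)).
Proof.
move=> u0 hu hv.
have h := has_gradM hv (has_gradV u0 hu).
have n1 : 1 + (v z / u z) ^+ 2 != 0 by rewrite gt_eqF// slope_gt0.
have n2 : u z ^+ 2 + v z ^+ 2 != 0.
  by rewrite gt_eqF// ltr_pwDl ?sqr_ge0// exprn_even_gt0.
apply: (has_grad_eq (has_grad_comp h (is_derive1_atan _))).
  by field; rewrite u0 n2.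
by field; rewrite u0 n2.
Qed.

Lemma sound_speed2_grad (R : realType) (gamma : R) (p r : R * R -> R) (z : R * R)
    (p1 p2 r1 r2 : R) : r z != 0 ->
  has_grad p z p1 p2 -> has_grad r z r1 r2 ->
  has_grad (fun x => gamma * p x / r x) z
    (gamma * (p1 / r z - p z * r1 / r z ^+ 2))
    (gamma * (p2 / r z - p z * r2 / r z ^+ 2)).
Proof.
move=> r0 hp hr.
have h := has_gradM (has_gradM (@has_grad_cst R gamma z) hp) (has_gradV r0 hr).
by apply: (has_grad_eq h); field.
Qed.

Lemma upstream_cone_closure (R : realType) (theta : R) (f : R -> R) (K c y1 t : R)
    (z : R * R) : front_curve (tan theta) f -> upstream_cone f K c y1 t z ->
  closure (Dminus theta f) z.
Proof. by move=> Hf [z2 z1 _ _]; exact: Dminus_closure. Qed.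

Lemma upstream_cone_interiorP (R : realType) (theta : R) (f : R -> R)
    (K c y1 t : R) (z : R * R) : front_curve (tan theta) f ->
  upstream_cone_interior f K c y1 t z ->
  Dminus theta f z /\ upstream_cone f K c y1 t z.
Proof.
move=> Hf [z2 /andP[z1 zf] zK zt]; split; first exact/DminusP.
by split; [exact: ltW|apply/andP; split; exact: ltW|exact: ltW|exact: ltW].
Qed.

Lemma upstream_cone_interior_open (R : realType) (T : R) (f : R -> R)
    (K c y1 t : R) (z : R * R) : front_curve T f -> 0 < K ->
  upstream_cone_interior f K c y1 t z ->
  \forall x \near z, upstream_cone_interior f K c y1 t x.
Proof.
move=> Hf K0 [z2 /andP[z1 zf] zK zt].
have e0 : 0 < (f z.2 - z.1) / 2 by rewrite divr_gt0// subr_gt0.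
have [d [d0 dP]] := front_curve_continuous Hf (ltW z2) e0.
pose m := (K * (c - z.1) - `|z.2 - y1|) / (1 + K).
have K1 : 0 < 1 + K by rewrite addr_gt0.
have m0 : 0 < m by rewrite divr_gt0// subr_gt0.
have mE : m * (1 + K) = K * (c - z.1) - `|z.2 - y1|.
  by rewrite /m; field; rewrite gt_eqF.
clearbody m.
apply/nbhs_ballP; exists (Num.min (Num.min (Num.min d z.2) (Num.min z.1 ((f z.2 - z.1) / 2)))
  (Num.min m (t - z.1))); first by rewrite /= !lt_min d0 z2 z1 e0 m0 subr_gt0.
move=> x []; rewrite /ball/= ![`|_ - x.1|]distrC ![`|_ - x.2|]distrC !lt_min.
move=> /andP[/andP[/andP[a1 a2] /andP[a3 a4]] /andP[a5 a6]].
move=> /andP[/andP[/andP[b1 b2] /andP[b3 b4]] /andP[b5 b6]].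
have x2 : 0 < x.2 by move: b2; rewrite ltr_norml => /andP[+ _]; clear; lra.
split=> //.
- apply/andP; split; first by move: a3; rewrite ltr_norml => /andP[+ _]; clear; lra.
  have := dP _ (ltW x2) b1; move: a4; rewrite !ltr_norml => /andP[_ h1] /andP[h2 _].
  by clear -h1 h2; lra.
- have := ler_normD (x.2 - z.2) (z.2 - y1); rewrite subrKA.
  have : K * (x.1 - z.1) < K * m.
    by rewrite ltr_pM2l//; apply: le_lt_trans a5; exact: ler_norm.
  by clear -mE b5; lra.
- by move: a6; rewrite ltr_norml => /andP[_]; clear; lra.
Qed.

Lemma upstream_cone_constant (R : realType) (T : R) (f : R -> R) (K c y1 t k : R)
    (F F1 F2 lam : R * R -> R) :
  front_curve T f -> 0 < K ->
  {within upstream_cone f K c y1 t, continuous F} ->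
  {within upstream_cone f K c y1 t, continuous lam} ->
  {within upstream_cone f K c y1 t `\` [set vertex R], continuous F2} ->
  (forall z, upstream_cone_interior f K c y1 t z ->
     has_grad F z (F1 z) (F2 z) /\ F1 z + lam z * F2 z = 0) ->
  (forall z, upstream_cone f K c y1 t z -> `|lam z| < K) ->
  (forall z, upstream_cone f K c y1 t z -> 0 < z.1 -> z.1 = f z.2 ->
     lam z * derive1 f z.2 < 1) ->
  (forall z, upstream_cone f K c y1 t z -> z.1 = 0 -> F z = k) ->
  forall z, upstream_cone f K c y1 t z -> F z = k.
Proof.
move=> Hf K0 cF clam cF2 grad lamK lamf Fk z Nz.
apply/eqP; rewrite eq_le; apply/andP; split.
  apply: (upstream_cone_transport Hf K0 cF clam cF2 grad lamK lamf _ Nz).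
  by move=> x Nx x1; rewrite Fk.
rewrite -lerN2.
apply: (@upstream_cone_transport _ T f K c y1 t _ (fun x => - F x)
  (fun x => - F1 x) (fun x => - F2 x) lam Hf K0 _ clam) => //.
- by move: cF; rewrite !subspace_continuousP => cF x Nx; apply: cvgN; exact: cF.
- by move: cF2; rewrite !subspace_continuousP => cF2 x Nx; apply: cvgN; exact: cF2.
- move=> x Ix; have [gF F12] := grad x Ix; split; first exact: has_gradN.
  by rewrite mulrN -opprD F12 oppr0.
- by move=> x Nx x1; rewrite Fk.
Qed.

(** The flow in a truncated cone where it stays faster than [u1], itself above the
    critical speed: there [x] is a time-like variable and the front is crossed
    outwards by all characteristics. *)
Record upstream_setting (R : realType) (gamma p0 u0 rho0 theta : R) (f : R -> R)
    (p u v rho : R * R -> R) (u1 K c y1 t : R) : Prop := UpstreamSetting {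
  us_gamma : 1 < gamma ;
  us_p0 : 0 < p0 ;
  us_u0 : 0 < u0 ;
  us_rho0 : 0 < rho0 ;
  us_front : front_curve (tan theta) f ;
  us_flow : flow_up_to gamma (bernoulli_constant gamma p0 u0 rho0)
    (Dminus theta f) p u v rho ;
  us_data : forall z, z.1 = 0 -> 0 <= z.2 ->
    [/\ trace (Dminus theta f) p z = p0, trace (Dminus theta f) u z = u0,
        trace (Dminus theta f) v z = 0 & trace (Dminus theta f) rho z = rho0] ;
  us_spacelike : forall y, 0 < y -> u1 <= trace (Dminus theta f) u (f y, y) ->
    let s := derive1 f y in
    let P := trace (Dminus theta f) p (f y, y) in
    let U := trace (Dminus theta f) u (f y, y) in
    let V := trace (Dminus theta f) v (f y, y) in
    let Q := trace (Dminus theta f) rho (f y, y) in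
    0 < U - s * V /\ (1 + s ^+ 2) * (gamma * P / Q) < (U - s * V) ^+ 2 ;
  us_u1 : 0 < u1 <= u0 ;
  us_crit : critical_speed2 gamma (bernoulli_constant gamma p0 u0 rho0) < u1 ^+ 2 ;
  us_K : 2 * bernoulli_constant gamma p0 u0 rho0
    / (u1 ^+ 2 - critical_speed2 gamma (bernoulli_constant gamma p0 u0 rho0)) < K ;
  us_fast : forall z, upstream_cone f K c y1 t z -> u1 <= trace (Dminus theta f) u z }.

Lemma upstream_point (R : realType) (gamma p0 u0 rho0 theta : R) (f : R -> R)
    (p u v rho : R * R -> R) (u1 K c y1 t : R) (z : R * R) :
  upstream_setting gamma p0 u0 rho0 theta f p u v rho u1 K c y1 t ->
  upstream_cone f K c y1 t z ->
  let b0 := bernoulli_constant gamma p0 u0 rho0 in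
  let A := Dminus theta f in
  let P := trace A p z in let U := trace A u z in
  let V := trace A v z in let Q := trace A rho z in
  let e := gamma * P / Q in
  [/\ closure A z, [/\ 0 < P, 0 < Q & 0 < U],
      [/\ 0 < e, e < U ^+ 2 & e < critical_speed2 gamma b0],
      (U ^+ 2 + V ^+ 2) / 2 + e / (gamma - 1) = b0 &
      forall eps, eps ^+ 2 = 1 ->
       let S := Num.sqrt (e * (U ^+ 2 + V ^+ 2 - e)) in
       let l := (U * V + eps * S) / (U ^+ 2 - e) in
       [/\ S ^+ 2 = e * (U ^+ 2 + V ^+ 2 - e), `|V / U| < K, `|l| < K &
         0 < z.1 -> z.1 = f z.2 ->
           V / U * derive1 f z.2 < 1 /\ l * derive1 f z.2 < 1]].
Proof.
move=> us Nz b0 A P U V Q e; have Hf := us_front us.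
have Az : closure A z by exact: upstream_cone_closure Nz.
have [P0 Q0] := fu_pos (us_flow us) Az; rewrite -/P -/Q in P0 Q0.
have B := fu_bernoulli (us_flow us) Az; rewrite -/A -/P -/U -/V -/Q -/e -/b0 in B.
have u1U := us_fast us Nz; rewrite -/U in u1U.
have /andP[u10 _] := us_u1 us.
have U0 : 0 < U by exact: lt_le_trans u1U.
have [e0 eU q kap ec] := fast_state (us_gamma us) P0 Q0 u10 u1U (us_crit us) B.
rewrite -/e -/b0 in e0 eU q kap ec.
split=> // eps epsE S l.
have q0 : 0 <= U ^+ 2 + V ^+ 2 - e.
  by have := sqr_ge0 V; clear -eU; lra.
have SE : S ^+ 2 = e * (U ^+ 2 + V ^+ 2 - e).
  by rewrite sqr_sqrtr// mulr_ge0// ltW.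
have kap0 : 0 < u1 ^+ 2 - critical_speed2 gamma b0 by rewrite subr_gt0; exact: (us_crit us).
have S0 : 0 <= S by exact: sqrtr_ge0.
have [wK lK] := characteristic_slope_bound kap0 U0 e0 kap q S0 SE epsE.
split; [exact: SE|exact: lt_trans wK (us_K us)|exact: lt_trans lK (us_K us)|].
move=> z1 zf.
have z2 : 0 < z.2.
  case: Nz => + _ _ _; rewrite le_eqVlt => /predU1P[h|//].
  by move: z1; rewrite zf -h (fc_0 Hf) ltxx.
have zE : (f z.2, z.2) = z by rewrite -zf; case: (z).
have := us_spacelike us z2; rewrite zE -/A -/P -/U -/V -/Q => /(_ u1U)[un une].
split; last exact: (spacelike_front U0 e0 eU SE epsE un une).
by rewrite mulrAC ltr_pdivrMr// mul1r mulrC -subr_gt0.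
Qed.

Lemma upstream_traces_continuous (R : realType) (gamma p0 u0 rho0 theta : R)
    (f : R -> R) (p u v rho : R * R -> R) (u1 K c y1 t : R) (z : R * R) :
  upstream_setting gamma p0 u0 rho0 theta f p u v rho u1 K c y1 t ->
  upstream_cone f K c y1 t z -> forall F, [\/ F = p, F = u, F = v | F = rho] ->
  let N := upstream_cone f K c y1 t in let A := Dminus theta f in
  trace A F @ within N (nbhs z) --> trace A F z /\
  (z <> vertex R ->
    [/\ trace A F @ within (N `\` [set vertex R]) (nbhs z) --> trace A F z,
        trace A (dx F) @ within (N `\` [set vertex R]) (nbhs z) --> trace A (dx F) z &
        trace A (dy F) @ within (N `\` [set vertex R]) (nbhs z) --> trace A (dy F) z]).
Proof.
move=> us Nz F HF N A; have fl := us_flow us.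
have NA : N `<=` closure A by move=> x Nx; exact: upstream_cone_closure (us_front us) Nx.
have cF : {within N, continuous (trace A F)}.
  exact: continuous_subspaceW NA (fu_cont fl HF).
split; first exact: within_cvg.
move=> zO; have [c1 c2] := fu_grad_cont fl HF.
have NA' : N `\` [set vertex R] `<=` closure A `\` [set vertex R] by exact: setSD.
have NN : N `\` [set vertex R] `<=` N by move=> x [].
have Nz' : (N `\` [set vertex R]) z by split.
split.
- exact: within_cvg (continuous_subspaceW NN cF) Nz'.
- exact: within_cvg (continuous_subspaceW NA' c1) Nz'.
- exact: within_cvg (continuous_subspaceW NA' c2) Nz'.
Qed.

Lemma upstream_setting_K (R : realType) (gamma p0 u0 rho0 theta : R) (f : R -> R)
    (p u v rho : R * R -> R) (u1 K c y1 t : R) :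
  upstream_setting gamma p0 u0 rho0 theta f p u v rho u1 K c y1 t -> 0 < K.
Proof.
move=> us; apply: le_lt_trans (us_K us).
have h1 := us_crit us; have g1 := us_gamma us.
have b00 : 0 <= bernoulli_constant gamma p0 u0 rho0.
  rewrite /bernoulli_constant addr_ge0// divr_ge0 ?sqr_ge0//.
    by rewrite mulr_ge0 ?(ltW (us_p0 us))//; clear -g1; lra.
  by rewrite mulr_ge0 ?(ltW (us_rho0 us))//; clear -g1; lra.
by rewrite divr_ge0 ?mulr_ge0// subr_ge0 ltW.
Qed.

Lemma entropy_transport (R : realType) (gamma p u v r p1 p2 r1 r2 : R) :
  0 < p -> 0 < r -> 0 < u ->
  r * (u * p1 + v * p2) = gamma * p * (u * r1 + v * r2) ->
  p1 / p - gamma * (r1 / r) + v / u * (p2 / p - gamma * (r2 / r)) = 0.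
Proof.
move=> p0 r0 u0 S.
have -> : p1 / p - gamma * (r1 / r) + v / u * (p2 / p - gamma * (r2 / r)) =
  (r * (u * p1 + v * p2) - gamma * p * (u * r1 + v * r2)) / (p * r * u).
  by field; rewrite !gt_eqF.
by rewrite S subrr mul0r.
Qed.

(** Entropy is transported along the streamlines, which come from [x = 0]. *)
Lemma upstream_entropy (R : realType) (gamma p0 u0 rho0 theta : R) (f : R -> R)
    (p u v rho : R * R -> R) (u1 K c y1 t : R) :
  upstream_setting gamma p0 u0 rho0 theta f p u v rho u1 K c y1 t ->
  let A := Dminus theta f in
  forall z, upstream_cone f K c y1 t z ->
  entropy gamma (trace A p z) (trace A rho z) = entropy gamma p0 rho0.
Proof.
move=> us A; set N := upstream_cone f K c y1 t; have fl := us_flow us.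
have Hf := us_front us.
have pt z : N z -> _ := fun Nz => upstream_point us Nz.
have ct z : N z -> _ := fun Nz => upstream_traces_continuous us Nz.
have is_p : [\/ p = p, p = u, p = v | p = rho] by exact: Or41.
have is_u : [\/ u = p, u = u, u = v | u = rho] by exact: Or42.
have is_v : [\/ v = p, v = u, v = v | v = rho] by exact: Or43.
have is_r : [\/ rho = p, rho = u, rho = v | rho = rho] by exact: Or44.
have K0 := upstream_setting_K us.
pose F1 z := trace A (dx p) z / trace A p z
  - gamma * (trace A (dx rho) z / trace A rho z).
pose F2 z := trace A (dy p) z / trace A p z
  - gamma * (trace A (dy rho) z / trace A rho z).
apply: (@upstream_cone_constant _ _ f K c y1 t _ _ F1 F2
  (fun z => trace A v z / trace A u z) Hf K0).
- apply/subspace_continuousP => z Nz; have [_ [P0 Q0 _] _ _ _] := pt z Nz.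
  have [cp _] := ct z Nz _ is_p; have [cr _] := ct z Nz _ is_r.
  apply: cvgB; first exact: cvg_real_comp (continuous_ln P0) cp.
  apply: cvgMl_tmp; exact: cvg_real_comp (continuous_ln Q0) cr.
- apply/subspace_continuousP => z Nz; have [_ [_ _ U0] _ _ _] := pt z Nz.
  have [cu _] := ct z Nz _ is_u; have [cv _] := ct z Nz _ is_v.
  exact: (cvg_quotient U0 cv cu).
- apply/subspace_continuousP => z [Nz zO]; have [_ [P0 Q0 _] _ _ _] := pt z Nz.
  have [_ /(_ zO)[cp _ cp2]] := ct z Nz _ is_p.
  have [_ /(_ zO)[cr _ cr2]] := ct z Nz _ is_r.
  apply: cvgB; first exact: (cvg_quotient P0 cp2 cp).
  by apply: cvgMl_tmp; exact: (cvg_quotient Q0 cr2 cr).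
- move=> z Iz; have [Az Nz] := upstream_cone_interiorP Hf Iz.
  have [_ [P0 Q0 U0] _ _ _] := pt z Nz.
  split; first exact: entropy_grad P0 Q0 (fu_grad fl is_p Az) (fu_grad fl is_r Az).
  have [S _ _ _ _] := fu_relations fl Az; rewrite -/A in S.
  exact: (entropy_transport P0 Q0 U0 S).
- by move=> z Nz; have [_ _ _ _ /(_ 1 (expr1n _ _))[]] := pt z Nz.
- by move=> z Nz z1 zf; have [_ _ _ _ /(_ 1 (expr1n _ _))[_ _ _ /(_ z1 zf)[]]] := pt z Nz.
- move=> z Nz z1; have [z2 _ _ _] := Nz.
  by have [-> _ _ ->] := us_data us z1 z2.
Qed.

Lemma primitive_increasing (R : realType) (G g : R -> R) (a b x y : R) :
  (forall t, a < t < b -> is_derive t (1 : R) G (g t)) ->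
  (forall t, a < t < b -> 0 < g t) -> a < x -> x < y -> y < b -> G x < G y.
Proof.
move=> dG g0 ax xy yb.
have d1 t : t \in `]x, y[%R -> is_derive t (1 : R) G (g t).
  by rewrite in_itv/= => /andP[t1 t2]; apply: dG; rewrite (lt_trans ax)// (lt_trans t2).
have c1 : {within `[x, y], continuous G}.
  apply: derivable_within_continuous => t; rewrite in_itv/= => /andP[t1 t2].
  have tab : a < t < b by rewrite (lt_le_trans ax)// (le_lt_trans t2).
  by have [] := dG t tab.
have [t] := MVT xy d1 c1; rewrite in_itv/= => /andP[t1 t2] E.
rewrite -subr_gt0 E mulr_gt0 ?subr_gt0//.
by apply: g0; rewrite (lt_trans ax)// (lt_trans t2).
Qed.

(** The rate at which the flow angle varies with the squared sound speed along
    a Mach line of an isentropic flow with Bernoulli constant [b0]: its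
    primitive is the Prandtl-Meyer function. *)
Definition turning_rate (R : realType) (gamma b0 e : R) : R :=
  let q2 := 2 * b0 - 2 * e / (gamma - 1) in
  Num.sqrt (e * (q2 - e)) / (q2 * e * (gamma - 1)).

Lemma turning_rate_gt0_continuous (R : realType) (gamma b0 a : R) :
  1 < gamma -> 0 < a -> let b := critical_speed2 gamma b0 in a < b ->
  {within `[a, b], continuous (turning_rate gamma b0)} /\
  forall e, a < e < b -> 0 < turning_rate gamma b0 e.
Proof.
move=> g1 a0 b ab.
have gm : 0 < gamma - 1 by rewrite subr_gt0.
pose q2 e : R := 2 * b0 - 2 * e / (gamma - 1).
have qb : q2 b = b.
  by rewrite /q2 /b /critical_speed2; field; rewrite !gt_eqF//; clear -g1; lra.
have qm e : q2 e = b + 2 * (b - e) / (gamma - 1).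
  by rewrite -{1}qb /q2; field; rewrite gt_eqF.
have b_0 : 0 < b by exact: lt_trans ab.
have qpos e : e <= b -> b <= q2 e.
  by move=> eb; rewrite qm lerDl divr_ge0 ?(ltW gm)// mulr_ge0// subr_ge0.
split.
  apply/subspace_continuousP => e; rewrite /= in_itv/= => /andP[ae eb].
  have cid : id @ within `[a, b]%classic (nbhs e) --> e by apply: cvg_within_filter; exact: cvg_id.
  have cq : q2 @ within `[a, b]%classic (nbhs e) --> q2 e.
    apply: cvgB; first exact: cvg_cst.
    by apply: cvgMr_tmp; apply: cvgMl_tmp; exact: cid.
  apply: cvgM.
    apply: (continuous_cvg _ (@sqrt_continuous R _)).
    by apply: cvgM => //; apply: cvgB.
  apply: cvgV.
    rewrite !mulf_neq0 ?(gt_eqF gm)//.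
      by rewrite gt_eqF// (lt_le_trans b_0)// qpos.
    by rewrite gt_eqF// (lt_le_trans a0).
  by apply: cvgMr_tmp; apply: cvgM.
move=> e /andP[ae eb]; have e0 := lt_trans a0 ae.
have q0 := qpos e (ltW eb).
rewrite /turning_rate -/(q2 e) divr_gt0//.
  by rewrite sqrtr_gt0 mulr_gt0// subr_gt0 (lt_le_trans eb).
by rewrite !mulr_gt0// (lt_le_trans b_0).
Qed.

(** The invariants [atan (v / u) + eps om(e)], with [om] a primitive of the
    turning rate, are transported exactly along the Mach lines. *)
Lemma riemann_transport (R : realType)
    (gamma b0 p u v r p1 p2 u1 u2 v1 v2 r1 r2 e eps l : R) :
  1 < gamma -> 0 < p -> 0 < r -> 0 < u ->
  euler_relations gamma p u v r p1 p2 u1 u2 v1 v2 r1 r2 ->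
  p1 / p = gamma * (r1 / r) -> p2 / p = gamma * (r2 / r) ->
  e = gamma * p / r -> e < u ^+ 2 ->
  (u ^+ 2 + v ^+ 2) / 2 + e / (gamma - 1) = b0 -> eps ^+ 2 = 1 ->
  l = (u * v + eps * Num.sqrt (e * (u ^+ 2 + v ^+ 2 - e))) / (u ^+ 2 - e) ->
  (u * v1 - v * u1) / (u ^+ 2 + v ^+ 2)
    + eps * (turning_rate gamma b0 e * (gamma * (p1 / r - p * r1 / r ^+ 2)))
  + l * ((u * v2 - v * u2) / (u ^+ 2 + v ^+ 2)
    + eps * (turning_rate gamma b0 e * (gamma * (p2 / r - p * r2 / r ^+ 2)))) = 0.
Proof.
move=> g1 p0 r0 u0 rel i1 i2 eE eu B epsE lE.
have e0 : 0 < e by rewrite eE divr_gt0// mulr_gt0//; lra.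
have SE : Num.sqrt (e * (u ^+ 2 + v ^+ 2 - e)) ^+ 2 = e * (u ^+ 2 + v ^+ 2 - e).
  rewrite sqr_sqrtr// mulr_ge0 ?(ltW e0)//.
  by have := sqr_ge0 v; clear -eu; lra.
have H := characteristic_relation rel eE eu SE epsE lE.
have q2E : 2 * b0 - 2 * e / (gamma - 1) = u ^+ 2 + v ^+ 2.
  by rewrite -B; field; rewrite gt_eqF// subr_gt0.
rewrite /turning_rate q2E.
set S := Num.sqrt _ in H lE *.
have q0 : u ^+ 2 + v ^+ 2 != 0 by rewrite gt_eqF// ltr_pwDl ?sqr_ge0// exprn_gt0.
have gn : gamma != 0 by rewrite gt_eqF//; clear -g1; lra.
have gmn : gamma - 1 != 0 by rewrite gt_eqF// subr_gt0.
have n1 : p != 0 by rewrite gt_eqF.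
have n2 : r != 0 by rewrite gt_eqF.
have j q s : q / p = gamma * (s / r) ->
    gamma * (q / r - p * s / r ^+ 2) = (gamma - 1) * q / r.
  move=> h; have -> : s = (gamma * (s / r)) * r / gamma by field; rewrite gn n2.
  by rewrite -h; field; rewrite gn n1 n2.
rewrite !j//.
have -> : (u * v1 - v * u1) / (u ^+ 2 + v ^+ 2)
   + eps * (S / ((u ^+ 2 + v ^+ 2) * e * (gamma - 1)) * ((gamma - 1) * p1 / r))
 + l * ((u * v2 - v * u2) / (u ^+ 2 + v ^+ 2)
   + eps * (S / ((u ^+ 2 + v ^+ 2) * e * (gamma - 1)) * ((gamma - 1) * p2 / r)))
 = (gamma * p * ((u * v1 - v * u1) + l * (u * v2 - v * u2))
    + eps * S * (p1 + l * p2)) / (gamma * p * (u ^+ 2 + v ^+ 2)).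
  by clearbody S; rewrite eE; field; rewrite gn gmn n1 n2 q0.
by rewrite H !mulNr addNr mul0r.
Qed.

(** The entropy being uniform, both Riemann invariants are transported along Mach
    lines that come from the uniform data. Their sum and difference give the flow
    angle and the sound speed, as the Prandtl-Meyer function is increasing. *)
Lemma upstream_uniform_in_cone (R : realType) (gamma p0 u0 rho0 theta : R)
    (f : R -> R) (p u v rho : R * R -> R) (u1 K c y1 t : R) :
  upstream_setting gamma p0 u0 rho0 theta f p u v rho u1 K c y1 t ->
  let A := Dminus theta f in
  forall z, upstream_cone f K c y1 t z ->
  [/\ trace A p z = p0, trace A u z = u0, trace A v z = 0 & trace A rho z = rho0].
Proof.
move=> us A; set N := upstream_cone f K c y1 t; have fl := us_flow us.
have Hf := us_front us; have K0 := upstream_setting_K us.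
have g1 := us_gamma us; have gm : 0 < gamma - 1 by rewrite subr_gt0.
have pt z : N z -> _ := fun Nz => upstream_point us Nz.
have ct z : N z -> _ := fun Nz => upstream_traces_continuous us Nz.
have is_p : [\/ p = p, p = u, p = v | p = rho] by exact: Or41.
have is_u : [\/ u = p, u = u, u = v | u = rho] by exact: Or42.
have is_v : [\/ v = p, v = u, v = v | v = rho] by exact: Or43.
have is_r : [\/ rho = p, rho = u, rho = v | rho = rho] by exact: Or44.
pose b0 := bernoulli_constant gamma p0 u0 rho0.
pose e z := gamma * trace A p z / trace A rho z.
pose e0 := gamma * p0 / rho0.
pose cs := critical_speed2 gamma b0.
have cN : compact N by exact: (@upstream_cone_compact _ _ _ _ c y1 t Hf K0).
have ce : forall z, N z -> e @ within N (nbhs z) --> e z.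
  move=> z Nz; have [_ [P0 Q0 _] _ _ _] := pt z Nz.
  have [cp _] := ct z Nz _ is_p; have [cr _] := ct z Nz _ is_r.
  by apply: (cvg_quotient Q0 _ cr); apply: cvgMl_tmp; exact: cp.
have [e00 e0cs] : 0 < e0 /\ e0 < cs.
  have /andP[u10 u1u] := us_u1 us.
  have B0 : (u0 ^+ 2 + 0 ^+ 2) / 2 + gamma * p0 / rho0 / (gamma - 1) = b0.
    rewrite /b0 /bernoulli_constant; field.
    by rewrite !gt_eqF//; exact: (us_rho0 us).
  by have [] := fast_state g1 (us_p0 us) (us_rho0 us) u10 u1u (us_crit us) B0.
(* The turning rate is singular at [e = 0]: its primitive is taken on an interval
   bounded away from zero, which exists by compactness. *)
have [a [a0 aN ae0]] : exists a, [/\ 0 < a, forall z, N z -> a < e z & a < e0].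
  have ci : {within N, continuous (fun z => (e z)^-1)}.
    apply/subspace_continuousP => z Nz; have [_ _ [ez _ _] _ _] := pt z Nz.
    by apply: cvgV; [rewrite gt_eqF|exact: ce].
  have [C [C0 CP]] := compact_bound cN ci.
  exists (Num.min C^-1 e0 / 2).
  have m0 : 0 < Num.min C^-1 e0 by rewrite lt_min invr_gt0 C0.
  have mh : Num.min C^-1 e0 / 2 < Num.min C^-1 e0 by clear -m0; lra.
  split; first by rewrite divr_gt0.
    move=> z Nz; apply: lt_le_trans mh _; rewrite ge_min; apply/orP; left.
    have [_ _ [ez _ _] _ _] := pt z Nz.
    have := CP z Nz; rewrite gtr0_norm ?invr_gt0// => h.
    by rewrite -[e z]invrK lef_pV2 ?posrE ?invr_gt0.
  by apply: lt_le_trans mh _; rewrite ge_min lexx orbT.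
have acs : a < cs by exact: lt_trans e0cs.
have [ck kpos] := turning_rate_gt0_continuous g1 a0 acs.
have [om omP] := primitive_exists acs ck.
have eN z : N z -> a < e z < cs.
  by move=> Nz; have [_ _ [_ _ ez] _ _] := pt z Nz; rewrite aN.
have om_cont z : N z -> {for e z, continuous om}.
  by move=> Nz; exact: is_derive_continuous (omP _ (eN z Nz)).
have zpos z : upstream_cone_interior f K c y1 t z ->
    trace A (dx p) z / trace A p z = gamma * (trace A (dx rho) z / trace A rho z) /\
    trace A (dy p) z / trace A p z = gamma * (trace A (dy rho) z / trace A rho z).
  move=> Iz; have [Az Nz] := upstream_cone_interiorP Hf Iz.
  have [_ [P0 Q0 _] _ _ _] := pt z Nz.
  have gs := entropy_grad gamma P0 Q0 (fu_grad fl is_p Az) (fu_grad fl is_r Az).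
  have nb : \forall x \near z, entropy gamma (trace A p x) (trace A rho x)
      = entropy gamma p0 rho0.
    apply: filterS (upstream_cone_interior_open Hf K0 Iz) => x Ix.
    by apply: (upstream_entropy us); have [] := upstream_cone_interiorP Hf Ix.
  have gs' := has_grad_near nb gs.
  have g0 := @has_grad_cst R (entropy gamma p0 rho0) z.
  have := has_grad_dxE gs'; rewrite (has_grad_dxE g0) => /esym/eqP.
  rewrite subr_eq0 => /eqP h1.
  have := has_grad_dyE gs'; rewrite (has_grad_dyE g0) => /esym/eqP.
  rewrite subr_eq0 => /eqP h2.
  by split; [exact: h1|exact: h2].
have inv eps : eps ^+ 2 = 1 -> forall z, N z ->
    atan (trace A v z / trace A u z) + eps * om (e z) = eps * om e0.
  move=> epsE.
  pose k z := turning_rate gamma b0 (e z).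
  pose S z := Num.sqrt (e z * (trace A u z ^+ 2 + trace A v z ^+ 2 - e z)).
  pose G (d : (R * R -> R) -> R * R -> R) z :=
    (trace A u z * trace A (d v) z - trace A v z * trace A (d u) z)
      / (trace A u z ^+ 2 + trace A v z ^+ 2)
    + eps * (k z * (gamma * (trace A (d p) z / trace A rho z
        - trace A p z * trace A (d rho) z / trace A rho z ^+ 2))).
  apply: (@upstream_cone_constant _ _ f K c y1 t _ _ (G (@dx R)) (G (@dy R))
   (fun z => (trace A u z * trace A v z + eps * S z) / (trace A u z ^+ 2 - e z)) Hf K0).
  - apply/subspace_continuousP => z Nz; have [_ [_ _ U0] _ _ _] := pt z Nz.
    have [cu _] := ct z Nz _ is_u; have [cv _] := ct z Nz _ is_v.
    apply: cvgD.
      apply: (cvg_real_comp (@continuous_atan R _)).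
      exact: (cvg_quotient U0 cv cu).
    by apply: cvgMl_tmp; apply: cvg_real_comp (om_cont z Nz) (ce z Nz).
  - apply/subspace_continuousP => z Nz; have [_ [_ _ U0] [_ ez _] _ _] := pt z Nz.
    have [cu _] := ct z Nz _ is_u; have [cv _] := ct z Nz _ is_v.
    have cu2 : (fun z => trace A u z ^+ 2) @ within N (nbhs z) --> trace A u z ^+ 2.
      by rewrite expr2; exact: (cvgM cu cu).
    have cv2 : (fun z => trace A v z ^+ 2) @ within N (nbhs z) --> trace A v z ^+ 2.
      by rewrite expr2; exact: (cvgM cv cv).
    have ez' := ce z Nz.
    apply: cvg_quotient; [by rewrite subr_gt0| |by apply: cvgB; [exact: cu2|exact: ez']].
    apply: cvgD; first exact: (cvgM cu cv).
    apply: cvgMl_tmp; apply: (cvg_real_comp (@sqrt_continuous R _)).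
    apply: cvgM; first exact: ez'.
    by apply: cvgB; [exact: (cvgD cu2 cv2)|exact: ez'].
  - apply/subspace_continuousP => z [Nz zO]; have [_ [P0 Q0 U0] _ _ _] := pt z Nz.
    have [_ /(_ zO)[cp _ cp2]] := ct z Nz _ is_p.
    have [_ /(_ zO)[cr _ cr2]] := ct z Nz _ is_r.
    have [_ /(_ zO)[cu _ cu2]] := ct z Nz _ is_u.
    have [_ /(_ zO)[cv _ cv2]] := ct z Nz _ is_v.
    have ce' : e @ within (N `\` [set vertex R]) (nbhs z) --> e z.
      by apply: (cvg_quotient Q0 _ cr); apply: cvgMl_tmp; exact: cp.
    have ck' : k @ within (N `\` [set vertex R]) (nbhs z) --> k z.
      apply: (cvg_real_comp _ ce').
      have ei : e z \in `]a, cs[%R by rewrite in_itv/= eN.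
      exact: (within_continuous_continuous acs ck ei).
    apply: cvgD.
      apply: cvg_quotient.
      + by rewrite ltr_pwDl ?sqr_ge0// exprn_gt0.
      + by apply: cvgB; [exact: (cvgM cu cv2)|exact: (cvgM cv cu2)].
      + by apply: cvgD; rewrite expr2; [exact: (cvgM cu cu)|exact: (cvgM cv cv)].
    apply: cvgMl_tmp; apply: cvgM; first exact: ck'.
    apply: cvgMl_tmp; apply: cvgB; first exact: (cvg_quotient Q0 cp2 cr).
    apply: cvg_quotient; [by rewrite exprn_gt0|exact: (cvgM cp cr2)|].
    by rewrite expr2; exact: (cvgM cr cr).
  - move=> z Iz; have [Az Nz] := upstream_cone_interiorP Hf Iz.
    have [_ [P0 Q0 U0] [ez eU _] B /(_ eps epsE)[SE _ _ _]] := pt z Nz.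
    have n2 : trace A rho z != 0 by rewrite gt_eqF.
    have n3 : trace A u z != 0 by rewrite gt_eqF.
    split.
      have h1 := flow_angle_grad n3 (fu_grad fl is_u Az) (fu_grad fl is_v Az).
      have h2 := sound_speed2_grad gamma n2 (fu_grad fl is_p Az) (fu_grad fl is_r Az).
      have h3 := has_grad_comp h2 (omP _ (eN z Nz)).
      apply: (has_grad_eq (has_gradD h1 (has_gradM (@has_grad_cst R eps z) h3))).
        by rewrite mulr0 addr0.
      by rewrite mulr0 addr0.
    have [i1 i2] := zpos z Iz.
    have rel := fu_relations fl Az; rewrite -/A in rel.
    exact: (riemann_transport g1 P0 Q0 U0 rel i1 i2 erefl eU B epsE erefl).
  - by move=> z Nz; have [_ _ _ _ /(_ eps epsE)[]] := pt z Nz.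
  - by move=> z Nz z1 zf; have [_ _ _ _ /(_ eps epsE)[_ _ _ /(_ z1 zf)[]]] := pt z Nz.
  - move=> z Nz z1; have [z2 _ _ _] := Nz.
    have [h1 h2 h3 h4] := us_data us z1 z2.
    by rewrite /e /e0 h1 h2 h3 h4 mul0r atan0 add0r.
move=> z Nz; have [_ [P0 Q0 U0] [_ _ _] B _] := pt z Nz.
have I1 := inv 1 (expr1n _ _) z Nz.
have m1 : (-1 : R) ^+ 2 = 1 by rewrite sqrrN expr1n.
have I2 := inv (-1) m1 z Nz.
have th0 : atan (trace A v z / trace A u z) = 0.
  move: I1 I2; rewrite !mul1r !mulN1r; move: (atan _) (om _) (om _) => x y w.
  by clear; lra.
have V0 : trace A v z = 0.
  have : trace A v z / trace A u z = 0 by rewrite -[LHS]atanK th0 tan0.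
  by move/eqP; rewrite mulf_eq0 invr_eq0 (gt_eqF U0) orbF => /eqP.
have omE : om (e z) = om e0 by move: I1; rewrite th0 !mul1r add0r.
have eE : e z = e0.
  have /andP[az bz] := eN z Nz.
  case: (ltgtP (e z) e0) => // h.
    by have := primitive_increasing omP kpos az h e0cs; rewrite omE ltxx.
  by have := primitive_increasing omP kpos ae0 h bz; rewrite omE ltxx.
have [-> ->] := entropy_injective g1 P0 Q0 (us_p0 us) (us_rho0 us)
  (upstream_entropy us Nz) eE.
split=> //.
have : trace A u z ^+ 2 = u0 ^+ 2.
  have E0 : b0 = u0 ^+ 2 / 2 + e0 / (gamma - 1).
    rewrite /b0 /bernoulli_constant /e0; field.
    by rewrite !gt_eqF//; exact: (us_rho0 us).
  move: B; rewrite V0 -/(e z) eE -/b0 E0 expr0n/= addr0.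
  by move: (trace A u z) => x; clear; lra.
by move/eqP; rewrite eqrXn2 ?(ltW U0) ?(ltW (us_u0 us))// => /eqP.
Qed.

Lemma bernoulli_constantE (R : realType) (gamma p0 u0 rho0 : R) :
  1 < gamma -> 0 < rho0 ->
  (u0 ^+ 2 + 0 ^+ 2) / 2 + gamma * p0 / rho0 / (gamma - 1)
    = bernoulli_constant gamma p0 u0 rho0.
Proof.
move=> g1 r0; rewrite /bernoulli_constant; field.
by rewrite !gt_eqF// subr_gt0.
Qed.

Lemma supersonic_upstream (R : realType) (gamma p0 u0 rho0 : R) :
  1 < gamma -> 0 < p0 -> 0 < u0 -> 0 < rho0 -> 1 < mach0 gamma p0 u0 rho0 ->
  critical_speed2 gamma (bernoulli_constant gamma p0 u0 rho0) < u0 ^+ 2.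
Proof.
move=> g1 p00 u00 r0 M; have [_ /(_ M) h] := sqr_mach0 g1 p00 r0 u00.
have [_ [+ _]] := critical_speed2P g1 (bernoulli_constantE p0 u0 g1 r0).
by rewrite expr0n/= addr0; apply; rewrite ltr_pdivrMr// [_ * rho0]mulrC.
Qed.

(** The flow behind the front is subsonic and moves to the right: with a fast
    state ahead, all upstream characteristics run into the front. *)
Lemma solution_spacelike (R : realType) (gamma p0 u0 rho0 thetaW : R)
    (f : R -> R) (p u v rho : R * R -> R) (y u1 : R) :
  1 < gamma -> 0 < thetaW < pi / 2 ->
  transonic_shock_solution gamma p0 u0 rho0 thetaW f p u v rho ->
  positive_upto (Dplus thetaW f) u ->
  0 < u1 ->
  critical_speed2 gamma (bernoulli_constant gamma p0 u0 rho0) < u1 ^+ 2 ->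
  0 < y -> u1 <= trace (Dminus thetaW f) u (f y, y) ->
  let A := Dminus thetaW f in let z := (f y, y) in
  let s := derive1 f y in let P := trace A p z in let U := trace A u z in
  let V := trace A v z in let Q := trace A rho z in
  0 < U - s * V /\ (1 + s ^+ 2) * (gamma * P / Q) < (U - s * V) ^+ 2.
Proof.
move=> g1 th sol up u10 cu y0 u1U A z s P U V Q.
have [cm cp [e1 e2 e3 e4]] := solution_jumps th sol y0.
have flm := solution_flow g1 th sol (or_introl erefl).
have flp := solution_flow g1 th sol (or_intror erefl).
have [P0 Q0] := fu_pos flm cm; have [P'0 Q'0] := fu_pos flp cp.
have U0 : 0 < U by exact: lt_le_trans u1U.
have cU : critical_speed2 gamma (bernoulli_constant gamma p0 u0 rho0) < U ^+ 2.
  apply: lt_le_trans cu _.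
  by rewrite ler_pXn2r// nnegrE ltW.
have U'0 := up _ cp.
have e'0 : 0 < gamma * trace (Dplus thetaW f) p z / trace (Dplus thetaW f) rho z.
  by rewrite divr_gt0// mulr_gt0// (lt_trans ltr01).
have sub := (mach_sonic_cmp (trace (Dplus thetaW f) u z) (trace (Dplus thetaW f) v z) e'0).1
  (tss_subsonic sol cp).
exact: (shock_supersonic_normal g1 P0 Q0 Q'0 e4 e1 e2 e3 (fu_bernoulli flm cm)
  (fu_bernoulli flp cp) U0 cU U'0 sub).
Qed.

(** Consider the leftmost point of a backward cone where [u <= u1], for some [u1]
    between the critical speed and [u0]. The flow is fast in the part of the cone
    to the left of that point, hence uniform there, up to the point itself: then
    [u = u0] contradicts [u <= u1]. *)
Lemma upstream_uniform (R : realType) (gamma p0 u0 rho0 thetaW : R)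
    (f : R -> R) (p u v rho : R * R -> R) (z1 : R * R) :
  1 < gamma -> 0 < p0 -> 0 < u0 -> 0 < rho0 -> 1 < mach0 gamma p0 u0 rho0 ->
  0 < thetaW < pi / 2 ->
  transonic_shock_solution gamma p0 u0 rho0 thetaW f p u v rho ->
  positive_upto (Dplus thetaW f) u ->
  0 <= z1.2 -> 0 <= z1.1 <= f z1.2 ->
  let A := Dminus thetaW f in
  [/\ trace A p z1 = p0, trace A u z1 = u0, trace A v z1 = 0 & trace A rho z1 = rho0].
Proof.
move=> g1 p00 u00 r0 M th sol up z12 z11 A.
have Hf := solution_front_curve th sol.
have cu0 := supersonic_upstream g1 p00 u00 r0 M.
set b0 := bernoulli_constant gamma p0 u0 rho0 in cu0.
set cs := critical_speed2 gamma b0 in cu0.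
have cs0 : 0 < cs.
  rewrite /cs /critical_speed2 /b0 -bernoulli_constantE//.
  have h1 : 0 < u0 ^+ 2 by rewrite exprn_gt0.
  have h2 : 0 < gamma * p0 / rho0 / (gamma - 1).
    by rewrite divr_gt0 ?subr_gt0// divr_gt0// mulr_gt0// (lt_trans ltr01).
  rewrite mulr_gt0//.
    by rewrite divr_gt0//; [rewrite mulr_gt0// subr_gt0|clear -g1; lra].
  by rewrite expr0n/= addr0 addr_gt0// divr_gt0.
(* The square of [u1] is halfway between the critical value and [u0^2]. *)
pose u1 := Num.sqrt ((cs + u0 ^+ 2) / 2).
have m0 : 0 < (cs + u0 ^+ 2) / 2 by rewrite divr_gt0// addr_gt0// exprn_gt0.
have u10 : 0 < u1 by rewrite sqrtr_gt0.
have u1E : u1 ^+ 2 = (cs + u0 ^+ 2) / 2 by rewrite sqr_sqrtr// ltW.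
have csu1 : cs < u1 ^+ 2 by rewrite u1E; clear -cu0; lra.
have u1u0 : u1 < u0.
  rewrite -(ltr_pXn2r (_ : (0 < 2)%N)) ?nnegrE ?ltW// u1E.
  by clear -cu0; lra.
pose K := 2 * b0 / (u1 ^+ 2 - cs) + 1.
have KE : 2 * b0 / (u1 ^+ 2 - cs) < K by rewrite ltrDl.
have data z : z.1 = 0 -> 0 <= z.2 ->
    [/\ trace A p z = p0, trace A u z = u0, trace A v z = 0 & trace A rho z = rho0].
  by move=> h1 h2; apply: (tss_Sigma0 sol).
pose c := z1.1 + 1.
have setting t : (forall z, upstream_cone f K c z1.2 t z -> u1 <= trace A u z) ->
    upstream_setting gamma p0 u0 rho0 thetaW f p u v rho u1 K c z1.2 t.
  move=> fast; split; [exact: g1|exact: p00|exact: u00|exact: r0|exact: Hf| |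
    exact: data| |by rewrite u10 ltW|exact: csu1|exact: KE|exact: fast].
  - exact: solution_flow g1 th sol (or_introl erefl).
  - by move=> y y0 h; exact: (solution_spacelike g1 th sol up u10 csu1 y0 h).
have K0 : 0 < K.
  have b00 : 0 < b0.
    move: cs0; rewrite /cs /critical_speed2 pmulr_rgt0//.
    by rewrite divr_gt0//; [rewrite mulr_gt0// subr_gt0|clear -g1; lra].
  by rewrite /K addr_gt0// divr_gt0 ?subr_gt0// mulr_gt0.
have z1N : upstream_cone f K c z1.2 z1.1 z1.
  split=> //; rewrite subrr normr0 /c.
  have -> : z1.1 + 1 - z1.1 = 1 by ring.
  by rewrite mulr1 ltW.
apply: (upstream_uniform_in_cone (setting z1.1 _) z1N).
move=> z Nz; rewrite leNgt; apply/negP => slow.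
pose N := upstream_cone f K c z1.2 z1.1.
pose B := N `&` [set x | trace A u x <= u1].
have cN : compact N by exact: (@upstream_cone_compact _ _ _ _ c z1.2 z1.1 Hf K0).
have NA : N `<=` closure A by move=> x Nx; exact: upstream_cone_closure Hf Nx.
have flm := solution_flow g1 th sol (or_introl erefl).
have cu : {within N, continuous (trace A u)}.
  exact: continuous_subspaceW NA (fu_cont flm (Or42 _ _ _ erefl)).
have cB : compact B.
  apply: (@subclosed_compact _ _ N) => //; last by move=> x [].
  move=> x clx; have Nx : N x.
    have /closure_id -> : closed N by apply: compact_closed => //; exact: norm_hausdorff.
    by apply: closureS clx => y [].
  split; first exact: Nx.
  rewrite /= leNgt; apply/negP => h.
  have e0 : 0 < trace A u x - u1 by rewrite subr_gt0.
  move/within_planeP : (cu) => /(_ x Nx _ e0)[d [d0 dP]].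
  have [y [[Ny yu] [y1 y2]]] := clx _ (nbhsx_ballx x _ d0).
  rewrite /ball/= in y1 y2.
  have := dP y Ny; rewrite ![`|y.1 - _|]distrC ![`|y.2 - _|]distrC => /(_ y1 y2).
  rewrite ltr_norml => /andP[+ _]; move: yu => /=.
  by move: (trace A u y) (trace A u x) => a b; clear; lra.
have B0 : B !=set0 by exists z; split; [exact: Nz|exact: ltW].
have cx : {within B, continuous (fun x : R * R => - x.1)}.
  by apply: continuous_subspaceT => x; apply: cvgN; exact: cvg_fst.
have [z2 + z2min] := compact_EVT_max B0 cB cx.
rewrite inE => -[Nz2 /= z2u].
have Nt2 x : upstream_cone f K c z1.2 z2.1 x -> N x.
  case=> a1 a2 a3 a4; split=> //; apply: le_trans a4 _.
  by case: Nz2.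
have fast x : upstream_cone f K c z1.2 z2.1 x -> u1 <= trace A u x.
  move=> Nx; have Nx' := Nt2 x Nx; rewrite leNgt; apply/negP => xu.
  have Bx : x \in B by rewrite inE; split; [exact: Nx'|exact: ltW].
  have x1 : x.1 = z2.1.
    apply/eqP; rewrite eq_le; case: Nx => _ _ _ -> /=.
    by rewrite -lerN2; exact: z2min.
  have [x20 /andP[x10 xf] xK _] := Nx'.
  have [x0|x0] := eqVneq x.1 0.
    have [_ ux _ _] := data x x0 x20.
    by move: xu; rewrite ux ltNge ltW.
  have {}x0 : 0 < x.1 by rewrite lt_neqAle eq_sym x0.
  have e0 : 0 < u1 - trace A u x by rewrite subr_gt0.
  move/within_planeP : (cu) => /(_ x Nx' _ e0)[d [d0 dP]].
  pose r := Num.min (d / 2) x.1.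
  have rp : 0 < r by rewrite lt_min divr_gt0.
  have rd : r < d by rewrite gt_min; apply/orP; left; clear -d0; lra.
  have rx : r <= x.1 by rewrite ge_min lexx orbT.
  (* A horizontal step to the left stays in the cone and in the slow set. *)
  pose y : R * R := (x.1 - r, x.2).
  have Ny : N y.
    split=> /=.
    - exact: x20.
    - by rewrite subr_ge0 rx/= (le_trans _ xf)// gerBl ltW.
    - by apply: le_trans xK _; rewrite ler_pM2l//; clear -rp; lra.
    - by case: Nx' => _ _ _ h; apply: le_trans h; rewrite gerBl ltW.
  have yd1 : `|y.1 - x.1| < d.
    have -> : y.1 - x.1 = - r by rewrite /=; ring.
    by rewrite normrN gtr0_norm.
  have yd2 : `|y.2 - x.2| < d by rewrite subrr normr0.
  have := dP y Ny yd1 yd2; rewrite ltr_norml => /andP[_ h].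
  have yu : trace A u y <= u1.
    by move: h; move: (trace A u y) (trace A u x) => a b; clear; lra.
  have By : y \in B by rewrite inE.
  by have := z2min y By; rewrite -x1 /= lerN2 leNgt ltrBlDr ltrDl rp.
have Nz2' : upstream_cone f K c z1.2 z2.1 z2 by case: Nz2.
have [_ U2 _ _] := upstream_uniform_in_cone (setting z2.1 fast) Nz2'.
by move: z2u; rewrite U2 leNgt u1u0.
Qed.

(** * Straightening the downstream sector *)

Lemma within_continuous_plane_comp (R : realType) (Q C : set (R * R))
    (G h1 h2 : R * R -> R) :
  {within C, continuous G} -> {within Q, continuous h1} ->
  {within Q, continuous h2} -> (forall z, Q z -> C (h1 z, h2 z)) ->
  {within Q, continuous (fun z => G (h1 z, h2 z))}.
Proof.
move=> /within_planeP cG /within_planeP c1 /within_planeP c2 QC.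
apply/within_planeP => z Qz e e0; have [d [d0 dP]] := cG _ (QC z Qz) e e0.
have [d1 [d10 d1P]] := c1 z Qz d d0; have [d2 [d20 d2P]] := c2 z Qz d d0.
exists (Num.min d1 d2); split; first by rewrite lt_min d10.
move=> z' Qz'; rewrite !lt_min => /andP[a1 a2] /andP[b1 b2].
by apply: dP; [exact: QC|exact: d1P|exact: d2P].
Qed.

(** The increment estimates hold uniformly up to the side [s = 0], so the limit of
    the vertical derivatives is the derivative along that side. *)
Lemma C1_rectangle_boundary (R : realType) (a b y : R) (F F1 F2 : R * R -> R) :
  C1_rectangle a b F F1 F2 -> a < y < b ->
  is_derive y (1 : R) (fun t => F (0, t)) (F2 (0, y)).
Proof.
move=> [cF _ cF2 _ dF] /andP[ay yb]; apply/is_derive1_epsP => e e0.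
have cQ : compact (rectangle a b) by exact: compact_rectangle.
have [d [d0 dP]] := compact_uniform_continuity cQ cF2 e0.
have s01 : (0 : R) <= (0 : R) <= 1 by apply/andP; split => //; exact: ler01.
have Qy : rectangle a b (0, y) by apply/rectangleP; split; [exact: s01|rewrite /= (ltW ay) (ltW yb)].
exists (Num.min d (Num.min (y - a) (b - y))); split.
  by rewrite !lt_min d0 !subr_gt0 ay.
move=> t; rewrite !lt_min => /and3P[t1 t2 t3].
have [ty|ty|ty] := ltgtP t y; last first.
- by rewrite ty; have -> : y - y = 0 by [ring]; rewrite mulr0 subr0 subrr normr0 mulr0.
- have h1 : t <= b by move: t3; rewrite ltr_norml => /andP[_]; clear; lra.
  have h2 : t - d < y < y + d.
    by move: t1; rewrite ltr_norml => /andP[_]; clear -d0; move=> ?; apply/andP; split; lra.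
  have h3 : `|(0 : R) - (0, y).1| < d by rewrite subrr normr0.
  have := vertical_increment cF dF dP s01 (ltW ay) ty h1 Qy h3 h2.
  rewrite [(t - y) * _]mulrC => h; apply: le_trans h _.
  by rewrite gtr0_norm ?subr_gt0.
- have h1 : a <= t by move: t2; rewrite ltr_norml => /andP[+ _]; clear; lra.
  have h2 : y - d < y < t + d.
    by move: t1; rewrite ltr_norml => /andP[+ _]; clear -d0; move=> ?; apply/andP; split; lra.
  have h3 : `|(0 : R) - (0, y).1| < d by rewrite subrr normr0.
  have := vertical_increment cF dF dP s01 h1 ty (ltW yb) Qy h3 h2.
  have -> : F (0, y) - F (0, t) - (y - t) * F2 (0, y) =
    - (F (0, t) - F (0, y) - F2 (0, y) * (t - y)) by ring.
  rewrite normrN => h; apply: le_trans h _.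
  by rewrite distrC gtr0_norm ?subr_gt0.
Qed.

(** The downstream sector is straightened into the strip [0 <= s <= 1], the
    front being [s = 0] and the ramp [s = 1]. *)
Definition sector_width (R : realType) (T : R) (f : R -> R) (y : R) : R :=
  y / T - f y.

Definition sector_x (R : realType) (T : R) (f : R -> R) (z : R * R) : R :=
  f z.2 + z.1 * sector_width T f z.2.

Definition sector_xy (R : realType) (T : R) (f : R -> R) (z : R * R) : R :=
  derive1 f z.2 + z.1 * (T^-1 - derive1 f z.2).

Definition pullback (R : realType) (T : R) (f : R -> R) (G : R * R -> R)
    (z : R * R) : R := G (sector_x T f z, z.2).

Lemma sector_closure (R : realType) (theta : R) (f : R -> R) (a b : R) (z : R * R) :
  front_curve (tan theta) f -> 0 < a -> rectangle a b z ->
  (closure (Dplus theta f) `\` [set vertex R]) (sector_x (tan theta) f z, z.2).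
Proof.
move=> Hf a0 /rectangleP[/andP[z1 z1'] /andP[z2 _]].
have z20 : 0 < z.2 by exact: lt_le_trans z2.
have /andP[_ fT] := fc_domain Hf z20.
have w0 : 0 <= sector_width (tan theta) f z.2 by rewrite subr_ge0 ltW.
split; last by move=> -[_ h]; rewrite h ltxx in z20.
apply: Dplus_closure => //=; first exact: ltW.
rewrite /sector_x; apply/andP; split; first by rewrite lerDl mulr_ge0.
rewrite -lerBrDl; have : z.1 * sector_width (tan theta) f z.2 <= 1 * sector_width (tan theta) f z.2.
  by rewrite ler_wpM2r.
by rewrite mul1r.
Qed.

Lemma sector_interior (R : realType) (theta : R) (f : R -> R) (z : R * R) :
  front_curve (tan theta) f -> 0 < z.2 -> 0 < z.1 < 1 ->
  Dplus theta f (sector_x (tan theta) f z, z.2).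
Proof.
move=> Hf z2 /andP[z1 z1']; have /andP[_ fT] := fc_domain Hf z2.
have w0 : 0 < sector_width (tan theta) f z.2 by rewrite subr_gt0.
apply/DplusP => //=; split=> //; first by rewrite ltrDl mulr_gt0.
rewrite -ltrBrDl; have : z.1 * sector_width (tan theta) f z.2 < 1 * sector_width (tan theta) f z.2.
  by rewrite ltr_pM2r.
by rewrite mul1r.
Qed.

Lemma front_function_continuous (R : realType) (a b : R) (g : R -> R) (z : R * R) :
  0 < a -> (forall y, 0 < y -> {for y, continuous g}) -> rectangle a b z ->
  (fun x : R * R => g x.2) @ within (rectangle a b) (nbhs z) --> g z.2.
Proof.
move=> a0 cg /rectangleP[_ /andP[z2 _]].
apply: (continuous_cvg _ (cg _ (lt_le_trans a0 z2))).
by apply: cvg_within_filter; exact: cvg_snd.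
Qed.

Lemma pullback_C1 (R : realType) (theta : R) (f : R -> R) (a b : R)
    (G G1 G2 : R * R -> R) :
  let A := Dplus theta f in let T := tan theta in
  front_curve T f -> 0 < a ->
  {within closure A, continuous G} ->
  {within closure A `\` [set vertex R], continuous G1} ->
  {within closure A `\` [set vertex R], continuous G2} ->
  (forall z, A z -> has_grad G z (G1 z) (G2 z)) ->
  C1_rectangle a b (pullback T f G)
    (fun z => pullback T f G1 z * sector_width T f z.2)
    (fun z => pullback T f G1 z * sector_xy T f z + pullback T f G2 z).
Proof.
move=> A T Hf a0 cG cG1 cG2 gG; set Q := rectangle a b.
have cf y : 0 < y -> {for y, continuous f}.
  by move=> y0; exact: is_derive_continuous (front_curve_derive Hf y0).
have cf' y : 0 < y -> {for y, continuous (derive1 f)}.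
  by move=> y0; exact: is_derive_continuous (front_curve_derive2 Hf y0).
have c1 (z : R * R) : (fun x : R * R => x.1) @ within Q (nbhs z) --> z.1.
  by apply: cvg_within_filter; exact: cvg_fst.
have c2 (z : R * R) : (fun x : R * R => x.2) @ within Q (nbhs z) --> z.2.
  by apply: cvg_within_filter; exact: cvg_snd.
have cw (z : R * R) : Q z -> (fun x : R * R => sector_width T f x.2) @ within Q (nbhs z)
    --> sector_width T f z.2.
  move=> Qz; apply: cvgB; last exact: front_function_continuous a0 cf Qz.
  by apply: cvgMr_tmp; exact: c2.
have cx : {within Q, continuous (sector_x T f)}.
  apply/subspace_continuousP => z Qz.
  apply: cvgD; first exact: front_function_continuous a0 cf Qz.
  exact: cvgM (c1 z) (cw z Qz).
have cxy z : Q z -> sector_xy T f @ within Q (nbhs z) --> sector_xy T f z.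
  move=> Qz; have h := front_function_continuous a0 cf' Qz.
  apply: cvgD; first exact: h.
  apply: cvgM; first exact: c1.
  by apply: cvgB; [exact: cvg_cst|exact: h].
have c2' : {within Q, continuous (fun x : R * R => x.2)}.
  by apply/subspace_continuousP => z _; exact: c2.
have QC z : Q z -> closure A (sector_x T f z, z.2).
  by move=> Qz; case: (sector_closure Hf a0 Qz).
have QC' z : Q z -> (closure A `\` [set vertex R]) (sector_x T f z, z.2).
  exact: sector_closure Hf a0.
have k0 : {within Q, continuous (pullback T f G)} := within_continuous_plane_comp cG cx c2' QC.
have k1 : {within Q, continuous (pullback T f G1)} := within_continuous_plane_comp cG1 cx c2' QC'.
have k2 : {within Q, continuous (pullback T f G2)} := within_continuous_plane_comp cG2 cx c2' QC'.
move: (k1) (k2) => /subspace_continuousP k1' /subspace_continuousP k2'.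
have ydom (z : R * R) : a <= z.2 <= b -> 0 < z.2.
  by move=> /andP[h _]; exact: lt_le_trans h.
split; first exact: k0.
- by apply/subspace_continuousP => z Qz; exact: cvgM (k1' z Qz) (cw z Qz).
- apply/subspace_continuousP => z Qz; apply: cvgD; last exact: k2'.
  exact: cvgM (k1' z Qz) (cxy z Qz).
- move=> z z1 /ydom z2; have Az := sector_interior Hf z2 z1.
  have d1 : is_derive z.1 (1 : R) (fun s => sector_x T f (s, z.2)) (sector_width T f z.2).
    have k : is_derive z.1 (1 : R) (fun s : R => f z.2 + s * sector_width T f z.2)
        (sector_width T f z.2).
      apply: (is_derive_eq (is_deriveD (is_derive_cst _ _ _)
        (is_deriveM (is_derive_id _ _) (is_derive_cst _ _ _)))).
      rewrite scaler0 !add0r; exact: mulr1.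
    exact: k.
  have h : (sector_x T f (z.1, z.2), z.2) = (sector_x T f z, z.2) by case: (z).
  apply: (is_derive_eq (gG _ Az _ _ _ _ _ d1 (is_derive_cst _ _ _) h)).
  by rewrite mulr0 addr0.
- move=> z z1 /ydom z2; have Az := sector_interior Hf z2 z1.
  have df := front_curve_derive Hf z2.
  have dw : is_derive z.2 (1 : R) (sector_width T f) (T^-1 - derive1 f z.2).
    have k : is_derive z.2 (1 : R) (fun y : R => y / T - f y) (T^-1 - derive1 f z.2).
      apply: (is_derive_eq (is_deriveB (is_deriveM (is_derive_id _ _) (is_derive_cst _ _ _)) df)).
      by rewrite scaler0 add0r; congr (_ - _); exact: mulr1.
    exact: k.
  have d1 : is_derive z.2 (1 : R) (fun y => sector_x T f (z.1, y)) (sector_xy T f z).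
    have k : is_derive z.2 (1 : R) (fun y : R => f y + z.1 * sector_width T f y)
        (sector_xy T f z).
      apply: (is_derive_eq (is_deriveD df (is_deriveM (is_derive_cst _ _ _) dw))).
      by rewrite scaler0 addr0.
    exact: k.
  have h : (sector_x T f (z.1, z.2), z.2) = (sector_x T f z, z.2) by case: (z).
  apply: (is_derive_eq (gG _ Az _ _ _ _ _ d1 (is_derive_id _ _) h)).
  by rewrite mulr1.
Qed.

(** * The elliptic system behind the front *)

Lemma quotient_grad (R : realType) (u v : R * R -> R) (z : R * R)
    (u1 u2 v1 v2 : R) : 0 < u z -> has_grad u z u1 u2 -> has_grad v z v1 v2 ->
  has_grad (fun x => v x / u x) z ((u z * v1 - v z * u1) / u z ^+ 2)
    ((u z * v2 - v z * u2) / u z ^+ 2).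
Proof.
move=> u0 hu hv; have un : u z != 0 by rewrite gt_eqF.
by apply: (has_grad_eq (has_gradM hv (has_gradV un hu))); field.
Qed.

(** In a subsonic flow the pair (pressure, slope of the velocity) satisfies a
    first-order elliptic system: its Jacobian determinant is a definite
    quadratic form in either gradient. *)
Lemma elliptic_jacobian (R : realType)
    (gamma p u v r p1 p2 u1 u2 v1 v2 r1 r2 : R) :
  1 < gamma -> 0 < p -> 0 < r -> 0 < u ->
  euler_relations gamma p u v r p1 p2 u1 u2 v1 v2 r1 r2 ->
  u ^+ 2 + v ^+ 2 < gamma * p / r ->
  let w1 := (u * v1 - v * u1) / u ^+ 2 in let w2 := (u * v2 - v * u2) / u ^+ 2 in
  0 <= w2 * p1 - w1 * p2 /\
  (w2 * p1 - w1 * p2 = 0 -> [/\ p1 = 0, p2 = 0, w1 = 0 & w2 = 0]).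
Proof.
move=> g1 p0 r0 u0 [_ _ _ K1 K2] sub w1 w2.
have gp : 0 < gamma * p by rewrite mulr_gt0// (lt_trans ltr01).
have u2n : 0 < u ^+ 2 by rewrite exprn_gt0.
have k0 : 0 < gamma * p * u ^+ 2 by rewrite mulr_gt0.
set e := gamma * p / r in K1 K2 sub.
have E : gamma * p * u ^+ 2 * (w2 * p1 - w1 * p2) =
  (e - (u ^+ 2 + v ^+ 2)) * (p1 ^+ 2 + p2 ^+ 2) + (u * p2 - v * p1) ^+ 2.
  have -> : gamma * p * u ^+ 2 * (w2 * p1 - w1 * p2) =
    (gamma * p * (u * v2 - v * u2)) * p1 - (gamma * p * (u * v1 - v * u1)) * p2.
    by rewrite /w1 /w2; field; rewrite gt_eqF.
  by rewrite K1 K2; ring.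
have d0 : 0 < e - (u ^+ 2 + v ^+ 2) by rewrite subr_gt0.
have q0 : 0 <= p1 ^+ 2 + p2 ^+ 2 by rewrite addr_ge0 ?sqr_ge0.
split.
  rewrite -(pmulr_rge0 _ k0) E addr_ge0 ?sqr_ge0//.
  by rewrite mulr_ge0// ltW.
move=> J; rewrite J mulr0 in E.
have h : (e - (u ^+ 2 + v ^+ 2)) * (p1 ^+ 2 + p2 ^+ 2) = 0.
  apply/eqP; rewrite eq_le mulr_ge0 ?(ltW d0)// andbT.
  by rewrite [leRHS]E lerDl sqr_ge0.
move/eqP: h; rewrite mulf_eq0 gt_eqF//= paddr_eq0 ?sqr_ge0//.
rewrite !sqrf_eq0 => /andP[/eqP p10 /eqP p20].
have k1 : gamma * p != 0 by rewrite gt_eqF.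
rewrite p10 p20 !mulr0 subrr in K1 K2.
split=> //.
- move/eqP: K1; rewrite mulf_eq0 (negbTE k1)/= => /eqP K1.
  by rewrite /w1 K1 mul0r.
- move/eqP: K2; rewrite mulf_eq0 (negbTE k1)/= => /eqP K2.
  by rewrite /w2 K2 mul0r.
Qed.

Definition front_pressure_slope (R : realType) (gamma a s : R) : R :=
  - (4 * a * s) / ((gamma + 1) * (1 + s ^+ 2) ^+ 2).

Lemma is_derive_front_pressure (R : realType) (gamma p0 a s : R) : 1 < gamma ->
  is_derive s (1 : R) (front_pressure gamma p0 a) (front_pressure_slope gamma a s).
Proof.
move=> g1; have s1 := slope_gt0 s.
have n1 : gamma + 1 != 0 by rewrite gt_eqF//; lra.
have n2 : 1 + s ^+ 2 != 0 by rewrite gt_eqF.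
have d1 : is_derive s (1 : R) (fun t : R => 1 + t * t) (2 * s).
  apply: (is_derive_eq (is_deriveD (is_derive_cst (1 : R) s 1)
    (is_deriveM (is_derive_id s 1) (is_derive_id s 1)))).
  by rewrite /GRing.scale/=; ring.
have n3 : 1 + s * s != 0 by rewrite -expr2.
have d2 := @is_deriveV R (fun t : R => 1 + t * t) s (2 * s) 1 n3 d1.
have d3 : is_derive s (1 : R)
  (fun t : R => (2 * a * (1 + t * t)^-1 - (gamma - 1) * p0) * (gamma + 1)^-1)
  (front_pressure_slope gamma a s).
  apply: (is_derive_eq (is_deriveM (is_deriveB (is_deriveM
    (is_derive_cst (2 * a) s 1) d2) (is_derive_cst ((gamma - 1) * p0) s 1))
    (is_derive_cst (gamma + 1)^-1 s 1))).
  rewrite /GRing.scale/= /front_pressure_slope; field.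
  by rewrite ?n1 ?n2 ?n3.
exact: d3.
Qed.

Lemma front_w_continuous (R : realType) (gamma p0 a : R) :
  1 < gamma -> 0 < p0 -> 0 < a -> continuous (front_w gamma p0 a).
Proof.
move=> g1 p00 a0 s.
have cs : (fun t : R => t ^+ 2) @ s --> s ^+ 2 by exact: exprn_continuous.
apply: cvgM.
  apply: cvgM; first by apply: cvgMl_tmp; exact: cvg_id.
  by apply: cvgB; [exact: cvg_cst|apply: cvgMl_tmp; exact: cs].
apply: cvgV; first by rewrite gt_eqF// front_w_den_gt0.
by apply: cvgD; [exact: cvg_cst|apply: cvgMl_tmp; exact: cs].
Qed.

Lemma front_pressure_slope_continuous (R : realType) (gamma a : R) :
  1 < gamma -> continuous (front_pressure_slope gamma a).
Proof.
move=> g1 s; have g0 : 0 < gamma + 1 by lra.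
have cs : (fun t : R => t ^+ 2) @ s --> s ^+ 2 by exact: exprn_continuous.
apply: cvgM.
  by apply: cvgN; apply: cvgMl_tmp; exact: cvg_id.
apply: cvgV; first by rewrite gt_eqF// mulr_gt0// exprn_gt0// slope_gt0.
apply: cvgMl_tmp; have c1 : (fun t : R => 1 + t ^+ 2) @ s --> 1 + s ^+ 2.
  by apply: cvgD; [exact: cvg_cst|exact: cs].
by rewrite [_ ^+ 2]expr2; apply: cvgM; exact: c1.
Qed.

(** The free boundary problem behind the front: a flow that is subsonic, with the
    slope of the velocity prescribed on the ramp, at the vertex and at infinity,
    and both the pressure and this slope given on the front by the inclination of
    the front. *)
Record downstream_setting (R : realType) (gamma b0 p0 a theta : R) (f : R -> R)
    (p u v rho : R * R -> R) : Prop := DownstreamSetting {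
  ds_gamma : 1 < gamma ;
  ds_p0 : 0 < p0 ;
  ds_a : gamma * p0 < a ;
  ds_front : front_curve (tan theta) f ;
  ds_flow : flow_up_to gamma b0 (Dplus theta f) p u v rho ;
  ds_u : forall z, closure (Dplus theta f) z -> 0 < trace (Dplus theta f) u z ;
  ds_subsonic : forall z, closure (Dplus theta f) z ->
    trace (Dplus theta f) u z ^+ 2 + trace (Dplus theta f) v z ^+ 2
    < gamma * trace (Dplus theta f) p z / trace (Dplus theta f) rho z ;
  ds_shock : forall y, 0 < y ->
    [/\ trace (Dplus theta f) p (f y, y) = front_pressure gamma p0 a (derive1 f y),
        w_trace (Dplus theta f) u v (f y, y) = front_w gamma p0 a (derive1 f y) &
        gamma * p0 * derive1 f y ^+ 2 < a - gamma * p0] ;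
  ds_ramp : forall z, ramp theta z -> w_trace (Dplus theta f) u v z = tan theta ;
  ds_vertex : w_trace (Dplus theta f) u v (vertex R) = tan theta ;
  ds_infinity : forall e : R, 0 < e -> exists K : R,
    forall z : R * R, (Dplus theta f `|` front f) z -> K < `|z| ->
      `|w_trace (Dplus theta f) u v z - tan theta| < e }.

Lemma w_trace_continuous (R : realType) (gamma b0 p0 a theta : R) (f : R -> R)
    (p u v rho : R * R -> R) :
  downstream_setting gamma b0 p0 a theta f p u v rho ->
  {within closure (Dplus theta f), continuous (w_trace (Dplus theta f) u v)}.
Proof.
move=> ds; have cu := fu_cont (ds_flow ds) (Or42 _ _ _ erefl).
have cv := fu_cont (ds_flow ds) (Or43 _ _ _ erefl).
apply/subspace_continuousP => z Az.
exact: cvg_quotient (ds_u ds Az) (within_cvg cv Az) (within_cvg cu Az).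
Qed.

Lemma w_near_vertex (R : realType) (gamma b0 p0 a theta : R) (f : R -> R)
    (p u v rho : R * R -> R) (e : R) :
  downstream_setting gamma b0 p0 a theta f p u v rho -> 0 < e ->
  exists y0 : R, 0 < y0 /\ forall y s : R, 0 < y < y0 -> 0 <= s <= 1 ->
    `|pullback (tan theta) f (w_trace (Dplus theta f) u v) (s, y) - tan theta| < e.
Proof.
move=> ds e0; have Hf := ds_front ds; have T0 := fc_tan Hf.
have Oc : closure (Dplus theta f) (vertex R).
  by apply: Dplus_closure => //=; rewrite (fc_0 Hf) mul0r lexx.
have /within_planeP/(_ _ Oc e e0)[d [d0 dP]] := w_trace_continuous ds.
exists (Num.min d (d * tan theta)); split; first by rewrite lt_min d0 mulr_gt0.
move=> y s /andP[y0]; rewrite lt_min => /andP[yd ydT] s01.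
have Q : rectangle y y (s, y) by apply/rectangleP; rewrite /= lexx.
have [Az _] := sector_closure Hf y0 Q.
have := dP _ Az; rewrite (ds_vertex ds); apply; rewrite /= subr0.
  have /andP[s0 s1] := s01.
  have /andP[fy fT] := fc_domain Hf y0.
  have w0 : 0 < sector_width (tan theta) f y by rewrite subr_gt0.
  have x0 : 0 <= sector_x (tan theta) f (s, y).
    by rewrite /sector_x/= addr_ge0 ?(ltW fy)// mulr_ge0// ltW.
  rewrite ger0_norm//; apply: (@le_lt_trans _ _ (y / tan theta)).
    rewrite /sector_x/= -lerBrDl.
    have : s * sector_width (tan theta) f y <= 1 * sector_width (tan theta) f y.
      by rewrite ler_wpM2r// ltW.
    by rewrite mul1r.
  by rewrite ltr_pdivrMr.
by rewrite gtr0_norm.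
Qed.

Lemma w_near_infinity (R : realType) (gamma b0 p0 a theta : R) (f : R -> R)
    (p u v rho : R * R -> R) (e : R) :
  downstream_setting gamma b0 p0 a theta f p u v rho -> 0 < e ->
  exists y0 : R, 0 < y0 /\ forall y s : R, y0 < y -> 0 <= s <= 1 ->
    `|pullback (tan theta) f (w_trace (Dplus theta f) u v) (s, y) - tan theta| < e.
Proof.
move=> ds e0; have Hf := ds_front ds; have T0 := fc_tan Hf.
have [K KP] := ds_infinity ds e0.
exists (Num.max K 1); split; first by rewrite lt_max ltr01 orbT.
move=> y s; rewrite gt_max => /andP[yK y1] /andP[s0 s1].
have y0 : 0 < y by exact: lt_trans y1.
have /andP[fy fT] := fc_domain Hf y0.
move: s1; rewrite le_eqVlt => /predU1P[->|s1].
  rewrite (_ : pullback _ _ _ _ = tan theta) ?subrr ?normr0//.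
  rewrite /pullback (ds_ramp ds)// /ramp/= /sector_x/= mul1r /sector_width.
  have -> : f y + (y / tan theta - f y) = y / tan theta by ring.
  by rewrite divr_gt0// divfK// gt_eqF.
apply: KP.
  move: s0; rewrite le_eqVlt => /predU1P[<-|s0]; last first.
    by left; apply: (@sector_interior _ theta f (s, y) Hf) => //=; rewrite s0.
  by right; split=> //=; rewrite /sector_x/= mul0r addr0.
apply: (lt_le_trans yK); rewrite -[leLHS](ger0_norm (ltW y0)).
by rewrite prod_normE/= le_max lexx orbT.
Qed.

(** * The slope of the velocity is constant behind the front *)

Lemma derive0_eq (R : realType) (G : R -> R) (x y : R) :
  (forall t : R, (x <= t <= y) || (y <= t <= x) -> is_derive t (1 : R) G 0) -> G x = G y.
Proof.
have main (a b : R) : a <= b -> (forall t : R, a <= t <= b -> is_derive t (1 : R) G 0) -> G a = G b.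
  move=> ab dG; have d1 t : t \in `]a, b[%R -> is_derive t (1 : R) G 0.
    by rewrite in_itv/= => /andP[t1 t2]; apply: dG; rewrite !ltW.
  have c1 : {within `[a, b], continuous G}.
    apply: derivable_within_continuous => t; rewrite in_itv/= => tab.
    by have [] := dG t tab.
  have [t _] := @MVT_segment _ G (fun=> 0) _ _ ab d1 c1.
  by rewrite mul0r => /eqP; rewrite subr_eq0 => /eqP.
move=> dG; case: (leP x y) => h.
  by apply: main => // t ht; apply: dG; rewrite ht.
by apply/esym; apply: main; [exact: ltW|move=> t ht; apply: dG; rewrite ht orbT].
Qed.

Lemma flux_determinant (R : realType) (k l m w1 w2 p1 p2 : R) :
  (k * w1) * l * (- p1 * m + - p2) - ((k * w1) * m + k * w2) * (- p1 * l)
  = k * l * (w2 * p1 - w1 * p2).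
Proof. by ring. Qed.

(** Stokes' formula for [A = Psi (w)] and [B = - p] on the straightened sector.
    On the ramp, near the vertex and far away [Psi (w)] is zero. On the front,
    [w] and [p] are functions of the inclination [f'], so that [Psi (w) dp] is an
    exact differential in [f']; its primitive takes equal values at both ends, as
    [Psi (w)] is zero on the arc of the polar between them. The Jacobian
    determinant of [(Psi (w), - p)] is [psi (w)] times that of the elliptic
    system, which has a sign. *)
Lemma flux_degenerate (R : realType) (gamma b0 p0 a theta : R) (f : R -> R)
    (p u v rho : R * R -> R) (Psi psi : R -> R) (e : R) :
  let A := Dplus theta f in let W := w_trace A u v in
  let W' (d : (R * R -> R) -> R * R -> R) z :=
    (trace A u z * trace A (d v) z - trace A v z * trace A (d u) z) / trace A u z ^+ 2 in
  downstream_setting gamma b0 p0 a theta f p u v rho ->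
  (forall x : R, is_derive x (1 : R) Psi (psi x)) -> continuous psi ->
  (forall x : R, 0 <= psi x) -> 0 < e ->
  (forall x : R, `|x - tan theta| < e -> Psi x = 0) ->
  (exists y1 y2 : R, 0 < y1 /\ forall y y' : R, 0 < y < y1 -> y2 < y' ->
    forall s : R, (derive1 f y <= s <= derive1 f y') || (derive1 f y' <= s <= derive1 f y) ->
    Psi (front_w gamma p0 a s) = 0) ->
  forall z, A z -> psi (W z) != 0 ->
    [/\ trace A (dx p) z = 0, trace A (dy p) z = 0, W' (@dx R) z = 0 & W' (@dy R) z = 0].
Proof.
move=> A W W' ds dPsi cpsi psi0 e0 Psi0 [y1 [y2 [y10 HG]]] z Az psiz.
have g1 := ds_gamma ds; have p00 := ds_p0 ds; have ag := ds_a ds.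
have Hf := ds_front ds; have fl := ds_flow ds; set T := tan theta in Hf Psi0.
have T0 : 0 < T := fc_tan Hf.
have gp0 : 0 < gamma * p0 by rewrite mulr_gt0// (lt_trans ltr01).
have a_0 : 0 < a by exact: lt_trans ag.
have is_p : [\/ p = p, p = u, p = v | p = rho] by exact: Or41.
have is_u : [\/ u = p, u = u, u = v | u = rho] by exact: Or42.
have is_v : [\/ v = p, v = u, v = v | v = rho] by exact: Or43.
have [z2 zf zT] := (DplusP z Hf).1 Az.
have [a1 [a10 a1P]] := w_near_vertex ds e0.
have [b1 [b10 b1P]] := w_near_infinity ds e0.
have [al [al0 ala1 aly1 alz]] : exists al : R, [/\ 0 < al, al < a1, al < y1 & al < z.2].
  have m0 : 0 < Num.min a1 (Num.min y1 z.2) by rewrite !lt_min a10 y10.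
  exists (Num.min a1 (Num.min y1 z.2) / 2).
  have : Num.min a1 (Num.min y1 z.2) / 2 < Num.min a1 (Num.min y1 z.2) by clear -m0; lra.
  by rewrite !lt_min => /and3P[? ? ?]; split=> //; rewrite divr_gt0.
have [be [beb1 bey2 bez]] : exists be : R, [/\ b1 < be, y2 < be & z.2 < be].
  exists (Num.max b1 (Num.max y2 z.2) + 1).
  have : Num.max b1 (Num.max y2 z.2) < Num.max b1 (Num.max y2 z.2) + 1 by rewrite ltrDl.
  by rewrite !gt_max => /and3P[? ? ?].
have ab : al < be by exact: lt_trans bez.
have cW := w_trace_continuous ds; rewrite -/A -/W in cW.
have sub1 : closure A `\` [set vertex R] `<=` closure A by move=> x [].
have cont' (F : R * R -> R) : {within closure A, continuous F} ->
    {within closure A `\` [set vertex R], continuous F} 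
    by move=> h; exact: (continuous_subspaceW sub1 h).
have cpsiW : {within closure A `\` [set vertex R], continuous (fun x => psi (W x))}.
  apply/subspace_continuousP => x Ax.
  exact: cvg_real_comp (cpsi _) (within_cvg (cont' _ cW) Ax).
have cW' d : {within closure A `\` [set vertex R], continuous (trace A (d u))} ->
    {within closure A `\` [set vertex R], continuous (trace A (d v))} ->
    {within closure A `\` [set vertex R], continuous (W' d)}.
  move=> cu' cv'; apply/subspace_continuousP => x Ax.
  have cu := within_cvg (cont' _ (fu_cont fl is_u)) Ax.
  have cv := within_cvg (cont' _ (fu_cont fl is_v)) Ax.
  have u0 : 0 < trace A u x by apply: (ds_u ds); case: Ax.
  apply: cvg_quotient; first by rewrite exprn_gt0.
    apply: cvgB.
      exact: cvgM cu (within_cvg cv' Ax).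
    exact: cvgM cv (within_cvg cu' Ax).
  by rewrite expr2; exact: (cvgM cu cu).
have [cux cuy] := fu_grad_cont fl is_u; have [cvx cvy] := fu_grad_cont fl is_v.
have [cpx cpy] := fu_grad_cont fl is_p.
pose GA x := Psi (W x); pose GA' d x := psi (W x) * W' d x.
pose GB x := - trace A p x; pose GB' (d : (R * R -> R) -> R * R -> R) x := - trace A (d p) x.
have gradW x : A x -> has_grad W x (W' (@dx R) x) (W' (@dy R) x).
  move=> Ax; apply: quotient_grad (fu_grad fl is_u Ax) (fu_grad fl is_v Ax).
  exact/(ds_u ds)/subset_closure.
have CA (c d : R) : 0 < c -> C1_rectangle c d (pullback T f GA)
    (fun x => pullback T f (GA' (@dx R)) x * sector_width T f x.2)
    (fun x => pullback T f (GA' (@dx R)) x * sector_xy T f x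
       + pullback T f (GA' (@dy R)) x).
  move=> c0; apply: pullback_C1 => //.
  - apply/subspace_continuousP => x Ax.
    exact: cvg_real_comp (is_derive_continuous (dPsi _)) (within_cvg cW Ax).
  - apply/subspace_continuousP => x Ax.
    exact: cvgM (within_cvg cpsiW Ax) (within_cvg (cW' _ cux cvx) Ax).
  - apply/subspace_continuousP => x Ax.
    exact: cvgM (within_cvg cpsiW Ax) (within_cvg (cW' _ cuy cvy) Ax).
  - by move=> x Ax; exact: has_grad_comp (gradW x Ax) (dPsi _).
have CB (c d : R) : 0 < c -> C1_rectangle c d (pullback T f GB)
    (fun x => pullback T f (GB' (@dx R)) x * sector_width T f x.2)
    (fun x => pullback T f (GB' (@dx R)) x * sector_xy T f x
       + pullback T f (GB' (@dy R)) x).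
  move=> c0; apply: pullback_C1 => //.
  - apply/subspace_continuousP => x Ax; apply: cvgN.
    exact: within_cvg (fu_cont fl is_p) Ax.
  - by apply/subspace_continuousP => x Ax; apply: cvgN; exact: within_cvg cpx Ax.
  - by apply/subspace_continuousP => x Ax; apply: cvgN; exact: within_cvg cpy Ax.
  - by move=> x Ax; exact: has_gradN (fu_grad fl is_p Ax).
have ydom (y : R) : al <= y -> 0 < y by exact: lt_le_trans.
have front_x y : (sector_x T f (0, y), y) = (f y, y) by rewrite /sector_x/= mul0r addr0.
(* On the front the slope stays in a bounded interval, where [Psi (w) dp] has a
   primitive as a function of the slope. *)
pose sm := Num.sqrt ((a - gamma * p0) / (gamma * p0)) + 1.
have sbound (y : R) : 0 < y -> - sm < derive1 f y < sm.
  move=> y0; have [_ _ sl] := ds_shock ds y0.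
  have q0 : 0 < (a - gamma * p0) / (gamma * p0) by rewrite divr_gt0 ?subr_gt0.
  have : `|derive1 f y| < Num.sqrt ((a - gamma * p0) / (gamma * p0)).
    rewrite -(ltr_pXn2r (_ : (0 < 2)%N)) ?nnegrE ?normr_ge0 ?sqrtr_ge0//.
    by rewrite real_normK ?num_real// sqr_sqrtr ?(ltW q0)// ltr_pdivlMr// mulrC.
  rewrite /sm ltr_norml; move: (Num.sqrt _) (derive1 f y) => x t.
  by clear; move=> /andP[? ?]; apply/andP; split; lra.
have sm0 : - sm < sm.
  have h : 0 < sm by rewrite /sm ltr_wpDl ?sqrtr_ge0.
  by apply: (lt_trans _ h); rewrite oppr_lt0.
have cG : {within `[- sm, sm], continuous
    (fun s => Psi (front_w gamma p0 a s) * front_pressure_slope gamma a s)}.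
  apply: continuous_subspaceT => s; apply: cvgM.
    apply: (continuous_cvg _ (is_derive_continuous (dPsi _))).
    exact: front_w_continuous.
  exact: front_pressure_slope_continuous.
have [G dG] := primitive_exists sm0 cG.
pose g y := - G (derive1 f y).
have PB (y : R) : 0 < y -> is_derive y (1 : R) (fun t => pullback T f GB (0, t))
    (- (front_pressure_slope gamma a (derive1 f y) * derive1 (derive1 f) y)).
  move=> y0.
  have near0 : \forall t \near y, - front_pressure gamma p0 a (derive1 f t)
      = pullback T f GB (0, t).
    have : \forall t \near y, 0 < t by exact: lt_nbhsr.
    apply: filterS => t t0; rewrite /pullback/= front_x /GB.
    by have [-> _ _] := ds_shock ds t0.
  apply: near_eq_is_derive near0 _; apply: is_deriveN.
  have h := @is_derive1_comp _ (front_pressure gamma p0 a) (derive1 f) y _ _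
    (is_derive_front_pressure p0 a _ g1) (front_curve_derive2 Hf y0).
  by apply: (is_derive_eq h); rewrite mulrC.
have bdry (y : R) : al <= y <= be -> is_derive y (1 : R) g
   (pullback T f GA (0, y) * (pullback T f (GB' (@dx R)) (0, y) * sector_xy T f (0, y)
       + pullback T f (GB' (@dy R)) (0, y))).
  move=> /andP[yal ybe]; have y0 := ydom y yal.
  have hal : 0 < al / 2 by rewrite divr_gt0.
  have yin : al / 2 < y < be + 1.
    by clear -yal ybe al0; apply/andP; split; lra.
  have [_ k1] := C1_rectangle_boundary (CB (al / 2) (be + 1) hal) yin.
  have [_ k2] := PB y y0.
  rewrite -k1 k2 /pullback/= front_x /GA.
  have [_ wE _] := ds_shock ds y0; rewrite /W wE.
  have h := @is_derive1_comp _ G (derive1 f) y _ _ (dG _ (sbound y y0))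
    (front_curve_derive2 Hf y0).
  by apply: (is_derive_eq (is_deriveN h)); rewrite mulrN; congr (- _); exact: esym (mulrA _ _ _).
have gab : g al = g be.
  rewrite /g; congr (- _); apply: derive0_eq => t ht.
  have al1 : 0 < al < y1 by rewrite al0.
  have Pt := HG al be al1 bey2 t ht.
  have be0 : 0 < be by exact: lt_trans ab.
  have tin : - sm < t < sm.
    have := sbound al al0; have := sbound be be0; move: ht.
    move: (derive1 f al) (derive1 f be) (sm) => x y s; clear.
    by move=> /orP[] /andP[? ?] /andP[? ?] /andP[? ?]; apply/andP; split; lra.
  by apply: (is_derive_eq (dG t tin)); rewrite Pt mul0r.
have PsiT : Psi T = 0 by apply: Psi0; rewrite subrr normr0.
have AT (y : R) : al <= y <= be -> pullback T f GA (1, y) = 0.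
  move=> /andP[/ydom y0 _].
  have rz : ramp theta (sector_x T f ((1 : R), y), y).
    rewrite /ramp/= /sector_x/= mul1r /sector_width.
    have -> : f y + (y / T - f y) = y / T by ring.
    by rewrite divr_gt0// divfK// gt_eqF.
  exact: (etrans (congr1 Psi (ds_ramp ds rz)) PsiT).
have Aa (s : R) : 0 <= s <= 1 -> pullback T f GA (s, al) = 0.
  by move=> s01; apply: Psi0; apply: a1P => //; rewrite al0.
have Ab (s : R) : 0 <= s <= 1 -> pullback T f GA (s, be) = 0.
  by move=> s01; apply: Psi0; exact: b1P.
have jac x : A x -> 0 <= W' (@dy R) x * trace A (dx p) x - W' (@dx R) x * trace A (dy p) x /\
   (W' (@dy R) x * trace A (dx p) x - W' (@dx R) x * trace A (dy p) x = 0 ->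
    [/\ trace A (dx p) x = 0, trace A (dy p) x = 0, W' (@dx R) x = 0 & W' (@dy R) x = 0]).
  move=> Ax; have cAx := subset_closure Ax; have [P0 Q0] := fu_pos fl cAx.
  exact: (elliptic_jacobian g1 P0 Q0 (ds_u ds cAx) (fu_relations fl Ax) (ds_subsonic ds cAx)).
have width (y : R) : 0 < y -> 0 < sector_width T f y.
  by move=> /(fc_domain Hf)/andP[_ h]; rewrite subr_gt0.
have Dge (x : R * R) : 0 < x.1 < 1 -> al <= x.2 <= be ->
  0 <= pullback T f (GA' (@dx R)) x * sector_width T f x.2 *
    (pullback T f (GB' (@dx R)) x * sector_xy T f x + pullback T f (GB' (@dy R)) x)
  - (pullback T f (GA' (@dx R)) x * sector_xy T f x + pullback T f (GA' (@dy R)) x)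
    * (pullback T f (GB' (@dx R)) x * sector_width T f x.2).
  move=> x1 /andP[/ydom x2 _]; have Ax := sector_interior Hf x2 x1.
  rewrite flux_determinant mulr_ge0//; last exact: (jac _ Ax).1.
  by rewrite mulr_ge0// ltW// width.
pose zz : R * R := ((z.1 - f z.2) / sector_width T f z.2, z.2).
have w0 := width _ z2.
have zzE : (sector_x T f zz, zz.2) = z.
  rewrite /sector_x /zz/= divfK ?gt_eqF//.
  by have -> : f z.2 + (z.1 - f z.2) = z.1 by [ring]; case: (z).
have zz1 : 0 < zz.1 < 1.
  have n0 : 0 < z.1 - f z.2 by rewrite subr_gt0.
  rewrite (divr_gt0 n0 w0)/= ltr_pdivrMr// mul1r.
  by rewrite /sector_width ltrD2r.
have zz2 : al < zz.2 < be by rewrite alz.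
have := stokes_degenerate ab (CA al be al0) (CB al be al0) AT Aa Ab Dge bdry gab zz1 zz2.
rewrite flux_determinant zzE => /eqP; rewrite mulf_eq0 mulf_eq0 (negbTE psiz) gt_eqF//=.
by move=> /eqP; exact: (jac z Az).2.
Qed.

Lemma is_derive_mul_norm (R : realType) (x : R) :
  is_derive x (1 : R) (fun t => t * `|t|) (2 * `|x|).
Proof.
apply/is_derive1_epsP => e e0; exists e; split=> // y ye.
apply: (@le_trans _ _ (`|y - x| * `|y - x|)); last by rewrite ler_wpM2r// ltW.
rewrite -normrM; have h : (y - x) * (y - x) = `|(y - x) * (y - x)|.
  by rewrite ger0_norm// -expr2 sqr_ge0.
rewrite -h ler_norml; clear -x y.
have q1 := mulr_ge0 (normr_ge0 x) (normr_ge0 y).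
have q2 : 0 <= x * x by rewrite -expr2 sqr_ge0.
have q3 : 0 <= y * y by rewrite -expr2 sqr_ge0.
have q4 : 0 <= (y - x) * (y - x) by rewrite -expr2 sqr_ge0.
move: q1; have [x0|x0] := leP 0 x; have [y0|y0] := leP 0 y;
  rewrite ?(ger0_norm x0) ?(ger0_norm y0) ?(ltr0_norm x0) ?(ltr0_norm y0) => q1;
  apply/andP; split; nra.
Qed.

(** Twice the signed square of the distance from [x] to the interval of the
    numbers of absolute value at most [e]. *)
Definition dead_zone (R : realType) (e x : R) : R :=
  (x - e) * `|x - e| + (x + e) * `|x + e| - 4 * e * x.

Definition dead_zone_slope (R : realType) (e x : R) : R :=
  2 * `|x - e| + 2 * `|x + e| - 4 * e.

Lemma is_derive_dead_zone (R : realType) (e T x : R) :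
  is_derive x (1 : R) (fun t => dead_zone e (t - T)) (dead_zone_slope e (x - T)).
Proof.
have shift (k : R) : is_derive x (1 : R) (fun t : R => (t - T + k) * `|t - T + k|)
    (2 * `|x - T + k|).
  have d1 : is_derive x (1 : R) (fun t : R => t - T + k) 1.
    apply: (is_derive_eq (is_deriveD (is_deriveB (is_derive_id x 1)
      (is_derive_cst T x 1)) (is_derive_cst k x 1))).
    by rewrite subr0 addr0.
  have h := @is_derive1_comp R _ _ x _ _ (is_derive_mul_norm (x - T + k)) d1.
  by apply: (is_derive_eq h); rewrite mulr1.
have lin : is_derive x (1 : R) (fun t : R => 4 * e * (t - T)) (4 * e).
  apply: (is_derive_eq (is_deriveM (is_derive_cst (4 * e) x 1)
    (is_deriveB (is_derive_id x 1) (is_derive_cst T x 1)))).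
  by rewrite scaler0 addr0 subr0; exact: mulr1.
exact: (is_deriveB (is_deriveD (shift (- e)) (shift e)) lin).
Qed.

Lemma dead_zone_slope_continuous (R : realType) (e T : R) :
  continuous (fun t : R => dead_zone_slope e (t - T)).
Proof.
have c1 (k x : R) : (fun t : R => `|t - T + k|) @ x --> `|x - T + k|.
  apply: (@continuous_comp _ _ _ (fun t : R => t - T + k) (fun t : R => `|t|)).
    by apply: cvgD; [apply: cvgB; [exact: cvg_id|exact: cvg_cst]|exact: cvg_cst].
  exact: norm_continuous.
move=> x; apply: cvgB; last exact: cvg_cst.
by apply: cvgD; apply: cvgMl_tmp; [exact: (c1 (- e))|exact: (c1 e)].
Qed.

Lemma dead_zone_slope_ge0 (R : realType) (e x : R) : 0 <= dead_zone_slope e x.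
Proof.
have h : `|2 * e| <= `|x - e| + `|x + e|.
  by have -> : 2 * e = (x + e) - (x - e) by [ring]; rewrite [leRHS]addrC ler_normB.
have := le_trans (ler_norm _) h; rewrite /dead_zone_slope.
by move: `|x - e| `|x + e| => *; clear h; lra.
Qed.

Lemma dead_zone_eq0 (R : realType) (e x : R) : 0 < e ->
  (dead_zone e x = 0) <-> (`|x| <= e).
Proof.
move=> e0; rewrite /dead_zone ler_norml.
have sq0 (t : R) : 2 * (t * t) = 0 -> t = 0.
  by move=> /eqP; rewrite mulf_eq0 pnatr_eq0/= mulf_eq0 orbb => /eqP.
have [h1|h1] := leP 0 (x - e); have [h2|h2] := leP 0 (x + e);
  rewrite ?(ger0_norm h1) ?(ger0_norm h2) ?(ltr0_norm h1) ?(ltr0_norm h2).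
- have -> : (x - e) * (x - e) + (x + e) * (x + e) - 4 * e * x = 2 * ((x - e) * (x - e)).
    by ring.
  split=> [/sq0 h|/andP[_ h]]; first by apply/andP; split; lra.
  by have -> : x - e = 0 by [lra]; rewrite !mulr0.
- by exfalso; lra.
- split=> _; [apply/andP; split; lra|ring].
- have -> : (x - e) * - (x - e) + (x + e) * - (x + e) - 4 * e * x = - (2 * ((x + e) * (x + e))).
    by ring.
  split=> [/eqP|/andP[h _]]; last by exfalso; lra.
  by rewrite oppr_eq0 => /eqP/sq0 h; exfalso; lra.
Qed.

(** The derivative is used inside [A] only, so that the ends may lie on its
    boundary. *)
Lemma segment_constant (R : realType) (A : set (R * R)) (F : R * R -> R)
    (x1 x2 d1 d2 : R) :
  {within closure A, continuous F} ->
  (forall s : R, 0 <= s <= 1 -> closure A (x1 + s * d1, x2 + s * d2)) ->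
  (forall s : R, 0 < s < 1 -> A (x1 + s * d1, x2 + s * d2)) ->
  (forall z, A z -> exists g1 g2, has_grad F z g1 g2 /\ g1 * d1 + g2 * d2 = 0) ->
  F (x1, x2) = F (x1 + d1, x2 + d2).
Proof.
move=> cF cA inA gF.
have dl (x d s : R) : is_derive s (1 : R) (fun t : R => x + t * d) d.
  apply: (is_derive_eq (is_deriveD (is_derive_cst x s 1)
    (is_deriveM (is_derive_id s 1) (is_derive_cst d s 1)))).
  by rewrite scaler0 !add0r; exact: mulr1.
have cl (x d : R) : {within `[(0 : R), 1], continuous (fun t : R => x + t * d)}.
  apply: continuous_subspaceT => s; exact: is_derive_continuous (dl x d s).
have c1 : {within `[(0 : R), 1], continuous (fun s : R => F (x1 + s * d1, x2 + s * d2))}.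
  apply: within_continuous_along cF (cl x1 d1) (cl x2 d2) _ => s.
  by rewrite /= in_itv/=; exact: cA.
have D (s : R) : s \in `](0 : R), 1[ ->
    is_derive s (1 : R) (fun s : R => F (x1 + s * d1, x2 + s * d2)) 0.
  rewrite in_itv/= => /inA/gF[g1 [g2 [hg <-]]].
  exact: (hg _ _ _ _ _ (dl x1 d1 s) (dl x2 d2 s) erefl).
have [t _] := @MVT_segment _ _ (fun=> 0) _ _ (@ler01 R) D c1.
by rewrite mul0r !mul0r !mul1r !addr0 => /eqP; rewrite subr_eq0 eq_sym => /eqP.
Qed.

Lemma horizontal_constant (R : realType) (theta : R) (f : R -> R)
    (F : R * R -> R) (x x' y : R) :
  front_curve (tan theta) f -> 0 < y ->
  {within closure (Dplus theta f), continuous F} ->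
  (forall z, Dplus theta f z -> exists g2, has_grad F z 0 g2) ->
  f y <= x -> x < x' -> x' <= y / tan theta -> F (x, y) = F (x', y).
Proof.
move=> Hf y0 cF gF x0 xx x1.
have E (s : R) : (x + s * (x' - x), y + s * 0) = (x + s * (x' - x), y).
  by rewrite mulr0 addr0.
have d0 : 0 < x' - x by rewrite subr_gt0.
have := @segment_constant _ _ F x y (x' - x) 0 cF; rewrite addr0 [x + _]addrC subrK.
apply=> [s /andP[s0 s1]|s /andP[s0 s1]|z Az].
- rewrite E; apply: Dplus_closure => //=; first exact: ltW.
  have h : s * (x' - x) <= 1 * (x' - x) by rewrite ler_wpM2r// ltW.
  have h' : 0 <= s * (x' - x) by rewrite mulr_ge0// ltW.
  by clear -h h' x0 x1; apply/andP; split; lra.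
- rewrite E; apply/DplusP => //=.
  have h : s * (x' - x) < 1 * (x' - x) by rewrite ltr_pM2r.
  have h' : 0 < s * (x' - x) by rewrite mulr_gt0.
  by clear -h h' x0 x1 y0; split=> //; lra.
- have [g2 hg] := gF z Az; exists 0, g2; split=> //.
  by rewrite mul0r mulr0 addr0.
Qed.

(** Take for [Psi] a C1 non-decreasing function that vanishes exactly at distance
    at most [e] from [tan theta]. The values of [w] at the two ends of the front
    are in this range; both ends lie on the monotone branch of the polar, so the
    arc between them is in the range as well. Where [w] is out of the range, its
    gradient is zero by the degenerate flux identity: thus [Psi (w)] is constant
    on horizontal lines, which end on the ramp. *)
Lemma deflection_constant (R : realType) (gamma b0 p0 a theta : R) (f : R -> R)
    (p u v rho : R * R -> R) (ss y1 y2 : R) :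
  let A := Dplus theta f in let W := w_trace A u v in
  downstream_setting gamma b0 p0 a theta f p u v rho ->
  (forall s t : R, ss <= s -> s < t -> gamma * p0 * t ^+ 2 <= a - gamma * p0 ->
      front_w gamma p0 a t < front_w gamma p0 a s) ->
  0 < y1 -> (forall y, 0 < y < y1 \/ (0 < y /\ y2 < y) -> ss <= derive1 f y) ->
  forall z, closure A z -> W z = tan theta.
Proof.
move=> A W ds dec y10 weak.
have Hf := ds_front ds; set T := tan theta in Hf *; have T0 : 0 < T := fc_tan Hf.
have cW := w_trace_continuous ds; rewrite -/A -/W in cW.
apply: (closure_constant cW) => z Az.
have is_u : [\/ u = p, u = u, u = v | u = rho] by exact: Or42.
have is_v : [\/ v = p, v = u, v = v | v = rho] by exact: Or43.
have fl := ds_flow ds.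
apply/eqP; rewrite -subr_eq0 -normr_le0; apply/ler_addgt0Pr => e e0; rewrite add0r.
have ef (y : R) : (sector_x T f ((0 : R), y), y) = (f y, y).
  by rewrite /sector_x/= mul0r addr0.
have o01 : (0 : R) <= (0 : R) <= 1 by rewrite lexx ler01.
have [a1 [a10 a1P]] := w_near_vertex ds e0.
have [b1 [b10 b1P]] := w_near_infinity ds e0.
have nearO (y : R) : 0 < y < a1 -> `|front_w gamma p0 a (derive1 f y) - T| < e.
  move=> ya; have := a1P y 0 ya o01; rewrite /pullback/= ef.
  by have /andP[y0 _] := ya; have [_ -> _] := ds_shock ds y0.
have nearI (y : R) : b1 < y -> `|front_w gamma p0 a (derive1 f y) - T| < e.
  move=> yb; have := b1P y 0 yb o01; rewrite /pullback/= ef.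
  by have [_ -> _] := ds_shock ds (lt_trans b10 yb).
have decw (s t : R) : ss <= s -> s <= t -> gamma * p0 * t ^+ 2 < a - gamma * p0 ->
    front_w gamma p0 a t <= front_w gamma p0 a s.
  move=> h; rewrite le_eqVlt => /predU1P[->//|st] ht.
  exact: ltW (dec _ _ h st (ltW ht)).
have between (y y' s : R) : 0 < y -> 0 < y' -> ss <= derive1 f y -> 
    `|front_w gamma p0 a (derive1 f y) - T| < e ->
    `|front_w gamma p0 a (derive1 f y') - T| < e ->
    derive1 f y <= s <= derive1 f y' -> `|front_w gamma p0 a s - T| < e.
  move=> y0 y0' sy hy hy' /andP[h1 h2].
  have [_ _ l'] := ds_shock ds y0'; have gp : 0 < gamma * p0.
    by rewrite mulr_gt0 ?(ds_p0 ds)// (lt_trans ltr01 (ds_gamma ds)).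
  have k1 := decw _ _ (le_trans sy h1) h2 l'.
  have k2 : front_w gamma p0 a s <= front_w gamma p0 a (derive1 f y).
    have [->//|ns] := eqVneq s (derive1 f y).
    have ls : derive1 f y < s by rewrite lt_neqAle eq_sym ns.
    have [_ _ l] := ds_shock ds y0.
    apply: decw => //; apply: le_lt_trans (_ : _ <= Num.max (gamma * p0 * derive1 f y ^+ 2)
      (gamma * p0 * derive1 f y' ^+ 2)) _; last by rewrite gt_max l l'.
    rewrite le_max !(ler_pM2l gp).
    have [s0|s0] := lerP 0 s; apply/orP; [right|left]; 
      move: h1 h2 s0; move: (derive1 f y) (derive1 f y') => d d'; clear => h1 h2 s0; nra.
  move: hy hy'; rewrite !ltr_norml; move: k1 k2; clear.
  by move=> ? ? /andP[? ?] /andP[? ?]; apply/andP; split; lra.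
have HG : exists y1 y2 : R, 0 < y1 /\ forall y y' : R, 0 < y < y1 -> y2 < y' ->
    forall s : R, (derive1 f y <= s <= derive1 f y') || (derive1 f y' <= s <= derive1 f y) ->
    dead_zone e (front_w gamma p0 a s - T) = 0.
  exists (Num.min a1 y1), (Num.max b1 y2); split; first by rewrite lt_min a10.
  move=> y y' /andP[y0]; rewrite lt_min => /andP[ya yy1].
  rewrite gt_max => /andP[yb yy2] s hs; apply/(dead_zone_eq0 _ e0)/ltW.
  have y0' : 0 < y' := lt_trans b10 yb.
  have w1 : ss <= derive1 f y by apply: weak; left; rewrite y0.
  have w2 : ss <= derive1 f y' by apply: weak; right.
  have n1 : `|front_w gamma p0 a (derive1 f y) - T| < e by apply: nearO; rewrite y0.
  have n2 := nearI _ yb.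
  by case/orP: hs; [exact: between|exact: between].
have zero := flux_degenerate ds (is_derive_dead_zone e T) (dead_zone_slope_continuous (e := e) (T := T))
  (fun x => dead_zone_slope_ge0 e (x - T)) e0
  (fun x h => (dead_zone_eq0 _ e0).2 (ltW h)) HG.
have gradW x : A x -> exists g2, has_grad (fun x => dead_zone e (W x - T)) x 0 g2.
  move=> Ax; have h := quotient_grad (ds_u ds (subset_closure Ax))
    (fu_grad fl is_u Ax) (fu_grad fl is_v Ax).
  have k := has_grad_comp h (is_derive_dead_zone e T _).
  eexists; apply: (has_grad_eq k); last reflexivity.
  have [->|nz] := eqVneq (dead_zone_slope e (W x - T)) 0; first exact: mul0r.
  have [_ _ h3 _] := zero x Ax nz.
  exact: (etrans (congr1 (fun t => dead_zone_slope e (W x - T) * t) h3) (mulr0 _)).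
have cG : {within closure A, continuous (fun x => dead_zone e (W x - T))}.
  apply/subspace_continuousP => x Ax.
  exact: cvg_real_comp (is_derive_continuous (is_derive_dead_zone e T _)) (within_cvg cW Ax).
have [z2 zf zT] := (DplusP z Hf).1 Az.
have := horizontal_constant Hf z2 cG gradW (ltW zf) zT (lexx _).
have -> : W (z.2 / T, z.2) = T.
  by apply: (ds_ramp ds); rewrite /ramp/= divr_gt0// divfK// gt_eqF.
rewrite subrr (_ : (z.1, z.2) = z); last by case: (z).
have -> : dead_zone e (0 : R) = 0 by apply/(dead_zone_eq0 _ e0); rewrite normr0 ltW.
by move=> /(dead_zone_eq0 _ e0).
Qed.

(** * The front is straight and the state behind it uniform *)

Lemma front_straight (R : realType) (T : R) (f : R -> R) (s : R) :
  front_curve T f -> (forall y, 0 < y -> derive1 f y = s) ->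
  forall y, 0 < y -> f y = s * y.
Proof.
move=> Hf fs y y0.
have c1 : {within `[0, y]%classic, continuous f}.
  by apply: continuous_subspaceW (fc_C0 Hf) => t; rewrite /= !in_itv/= => /andP[-> _].
have d1 (t : R) : t \in `]0, y[%R -> is_derive t (1 : R) f s.
  by rewrite in_itv/= => /andP[t0 _]; rewrite -(fs t t0); exact: front_curve_derive Hf t0.
have [t _] := @MVT _ f (fun=> s) _ _ y0 d1 c1.
by rewrite (fc_0 Hf) !subr0.
Qed.

(** The slope of the front cannot leave the branch [ss < s] on which the polar
    is injective: by continuity it would take the value [ss], where the polar
    lies strictly above the common value. *)
Lemma front_slope_constant (R : realType) (gamma p0 a T : R) (f : R -> R)
    (ss y1 : R) :
  front_curve T f ->
  (forall s t : R, ss <= s -> s < t -> gamma * p0 * t ^+ 2 <= a - gamma * p0 ->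
      front_w gamma p0 a t < front_w gamma p0 a s) ->
  (forall y, 0 < y -> gamma * p0 * derive1 f y ^+ 2 < a - gamma * p0) ->
  (forall y, 0 < y -> front_w gamma p0 a (derive1 f y) = T) ->
  0 < y1 -> ss < derive1 f y1 ->
  forall y, 0 < y -> derive1 f y = derive1 f y1.
Proof.
move=> Hf dec lim wT y10 sy1 y y0.
have [sy|sy] := leP ss (derive1 f y).
  have [lt|lt|//] := ltgtP (derive1 f y) (derive1 f y1).
    by have := dec _ _ sy lt (ltW (lim _ y10)); rewrite !wT// ltxx.
  by have := dec _ _ (ltW sy1) lt (ltW (lim _ y0)); rewrite !wT// ltxx.
have cf' (c d : R) : 0 < c -> {within `[c, d], continuous (derive1 f)}.
  move=> c0; apply: derivable_within_continuous => t; rewrite in_itv/= => /andP[ct _].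
  by have [] := front_curve_derive2 Hf (lt_le_trans c0 ct).
have [c c0 fc] : exists2 c : R, 0 < c & derive1 f c = ss.
  have [yy|yy] := leP y y1.
    have [|c] := IVT yy (cf' _ _ y0) (v := ss).
      by rewrite ge_min (ltW sy) le_max (ltW sy1) orbT.
    rewrite in_itv/= => /andP[yc _] h; exists c; last exact: h.
    exact: lt_le_trans yc.
  have [|c] := IVT (ltW yy) (cf' _ _ y10) (v := ss).
    by rewrite ge_min (ltW sy) orbT le_max (ltW sy1).
  rewrite in_itv/= => /andP[yc _] h; exists c; last exact: h.
    exact: lt_le_trans yc.
have := dec _ _ (lexx ss) sy1 (ltW (lim _ y10)).
by rewrite -fc !wT// ltxx.
Qed.

Lemma isobaric_streamline (R : realType)
    (gamma p u v r p1 p2 u1 u2 v1 v2 r1 r2 T : R) :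
  euler_relations gamma p u v r p1 p2 u1 u2 v1 v2 r1 r2 ->
  p1 = 0 -> p2 = 0 -> v = u * T -> 1 < gamma -> 0 < p -> 0 < r -> 0 < u ->
  u1 + u2 * T = 0 /\ r1 + r2 * T = 0.
Proof.
move=> [E1 E2 _ _ _] h1 h2 hv g1 p_0 r_0 u_0.
have gp : 0 < gamma * p by rewrite mulr_gt0// (lt_trans ltr01).
move: E1 E2; rewrite {}h1 {}h2 {}hv !mulr0 addr0 mulr0 oppr0 => /esym E1 E2.
have k1 : (gamma * p * u) * (r1 + r2 * T) = 0 by rewrite -E1; ring.
have k2 : (r * u) * (u1 + u2 * T) = 0 by rewrite -E2; ring.
move/eqP: k1; rewrite mulf_eq0 (gt_eqF (mulr_gt0 gp u_0))/= => /eqP ->.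
by move/eqP: k2; rewrite mulf_eq0 (gt_eqF (mulr_gt0 r_0 u_0))/= => /eqP ->.
Qed.

(** As [w] is constant, the Jacobian determinant of the elliptic system is zero,
    and with it the gradient of the pressure. Then the velocity and the density
    are constant along the streamlines, which are parallel to the ramp and come
    from the front. *)
Lemma downstream_uniform (R : realType) (gamma b0 p0 a theta : R) (f : R -> R)
    (p u v rho : R * R -> R) (ss y1 y2 : R) :
  let A := Dplus theta f in let T := tan theta in
  downstream_setting gamma b0 p0 a theta f p u v rho ->
  (forall s t : R, ss <= s -> s < t -> gamma * p0 * t ^+ 2 <= a - gamma * p0 ->
      front_w gamma p0 a t < front_w gamma p0 a s) ->
  0 < y1 -> (forall y, 0 < y < y1 \/ (0 < y /\ y2 < y) -> ss < derive1 f y) ->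
  exists s, [/\ ss < s, forall y : R, 0 < y -> derive1 f y = s,
    forall z, closure A z -> trace A p z = front_pressure gamma p0 a s,
    forall z, A z -> trace A v z = trace A u z * T &
    forall z, A z -> exists y : R, [/\ 0 < y, trace A u z = trace A u (f y, y) &
      trace A rho z = trace A rho (f y, y)]].
Proof.
move=> A T ds dec y10 weak.
have Hf := ds_front ds; rewrite -/T in Hf; have T0 : 0 < T := fc_tan Hf.
have fl := ds_flow ds.
have is_p : [\/ p = p, p = u, p = v | p = rho] by exact: Or41.
have is_u : [\/ u = p, u = u, u = v | u = rho] by exact: Or42.
have is_v : [\/ v = p, v = u, v = v | v = rho] by exact: Or43.
have is_r : [\/ rho = p, rho = u, rho = v | rho = rho] by exact: Or44.
have WT z : closure A z -> w_trace A u v z = T.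
  by apply: (@deflection_constant _ _ _ _ _ _ _ _ _ _ _ _ _ y2 ds dec y10) => y hy; exact: ltW (weak y hy).
have vE z : A z -> trace A v z = trace A u z * T.
  move=> Az; have U0 : trace A u z != 0 by rewrite gt_eqF// (ds_u ds (subset_closure Az)).
  rewrite -(WT z (subset_closure Az)) mulrC; exact: esym (divfK U0 _).
have fz y : 0 < y -> closure A (f y, y).
  move=> y0; apply: Dplus_closure => //=; first exact: ltW.
  by have /andP[_ /ltW ->] := fc_domain Hf y0; rewrite lexx.
have lim y : 0 < y -> gamma * p0 * derive1 f y ^+ 2 < a - gamma * p0.
  by move=> y0; have [_ _ ->] := ds_shock ds y0.
have frontT y : 0 < y -> front_w gamma p0 a (derive1 f y) = T.
  by move=> y0; have [_ <- _] := ds_shock ds y0; exact: WT (fz y y0).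
have h10 : 0 < y1 / 2 by rewrite divr_gt0.
have sy1 : ss < derive1 f (y1 / 2).
  by apply: weak; left; rewrite h10 ltr_pdivrMr// ltr_pMr// ltr1n.
set s := derive1 f (y1 / 2) in sy1.
have f's := front_slope_constant Hf dec lim frontT h10 sy1; rewrite -/s in f's.
have fs := front_straight Hf f's.
have sT : s < T^-1.
  by have /andP[_] := fc_domain Hf ltr01; rewrite fs// mulr1 mul1r.
have grad0 z : A z -> trace A (dx p) z = 0 /\ trace A (dy p) z = 0.
  move=> Az; have cAz := subset_closure Az; have [P0 Q0] := fu_pos fl cAz.
  have h := quotient_grad (ds_u ds cAz) (fu_grad fl is_u Az) (fu_grad fl is_v Az).
  have k : has_grad (fun x => trace A v x / trace A u x) z 0 0.
    apply: has_grad_near (@has_grad_cst R T z).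
    have : nbhs z A by apply: open_nbhs_nbhs; split; [exact: Dplus_open Hf|exact: Az].
    by apply: filterS => x Ax; rewrite -(WT x (subset_closure Ax)).
  have e1 := etrans (esym (has_grad_dxE h)) (has_grad_dxE k).
  have e2 := etrans (esym (has_grad_dyE h)) (has_grad_dyE k).
  have [_ H] := elliptic_jacobian (ds_gamma ds) P0 Q0 (ds_u ds cAz)
    (fu_relations fl Az) (ds_subsonic ds cAz).
  have J (w1 w2 q1 q2 : R) : w1 = 0 -> w2 = 0 -> w2 * q1 - w1 * q2 = 0.
    by move=> -> ->; rewrite !mul0r subrr.
  have [h1 h2 _ _] := H (J _ _ _ _ e1 e2).
  by split; [exact: h1|exact: h2].
have pE z : A z -> trace A p z = front_pressure gamma p0 a s.
  move=> Az; have [z2 zf zT] := (DplusP z Hf).1 Az.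
  have gp x : A x -> exists g2, has_grad (trace A p) x 0 g2.
    move=> Ax; exists (trace A (dy p) x); have [h _] := grad0 x Ax.
    exact: (has_grad_eq (fu_grad fl is_p Ax) h erefl).
  have := horizontal_constant Hf z2 (fu_cont fl is_p) gp (lexx _) zf (ltW zT).
  have [-> _ _] := ds_shock ds z2; rewrite (f's _ z2) => h.
  by rewrite [z]surjective_pairing -h.
have flow0 z : A z -> trace A (dx u) z + trace A (dy u) z * T = 0 /\
    trace A (dx rho) z + trace A (dy rho) z * T = 0.
  move=> Az; have cAz := subset_closure Az; have [P0 Q0] := fu_pos fl cAz.
  have U0 := ds_u ds cAz; rewrite -/A in P0 Q0 U0.
  have [e1 e2] := grad0 z Az.
  exact: isobaric_streamline (fu_relations fl Az) e1 e2 (vE z Az) (ds_gamma ds) P0 Q0 U0.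
have backwards z (F : R * R -> R) : A z -> [\/ F = p, F = u, F = v | F = rho] ->
    (forall x, A x -> trace A (dx F) x + trace A (dy F) x * T = 0) ->
    let y := (z.2 - z.1 * T) / (1 - s * T) in
    0 < y /\ trace A F z = trace A F (f y, y).
  move=> Az is_F F0 y; have [z2 zf zT] := (DplusP z Hf).1 Az.
  rewrite (fs _ z2) in zf; rewrite ltr_pdivlMr// in zT.
  have d0 : 0 < 1 - s * T by rewrite subr_gt0 -ltr_pdivlMr// mul1r.
  have y0 : 0 < y by rewrite divr_gt0// subr_gt0.
  split; [exact: y0|]; pose t := (z.1 - s * z.2) / (1 - s * T).
  have t0 : 0 < t by rewrite divr_gt0// subr_gt0.
  have z1E : z.1 = s * y + t by rewrite /t /y; field; rewrite gt_eqF.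
  have z2E : z.2 = y + t * T by rewrite /t /y; field; rewrite gt_eqF.
  have -> : z = (s * y + t, y + t * T) by rewrite -z1E -z2E; case: (z).
  have inside r : 0 < r -> A (s * y + r * t, y + r * (t * T)).
    move=> r0; have k0 : 0 < r * t by rewrite mulr_gt0.
    have k1 : s * y < y / T by rewrite [y / T]mulrC ltr_pM2r.
    have k2 : 0 < (r * t) * T by rewrite mulr_gt0.
    have k3 : s * ((r * t) * T) < r * t.
      by rewrite mulrCA gtr_pMr// -subr_gt0.
    apply/(DplusP _ Hf); rewrite /= mulrA fs ?addr_gt0//; split=> //.
    - by rewrite mulrDr ltrD2l.
    - by rewrite mulrDl mulfK ?gt_eqF// ltrD2r.
  have comb (g1 g2 : R) : g1 + g2 * T = 0 -> g1 * t + g2 * (t * T) = 0.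
    by move=> h; rewrite -(mulr0 t) -h; ring.
  rewrite (fs _ y0); apply/esym.
  apply: (@segment_constant _ A (trace A F) (s * y) y t (t * T) (fu_cont fl is_F)).
  - move=> r /andP[]; rewrite le_eqVlt => /predU1P[<- _|r0 _].
      by rewrite !mul0r !addr0 -(fs y y0); exact: fz.
    exact/subset_closure/inside.
  - by move=> r /andP[r0 _]; exact: inside.
  - move=> x Ax; exists (trace A (dx F) x), (trace A (dy F) x); split.
      exact: (fu_grad fl is_F Ax).
    exact: comb (F0 x Ax).
exists s; split=> //.
- exact: closure_constant (fu_cont fl is_p) pE.
- move=> z Az; have [y0 uE] := backwards z u Az is_u (fun x Ax => (flow0 x Ax).1).
  have [_ rE] := backwards z rho Az is_r (fun x Ax => (flow0 x Ax).2).
  by eexists; split; [exact: y0|exact: uE|exact: rE].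
Qed.

(** The inclination of the front is positive where the deflection is, and then a
    pressure below that of the slope [ss] means a slope larger than [ss]. *)
Lemma weak_front_ends (R : realType) (gamma b0 p0 a theta : R) (f : R -> R)
    (p u v rho : R * R -> R) (ss : R) :
  let A := Dplus theta f in
  downstream_setting gamma b0 p0 a theta f p u v rho -> 0 < ss ->
  trace A p (vertex R) < front_pressure gamma p0 a ss ->
  (exists K : R, forall z : R * R, front f z -> K < `|z| ->
     trace A p z < front_pressure gamma p0 a ss) ->
  exists y1 y2 : R, 0 < y1 /\
    forall y, 0 < y < y1 \/ (0 < y /\ y2 < y) -> ss < derive1 f y.
Proof.
move=> A ds ss0 pO [K KP].
have Hf := ds_front ds; set T := tan theta in Hf; have T0 : 0 < T := fc_tan Hf.
have fl := ds_flow ds; have is_p : [\/ p = p, p = u, p = v | p = rho] by exact: Or41.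
have a0 : 0 < a.
  by apply: lt_trans (ds_a ds); rewrite mulr_gt0 ?(ds_p0 ds)// (lt_trans ltr01 (ds_gamma ds)).
have ef (y : R) : (sector_x T f ((0 : R), y), y) = (f y, y).
  by rewrite /sector_x/= mul0r addr0.
have o01 : (0 : R) <= (0 : R) <= 1 by rewrite lexx ler01.
have [a1 [a10 a1P]] := w_near_vertex ds T0.
have [b1 [b10 b1P]] := w_near_infinity ds T0.
have branch (y : R) : 0 < y ->
    `|pullback T f (w_trace A u v) (0, y) - T| < T ->
    trace A p (f y, y) < front_pressure gamma p0 a ss -> ss < derive1 f y.
  move=> y0; rewrite /pullback/= ef; have [pE wE l] := ds_shock ds y0.
  rewrite pE wE ltr_distl subrr => /andP[w0 _].
  have s0 := front_w_gt0 (ds_gamma ds) (ds_p0 ds) a0 l w0.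
  by rewrite (front_pressure_lt p0 (ds_gamma ds) a0 (ltW s0) (ltW ss0)).
have Oc : closure A (vertex R).
  by apply: Dplus_closure => //=; rewrite (fc_0 Hf) mul0r lexx.
have e0 : 0 < front_pressure gamma p0 a ss - trace A p (vertex R) by rewrite subr_gt0.
have /within_planeP/(_ _ Oc _ e0)[d [d0 dP]] := fu_cont fl is_p.
exists (Num.min a1 (Num.min d (d * T))), (Num.max b1 K); split.
  by rewrite !lt_min a10 d0 mulr_gt0.
move=> y [/andP[y0]|[y0]].
  rewrite !lt_min => /and3P[ya yd ydT].
  apply: (branch y y0); first by apply: a1P; rewrite ?y0 ?ya.
  have /andP[f0 fT] := fc_domain Hf y0.
  have cz : closure A (f y, y) by apply: Dplus_closure => //=; [exact: ltW|rewrite lexx ltW].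
  have h1 : `|(f y, y).1 - (vertex R).1| < d.
    by rewrite /= subr0 gtr0_norm// (lt_trans fT)// ltr_pdivrMr.
  have h2 : `|(f y, y).2 - (vertex R).2| < d by rewrite /= subr0 gtr0_norm.
  have := dP _ cz h1 h2; rewrite ltr_norml => /andP[_].
  by rewrite ltrD2r.
rewrite gt_max => /andP[yb yK]; apply: (branch y y0); first exact: b1P.
apply: KP; first by split.
apply: (lt_le_trans yK); rewrite -[leLHS](ger0_norm (ltW y0)).
by rewrite prod_normE/= le_max lexx orbT.
Qed.

(** The shock relations, with the uniform upstream state, put the state behind
    the front on the shock polar. *)
Lemma solution_front_state (R : realType) (gamma p0 u0 rho0 thetaW : R)
    (f : R -> R) (p u v rho : R * R -> R) (y : R) :
  1 < gamma -> 0 < p0 -> 0 < u0 -> 0 < rho0 -> 1 < mach0 gamma p0 u0 rho0 ->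
  0 < thetaW < pi / 2 ->
  transonic_shock_solution gamma p0 u0 rho0 thetaW f p u v rho ->
  positive_upto (Dplus thetaW f) u -> 0 < y ->
  let A := Dplus thetaW f in let a := rho0 * u0 ^+ 2 in
  let P := trace A p (f y, y) in let s := derive1 f y in
  [/\ p0 < P, P = front_pressure gamma p0 a s,
    w_trace A u v (f y, y) = front_w gamma p0 a s,
    trace A u (f y, y) = u_behind p0 u0 rho0 P &
    trace A rho (f y, y) = rho_behind gamma p0 rho0 P].
Proof.
move=> g1 p00 u00 r00 M th sol up y0 A a P s.
have Hf := solution_front_curve th sol.
have /andP[f0 _] := fc_domain Hf y0.
have [_ cz [J1 J2 J3 J4]] := solution_jumps th sol y0.
have fy0 : 0 <= (f y, y).1 <= f (f y, y).2 by rewrite /= (ltW f0) lexx.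
have [e1 e2 e3 e4] := upstream_uniform g1 p00 u00 r00 M th sol up (ltW y0 : 0 <= (f y, y).2) fy0.
rewrite e2 e3 e4 in J1; rewrite e1 e2 e3 e4 in J2; rewrite e1 e2 e3 e4 in J3.
rewrite e1 in J4.
have fl := solution_flow g1 th sol (or_intror erefl).
have [_ Q0] := fu_pos fl cz.
have B := fu_bernoulli fl cz; rewrite -bernoulli_constantE// in B.
have B' : u0 ^+ 2 / 2 + gamma * p0 / rho0 / (gamma - 1) =
  (trace A u (f y, y) ^+ 2 + trace A v (f y, y) ^+ 2) / 2
    + gamma * P / trace A rho (f y, y) / (gamma - 1).
  by rewrite B expr0n/= addr0.
have [k1 k2 k3 k4] := shock_state g1 p00 r00 u00 Q0 J4 (up _ cz) J1 J2 J3 B'.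
by split; [exact: J4|exact: k1|exact: k3|exact: k2|exact: k4].
Qed.

Lemma solution_downstream (R : realType) (gamma p0 u0 rho0 thetaW : R)
    (f : R -> R) (p u v rho : R * R -> R) :
  1 < gamma -> 0 < p0 -> 0 < u0 -> 0 < rho0 -> 1 < mach0 gamma p0 u0 rho0 ->
  0 < thetaW < pi / 2 ->
  transonic_shock_solution gamma p0 u0 rho0 thetaW f p u v rho ->
  positive_upto (Dplus thetaW f) u ->
  w_trace (Dplus thetaW f) u v (vertex R) = tan thetaW ->
  (forall e : R, 0 < e -> exists K : R,
    forall z : R * R, (Dplus thetaW f `|` front f) z -> K < `|z| ->
      `|w_trace (Dplus thetaW f) u v z - tan thetaW| < e) ->
  downstream_setting gamma (bernoulli_constant gamma p0 u0 rho0) p0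
    (rho0 * u0 ^+ 2) thetaW f p u v rho.
Proof.
move=> g1 p00 u00 r00 M th sol up wO winf.
have fl := solution_flow g1 th sol (or_intror erefl).
have ag := (sqr_mach0 g1 p00 r00 u00).2 M.
split; [exact: g1|exact: p00|exact: ag|exact: solution_front_curve th sol|exact: fl|
  exact: up| | |exact: tss_ramp sol|exact: wO|exact: winf].
  move=> z cz; have [P0 Q0] := fu_pos fl cz.
  have e0 : 0 < gamma * trace (Dplus thetaW f) p z / trace (Dplus thetaW f) rho z.
    by rewrite divr_gt0// mulr_gt0// (lt_trans ltr01).
  exact: (mach_sonic_cmp _ _ e0).1 (tss_subsonic sol cz).
move=> y y0.
have [h1 h2 h3 _ _] := solution_front_state g1 p00 u00 r00 M th sol up y0.
split; [exact: h2|exact: h3|].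
by rewrite -(front_pressure_gt _ _ _ g1) -h2.
Qed.

Lemma shock_angle (R : realType) (gamma p0 u0 rho0 s : R) :
  1 < gamma -> 0 < p0 -> 0 < u0 -> 0 < rho0 -> 0 < s ->
  let a := rho0 * u0 ^+ 2 in let alpha := atan s^-1 in
  [/\ 0 < alpha < pi / 2, cos alpha / sin alpha = s &
    sin alpha = sin_shock_angle gamma p0 (mach0 gamma p0 u0 rho0)
      (front_pressure gamma p0 a s)].
Proof.
move=> g1 p00 u00 r00 s0 a alpha.
have tE : tan alpha = s^-1 by exact: atanK.
have cE : cos alpha = (Num.sqrt (1 + s^-1 ^+ 2))^-1 by exact: cos_atan.
have c0 : 0 < cos alpha by rewrite cE invr_gt0 sqrtr_gt0 slope_gt0.
have sE : sin alpha = s^-1 * cos alpha by rewrite -tE /tan divfK// gt_eqF.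
have sin0 : 0 < sin alpha by rewrite sE mulr_gt0// invr_gt0.
have hs : 0 < s^-1 by rewrite invr_gt0.
split.
- rewrite atan_ltpi2 andbT ltNge; apply/negP => h.
  have : sin alpha <= 0.
    have h2 : 0 <= sin (- alpha).
      apply: sin_ge0_pi; rewrite oppr_ge0 h/= lerNl.
      have := atan_gtNpi2 s^-1; rewrite -/alpha => k.
      apply: le_trans (ltW k); rewrite lerN2.
      by move: (pi_gt0 R); move: (pi : R) => x; clear; lra.
    by rewrite sinN oppr_ge0 in h2.
  by rewrite leNgt sin0.
- by rewrite sE invfM invrK mulrCA divff ?mulr1// gt_eqF.
have g0 : 0 < gamma by exact: lt_trans g1.
have a0 : 0 < a by rewrite mulr_gt0// exprn_gt0.
have M0 : 0 < mach0 gamma p0 u0 rho0.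
  by rewrite divr_gt0// sqrtr_gt0 divr_gt0// mulr_gt0.
have q : (gamma + 1) / (2 * gamma)
    * (front_pressure gamma p0 a s / p0 + (gamma - 1) / (gamma + 1))
    = mach0 gamma p0 u0 rho0 ^+ 2 / (1 + s ^+ 2).
  rewrite (sqr_mach0 g1 p00 r00 u00).1 -/a /front_pressure.
  have n1 : gamma + 1 != 0 by rewrite gt_eqF//; clear -g0; lra.
  have n2 : 1 + s ^+ 2 != 0 by rewrite gt_eqF// slope_gt0.
  have n3 : p0 != 0 by rewrite gt_eqF.
  have n4 : gamma != 0 by rewrite gt_eqF.
  by field; rewrite ?n1 ?n2 ?n3 ?n4.
rewrite /sin_shock_angle q sqrtrM ?sqr_ge0// sqrtr_sqr gtr0_norm//.
rewrite mulKf ?gt_eqF// sE cE -invfM sqrtrV ?(ltW (slope_gt0 s))//.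
congr (_^-1); rewrite -[X in X * _](ger0_norm (ltW s0)) -sqrtr_sqr -sqrtrM ?sqr_ge0//.
by congr (Num.sqrt _); field; rewrite gt_eqF.
Qed.

Unset Implicit Arguments.

Theorem theorem2p4 (R : realType) (gamma p0 u0 rho0 thetaW : R)
    (pstar psonic pweak : R)
    (f : R -> R) (p u v rho : R * R -> R) (pinf : R)
    (gamma_gt1 : 1 < gamma)
    (p0_gt0 : 0 < p0) (u0_gt0 : 0 < u0) (rho0_gt0 : 0 < rho0)
    (M0_gt1 : 1 < mach0 gamma p0 u0 rho0)
    (thetaW_bounds : 0 < thetaW < pi / 2)
    (pstarP : is_pstar gamma p0 (mach0 gamma p0 u0 rho0) pstar)
    (psonicP : is_psonic gamma p0 u0 rho0 pstar psonic)
    (tan_thetaW_bounds :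
      polar gamma p0 (mach0 gamma p0 u0 rho0) psonic < tan thetaW
        < polar gamma p0 (mach0 gamma p0 u0 rho0) pstar)
    (pweakP :
      is_pweak gamma p0 (mach0 gamma p0 u0 rho0) thetaW pstar psonic pweak)
    (solution : transonic_shock_solution gamma p0 u0 rho0 thetaW f p u v rho)
    (u_behind_gt0 : positive_upto (Dplus thetaW f) u)
    (w_at_infinity : forall e : R, 0 < e -> exists K : R,
      forall z : R * R, (Dplus thetaW f `|` front f) z -> K < `|z| ->
        `|w_trace (Dplus thetaW f) u v z - tan thetaW| < e)
    (pinf_lt_pstar : pinf < pstar)
    (p_at_infinity : exists K : R,
      forall z : R * R, front f z -> K < `|z| ->
        trace (Dplus thetaW f) p z < pinf)
    (w_at_vertex : w_trace (Dplus thetaW f) u v (vertex R) = tan thetaW)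
    (p_at_vertex : trace (Dplus thetaW f) p (vertex R) = pweak) :
  is_weak_solution gamma p0 u0 rho0 thetaW pweak f p u v rho.
Proof.
have ag := (sqr_mach0 gamma_gt1 p0_gt0 rho0_gt0 u0_gt0).2 M0_gt1.
have Hf := solution_front_curve thetaW_bounds solution.
have ds := solution_downstream gamma_gt1 p0_gt0 u0_gt0 rho0_gt0 M0_gt1
  thetaW_bounds solution u_behind_gt0 w_at_vertex w_at_infinity.
have [ss [ss0 ssE dec]] :=
  pstar_slope gamma_gt1 p0_gt0 rho0_gt0 u0_gt0 ag pstarP.
have [y1 [y2 [y10 weak]]] : exists y1 y2 : R, 0 < y1 /\
    forall y, 0 < y < y1 \/ (0 < y /\ y2 < y) -> ss < derive1 f y.
  apply: (weak_front_ends ds ss0).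
    by rewrite p_at_vertex ssE; case: pweakP => /andP[].
  have [K KP] := p_at_infinity; exists K => z zS Kz; rewrite ssE.
  exact: lt_trans (KP z zS Kz) pinf_lt_pstar.
have [s [ss_s f's pE vE stream]] := downstream_uniform ds dec y10 weak.
have s0 : 0 < s := lt_trans ss0 ss_s.
have pweakE : front_pressure gamma p0 (rho0 * u0 ^+ 2) s = pweak.
  rewrite -p_at_vertex pE//; apply: Dplus_closure => //=.
  by rewrite (fc_0 Hf) mul0r lexx.
have [angle cotE sinE] := shock_angle gamma_gt1 p0_gt0 u0_gt0 rho0_gt0 s0.
exists (atan s^-1); split.
- exact: angle.
- by rewrite sinE pweakE.
- by move=> y y0; rewrite cotE mulrC; exact: front_straight Hf f's y y0.
- move=> z Az; have [z2 z1 zf] := (DminusP z Hf).1 Az.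
  have z1f : 0 <= z.1 <= f z.2 by rewrite !ltW.
  have fl := solution_flow gamma_gt1 thetaW_bounds solution (or_introl erefl).
  have [e1 e2 e3 e4] := upstream_uniform gamma_gt1 p0_gt0 u0_gt0 rho0_gt0 M0_gt1
    thetaW_bounds solution u_behind_gt0 (ltW z2) z1f.
  by rewrite -e1 -e2 -e3 -e4 !(fu_inside fl)//;
    [exact: Or44|exact: Or43|exact: Or42|exact: Or41].
- move=> z Az; have fl := ds_flow ds.
  have [y [y0 uE rE]] := stream z Az.
  have [_ PE _ UE RE] := solution_front_state gamma_gt1 p0_gt0 u0_gt0 rho0_gt0
    M0_gt1 thetaW_bounds solution u_behind_gt0 y0.
  rewrite (f's y y0) pweakE in PE; rewrite PE in UE; rewrite PE in RE.
  have hp := pE z (subset_closure Az); have hv := vE z Az.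
  rewrite (fu_inside fl (Or41 _ _ _ erefl) Az) pweakE in hp.
  rewrite (fu_inside fl (Or42 _ _ _ erefl) Az) UE in uE.
  rewrite (fu_inside fl (Or44 _ _ _ erefl) Az) RE in rE.
  rewrite (fu_inside fl (Or43 _ _ _ erefl) Az)
    (fu_inside fl (Or42 _ _ _ erefl) Az) in hv.
  by split; [exact: hp|exact: uE|exact: hv|exact: rE].
Qed.
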